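(* Let $n\in\mathbb N$, let $S_2=\{k\in\mathbb Z:k<0\}\cup\{1,2,\dots,n\}\subseteq\mathbb Z$, and let $W\in\mathcal W_q'([-\pi,\pi))$. Then $$P_{S_2}I=I-\Big(\sum_{j=0}^nB_jB_j^*\Big)^{-1}\cdot\sum_{j=0}^nB_je_j\,(\Phi^* )^{-1},$$ $$\Delta_{S_2}=\Big(\sum_{j=0}^nB_jB_j^*\Big)^{-1},$$ and $$\delta_{S_2}=\Big[\det\Big(\sum_{j=0}^nB_jB_j^*\Big)\Big]^{-1/q}.$$
   Context: The group is $\mathbf G=\mathbb Z$, its dual group is identified with $[-\pi,\pi)$ (addition mod $2\pi$), $\lambda$ is normalized Lebesgue measure on $[-\pi,\pi)$, integrals are over $[-\pi,\pi)$, and $e_k(t)=\mathrm e^{ikt}$, $k\in\mathbb Z$. For $q\in\mathbb N=\{1,2,\dots\}$, $\mathbf M_q$ is the algebra of complex $q\times q$ matrices, $I$ the identity matrix (matrices are also viewed as constant functions), $\mathbf M_q'$ the set of matrices of determinant $1$, $\mathbf M_q^>$ the set of positive (definite) Hermitian matrices, $\mathrm{tr}$ the normalized trace ($\mathrm{tr}\,I=1$). $\mathcal W_q([-\pi,\pi))$ is the set of integrable $\mathbf M_q^>$-valued functions on $[-\pi,\pi)$, and $\mathcal W_q'([-\pi,\pi))$ the set of $W\in\mathcal W_q([-\pi,\pi))$ such that $\log\det W$ is integrable. $L^2(W)$ is the left Hilbert $\mathbf M_q$-module of (classes of) measurable $F:[-\pi,\pi)\to\mathbf M_q$ with $\mathrm{tr}(FWF^*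 )$ integrable, with $\mathbf M_q$-valued inner product $(F,G)=\int FWG^*\,d\lambda$ and norm $\|F\|=(\mathrm{tr}(F,F))^{1/2}$. For $S\subseteq\mathbb Z\setminus\{0\}$: $\mathcal M(S)$ is the closure in $L^2(W)$ of the set of finite sums $\sum_{k\in S}A_ke_k$ with $A_k\in\mathbf M_q$; $P_S$ is the orthogonal projection of $L^2(W)$ onto $\mathcal M(S)$; $\Delta_S=(I-P_SI,I-P_SI)$; and $\delta_S=\inf\{\|A-F\|^2:A\in\mathbf M_q',\ F\in\mathcal M(S)\}$. For $W\in\mathcal W_q'([-\pi,\pi))$, $\Phi$ denotes the unique outer function of the Hardy space $\mathbf H^2$ of $\mathbf M_q$-valued functions (outer: $\det\Phi$ is a scalar outer function) such that $W=\Phi^*\Phi$ and $\int\Phi\,d\lambda\in\mathbf M_q^>$. $B_j$ is the $j$-th Taylor coefficient, $j=0,1,2,\dots$, of the function $\Phi^{-1}$ (which is holomorphic in the unit disc but need not belong to $\mathbf H^2$). *)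

(* Defs.v *)
From mathcomp Require Import all_boot all_order all_algebra.
From mathcomp Require Import all_classical all_reals all_analysis.
From mathcomp Require Export complex.

Set Implicit Arguments.
Unset Strict Implicit.
Unset Printing Implicit Defensive.

Import Order.TTheory GRing.Theory Num.Theory numFieldNormedType.Exports.

Local Open Scope classical_set_scope.
Local Open Scope ring_scope.
Local Open Scope complex_scope.
Local Open Scope sesquilinear_scope.

Definition torus {R : realType} : set R := `[- pi, pi[.

Notation leb R := (@lebesgue_measure R).

(* Measurability is Borel measurability, as everywhere in the library. *)
Definition cmeasurable {R : realType} (f : R -> R[i]) : Prop :=
  measurable_fun torus (fun t => complex.Re (f t)) /\
  measurable_fun torus (fun t => complex.Im (f t)).

Definition cintegrable {R : realType} (f : R -> R[i]) : Prop :=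
  (leb R).-integrable torus (fun t => (complex.Re (f t))%:E) /\
  (leb R).-integrable torus (fun t => (complex.Im (f t))%:E).

(* Integral against Lebesgue measure on [-pi, pi) normalized to total mass 1. *)
Definition tint {R : realType} (f : R -> R) : R :=
  (2 * pi)^-1 * \int[leb R]_(t in torus) f t.

Definition cint {R : realType} (f : R -> R[i]) : R[i] :=
  tint (fun t => complex.Re (f t)) +i* tint (fun t => complex.Im (f t)).

Definition mxmeasurable {R : realType} {q : nat} (F : R -> 'M[R[i]]_q) : Prop :=
  forall i j, cmeasurable (fun t => F t i j).

Definition mxintegrable {R : realType} {q : nat} (F : R -> 'M[R[i]]_q) : Prop :=
  forall i j, cintegrable (fun t => F t i j).

Definition mxint {R : realType} {q : nat} (F : R -> 'M[R[i]]_q) : 'M[R[i]]_q :=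
  \matrix_(i, j) cint (fun t => F t i j).

Definition expi {R : realType} (k : int) (t : R) : R[i] :=
  cos (k%:~R * t) +i* sin (k%:~R * t).

Definition cexp {R : realType} (z : R[i]) : R[i] :=
  (expR (complex.Re z))%:C * (cos (complex.Im z) +i* sin (complex.Im z)).

(* The order on R[i] is such that [0 < z] means that z is real and positive. *)
Definition posdefmx {R : realType} {q : nat} (A : 'M[R[i]]_q) : Prop :=
  A \is hermsymmx /\
  forall v : 'rV[R[i]]_q, v != 0 -> 0 < (v *m A *m v ^t*) 0 0.

(* Normalized trace. *)
Definition ntr {R : realType} {q : nat} (A : 'M[R[i]]_q) : R[i] :=
  q%:R^-1 * \tr A.

Definition weight {R : realType} {q : nat} (W : R -> 'M[R[i]]_q) : Prop :=
  mxintegrable W /\ forall t, torus t -> posdefmx (W t).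

(* [\det (W t)] is a positive real, hence equal to its real part. *)
Definition logdet_weight {R : realType} {q : nat} (W : R -> 'M[R[i]]_q) : Prop :=
  weight W /\
  (leb R).-integrable torus (fun t => (ln (complex.Re (\det (W t))))%:E).

(* Elements of L^2(W) are represented by functions; [L2eq W] is equality of
   the classes of two functions that both represent elements of L^2(W). *)
Definition inL2 {R : realType} {q : nat} (W F : R -> 'M[R[i]]_q) : Prop :=
  mxmeasurable F /\ cintegrable (fun t => ntr (F t *m W t *m F t ^t*)).

Definition L2eq {R : realType} {q : nat} (W F G : R -> 'M[R[i]]_q) : Prop :=
  [/\ inL2 W F, inL2 W G & {ae leb R, forall t, torus t -> F t = G t}].

Definition inner {R : realType} {q : nat} (W F G : R -> 'M[R[i]]_q) :
    'M[R[i]]_q :=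
  mxint (fun t => F t *m W t *m G t ^t*).

Definition L2norm {R : realType} {q : nat} (W F : R -> 'M[R[i]]_q) : R :=
  Num.sqrt (complex.Re (ntr (inner W F F))).

Definition trigpoly {R : realType} {q : nat} (S : set int)
    (F : R -> 'M[R[i]]_q) : Prop :=
  exists (s : seq int) (A : int -> 'M[R[i]]_q),
    [/\ uniq s, (forall k, k \in s -> S k) &
        F = fun t => \sum_(k <- s) expi k t *: A k].

Definition Mspace {R : realType} {q : nat} (W : R -> 'M[R[i]]_q) (S : set int) :
    set (R -> 'M[R[i]]_q) :=
  [set F | inL2 W F /\
     forall eps : R, 0 < eps -> exists2 G, trigpoly S G &
       L2norm W (fun t => F t - G t) < eps].

(* Orthogonality is with respect to the matrix-valued inner product. *)
Definition is_orthproj {R : realType} {q : nat} (W : R -> 'M[R[i]]_q)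
    (S : set int) (F G : R -> 'M[R[i]]_q) : Prop :=
  Mspace W S G /\
  forall H, Mspace W S H -> inner W (fun t => F t - G t) H = 0.

(* P_S F, as a chosen representative of its class. *)
Definition orthproj {R : realType} {q : nat} (W : R -> 'M[R[i]]_q)
    (S : set int) (F : R -> 'M[R[i]]_q) : R -> 'M[R[i]]_q :=
  xget (fun=> 0) [set G | is_orthproj W S F G].

Definition Delta {R : realType} {q : nat} (W : R -> 'M[R[i]]_q) (S : set int) :
    'M[R[i]]_q :=
  let E := fun t => 1%:M - orthproj W S (fun=> 1%:M) t in inner W E E.

Definition delta {R : realType} {q : nat} (W : R -> 'M[R[i]]_q) (S : set int) :
    R :=
  inf [set r | exists (A : 'M[R[i]]_q) (F : R -> 'M[R[i]]_q),
         [/\ \det A = 1, Mspace W S F &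
             r = L2norm W (fun t => A - F t) ^+ 2]].

Definition fourier {R : realType} {q : nat} (F : R -> 'M[R[i]]_q) (k : int) :
    'M[R[i]]_q :=
  mxint (fun t => expi (- k) t *: F t).

(* The Hardy space H^2, through boundary functions. *)
Definition hardy2 {R : realType} {q : nat} (F : R -> 'M[R[i]]_q) : Prop :=
  [/\ mxmeasurable F,
      (forall i j, (leb R).-integrable torus
         (fun t => (complex.Re (`|F t i j| ^+ 2))%:E)) &
      forall k : int, k < 0 -> fourier F k = 0].

(* The holomorphic function on the unit disc with boundary function F in H^2;
   [R[i]^o] carries the topology of R[i]. *)
Definition disc_ext {R : realType} {q : nat} (F : R -> 'M[R[i]]_q) (z : R[i]) :
    'M[R[i]]_q :=
  \matrix_(i, j)
    limn (series (fun k : nat => fourier F k%:Z i j * z ^+ k : R[i]^o)).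

(* Scalar outer functions on the disc:
     f(z) = c exp(int (e^{it} + z) / (e^{it} - z) log psi(t) dlambda(t)). *)
Definition scalar_outer {R : realType} (f : R[i] -> R[i]) : Prop :=
  exists (c : R[i]) (psi : R -> R),
    [/\ `|c| = 1, (forall t, torus t -> 0 < psi t),
        (leb R).-integrable torus (fun t => (ln (psi t))%:E) &
        forall z : R[i], `|z| < 1 ->
          f z = c * cexp (cint (fun t =>
            (expi 1 t + z) / (expi 1 t - z) * (ln (psi t))%:C))].

Definition outer2 {R : realType} {q : nat} (F : R -> 'M[R[i]]_q) : Prop :=
  hardy2 F /\ scalar_outer (fun z => \det (disc_ext F z)).

Definition outer_factor {R : realType} {q : nat} (W Phi : R -> 'M[R[i]]_q) :
    Prop :=
  [/\ outer2 Phi,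
      {ae leb R, forall t, torus t -> W t = Phi t ^t* *m Phi t} &
      posdefmx (mxint Phi)].

(* f is the sum of the power series with coefficients B near 0. *)
Definition taylor_coefs {R : realType} {q : nat} (f : R[i] -> 'M[R[i]]_q)
    (B : nat -> 'M[R[i]]_q) : Prop :=
  exists2 r : R, 0 < r & forall z : R[i], `|z| < r%:C -> forall i j,
    series (fun k : nat => B k i j * z ^+ k : R[i]^o) @ \oo
      --> (f z i j : R[i]^o).

Definition S2 (n : nat) : set int :=
  [set k : int | k < 0 \/ 1 <= k <= n%:Z].

(* Main.v *)
Require Import Defs.
From mathcomp Require Import all_boot all_order all_algebra.
From mathcomp Require Import all_classical all_reals all_analysis.
From mathcomp Require Import perm measurable_realfun lebesgue_integrable ring lra.

(** F |-> F Phi^* is an isometry of L^2(W) into the unweighted L^2; it sends [I - P_S I] to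
    [U = K^-1 sum_(j <= n) B_j e_j], where [K = sum_(j <= n) B_j B_j^*]. Indeed, since [B] is
    the Taylor sequence of [Phi^-1], the function [(sum_(j <= k) B_j e_j) Phi] has no
    frequency [m <= k] other than [m = 0], which makes [U] orthogonal to the image of M(S_2),
    and [int U U^* = int U Phi = K^-1]. That [Phi^* - U] lies in the image of M(S_2) is where
    outerness is used: there are analytic matrix polynomials [P] with [P(0) = Phi(0)^-1] and
    [Phi P] close to [I] in L^2, and replacing [Phi^-1] by [P] in the formula and removing the
    frequency 0 gives trigonometric polynomials with frequencies in S_2.

    To find [P], let [T] be a Taylor polynomial of [Phi (r z)] and put [P = h adj(T)], where
    the scalar polynomial [h] is close to [e^g] and [Re g] is uniformly close to
    [- log (|det T|^2 + kappa (1 + |adj T|^2)) / 2]. Then [T P] has norm at most about that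
    of [I] pointwise. Since [log |det Phi|] is a Poisson integral, [|h(0) det Phi(0)|] is
    almost 1, that is, the mean of [Phi P] almost has the norm of [I]; hence [Phi P] is close
    to its mean.

    The value of delta is the minimum of [tr (A K^-1 A^* )] over [det A = 1], by AM-GM. *)

Set Implicit Arguments.
Unset Strict Implicit.
Unset Printing Implicit Defensive.

Import Order.TTheory GRing.Theory Num.Theory numFieldNormedType.Exports.

Local Open Scope classical_set_scope.
Local Open Scope ring_scope.
Local Open Scope complex_scope.
Local Open Scope sesquilinear_scope.

(** * Integration on the torus *)

(** [Phi^-1] is only holomorphic in the disc, so it has no usable Fourier series on the circle; each
    use of it is replaced by a statement about polynomials or about finitely many of its Taylor
    coefficients. Boundary limits are avoided as well: for a fixed radius r < 1 the polynomial T is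
    uniformly close to Phi(r z), so |det T|^2 is compared with the exponential of a Poisson
    integral, while T is close to Phi itself only in L^2. The form h adj(T) turns the search for an
    inverse into a scalar problem, where logarithms can be averaged. Two things resist: log |det
    Phi| is integrable but not bounded below, and T has only an L^2 bound. The term with kappa makes
    the logarithm Lipschitz and keeps P bounded. Its cost in the mean of the logarithm is small,
    because the part of the density of log |det Phi| below -K has small integral, and because |adj
    T|^2 enters under a logarithm, where a small multiple of |T|^2 dominates it. Completeness of
    L^2(W) is never invoked: the projection is exhibited, then shown to be unique up to null
    sets. *)

Lemma ae_leb_filter (R : realType) : Filter (nbhs (almost_everywhere (leb R))).
Proof. exact: (ae_filter_ringOfSetsType (@lebesgue_measure R)). Qed.
#[global] Existing Instance ae_leb_filter.

Section RealIntegral.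
Variable R : realType.
Implicit Types f g h : R -> R.

Definition tintegrable f := (leb R).-integrable torus (EFin \o f).

Lemma measurable_torus : measurable (torus : set R).
Proof. exact: measurable_itv. Qed.
#[local] Hint Resolve measurable_torus : core.

(* Integrals against [leb] live on [measurableTypeR R], whose display differs
   from the default one of [R]. *)
Let mT : @measurable _ (measurableTypeR R) torus.
Proof. exact: measurable_itv. Qed.

Lemma leb_torus : leb R torus = (2 * pi)%:E.
Proof.
rewrite /torus lebesgue_measure_itv /= lte_fin ifT; last first.
  by have := pi_gt0 R; lra.
by rewrite -EFinD; congr (_%:E); ring.
Qed.

Lemma tmeasurable f : tintegrable f -> measurable_fun torus f.
Proof. by move=> /measurable_int /measurable_EFinP. Qed.

Lemma tintegrable_le f g : measurable_fun torus f ->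
  (forall t, torus t -> `|f t| <= g t) -> tintegrable g -> tintegrable f.
Proof.
move=> mf fg; apply: le_integrable => //; first exact/measurable_EFinP.
move=> t Dt; rewrite /= lee_fin (le_trans (fg t Dt)) //.
exact: ler_norm.
Qed.

Lemma tintegrable_eq f g : (forall t, torus t -> f t = g t) ->
  tintegrable f -> tintegrable g.
Proof.
move=> fg; apply: eq_integrable => // t; rewrite inE => Dt /=.
by rewrite fg.
Qed.

Lemma tintegrable_cst (c : R) : tintegrable (fun=> c).
Proof.
apply: measurable_bounded_integrable => //.
  by apply: (@le_lt_trans _ _ (2 * pi)%:E); [rewrite -leb_torus|exact: ltry].
exists `|c|; split; first exact: num_real.
by move=> M cM t _; exact: ltW.
Qed.

Lemma tintegrableD f g : tintegrable f -> tintegrable g ->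
  tintegrable (fun t => f t + g t).
Proof. by move=> fi gi; exact: (integrableD _ fi gi). Qed.

Lemma tintegrableZ (c : R) f : tintegrable f -> tintegrable (fun t => c * f t).
Proof. by move=> fi; exact: (integrableZl _ _ fi). Qed.

Lemma tintegrableN f : tintegrable f -> tintegrable (fun t => - f t).
Proof. by move=> fi; exact: (integrableN fi). Qed.

Lemma tintegrableB f g : tintegrable f -> tintegrable g ->
  tintegrable (fun t => f t - g t).
Proof. by move=> fi gi; exact: (integrableB _ fi gi). Qed.

Lemma tintegrable_norm f : tintegrable f -> tintegrable (fun t => `|f t|).
Proof. by move=> fi; exact: (integrable_norm fi). Qed.

Lemma tintegrable_bounded f (c : R) : measurable_fun torus f ->
  (forall t, torus t -> `|f t| <= c) -> tintegrable f.
Proof. by move=> mf fc; apply: tintegrable_le (tintegrable_cst c). Qed.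

Lemma tintegrable_sum (I : Type) (s : seq I) (F : I -> R -> R) :
  (forall i, tintegrable (F i)) -> tintegrable (fun t => \sum_(i <- s) F i t).
Proof.
move=> Fi; elim: s => [|i s IH].
  by apply: tintegrable_eq (tintegrable_cst 0) => t _; rewrite big_nil.
by apply: tintegrable_eq (tintegrableD (Fi i) IH) => t _; rewrite big_cons.
Qed.

Lemma tint_eq f g : (forall t, torus t -> f t = g t) -> tint f = tint g.
Proof.
move=> fg; rewrite /tint; congr (_ * _); apply: eq_Rintegral => t.
by rewrite inE => /fg.
Qed.

Lemma tintD f g : tintegrable f -> tintegrable g ->
  tint (fun t => f t + g t) = tint f + tint g.
Proof. by move=> fi gi; rewrite /tint RintegralD // mulrDr. Qed.

Lemma tintZ (c : R) f : tintegrable f -> tint (fun t => c * f t) = c * tint f.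
Proof. by move=> fi; rewrite /tint RintegralZl // mulrCA. Qed.

Lemma tintN f : tintegrable f -> tint (fun t => - f t) = - tint f.
Proof.
by move=> fi; rewrite -mulN1r -tintZ //; apply: tint_eq => t _; rewrite mulN1r.
Qed.

Lemma tintB f g : tintegrable f -> tintegrable g ->
  tint (fun t => f t - g t) = tint f - tint g.
Proof. by move=> fi gi; rewrite /tint RintegralB // mulrBr. Qed.

Lemma tint_cst (c : R) : tint (fun=> c) = c.
Proof.
transitivity ((2 * pi)^-1 * (c * fine (leb R torus))).
  by congr (_ * _); exact: Rintegral_cst.
rewrite leb_torus /= mulrC mulfK //.
by rewrite mulf_neq0 // gt_eqF // pi_gt0.
Qed.

Lemma tint_sum (I : Type) (s : seq I) (F : I -> R -> R) :
  (forall i, tintegrable (F i)) ->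
  tint (fun t => \sum_(i <- s) F i t) = \sum_(i <- s) tint (F i).
Proof.
move=> Fi; elim: s => [|i s IH].
  rewrite big_nil; transitivity (tint (fun=> 0 : R)); last exact: tint_cst.
  by apply: tint_eq => t _; rewrite big_nil.
rewrite big_cons -IH -tintD //; last exact: tintegrable_sum.
by apply: tint_eq => t _; rewrite big_cons.
Qed.

Let ipi_ge0 : 0 <= (2 * pi : R)^-1.
Proof. by rewrite invr_ge0 mulr_ge0 // pi_ge0. Qed.

Lemma tint_ge0 f : (forall t, torus t -> 0 <= f t) -> 0 <= tint f.
Proof. by move=> f0; rewrite /tint mulr_ge0 // Rintegral_ge0. Qed.

Lemma le_tint f g : tintegrable f -> tintegrable g ->
  (forall t, torus t -> f t <= g t) -> tint f <= tint g.
Proof. by move=> fi gi fg; rewrite /tint ler_wpM2l // le_Rintegral. Qed.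

Lemma normr_tint f : tintegrable f -> `|tint f| <= tint (fun t => `|f t|).
Proof.
by move=> fi; rewrite /tint normrM ger0_norm // ler_wpM2l // le_normr_Rintegral.
Qed.

Definition taeeq (T : Type) (f g : R -> T) :=
  {ae leb R, forall t, torus t -> f t = g t}.

Lemma taeeq_int f g : measurable_fun torus f -> measurable_fun torus g ->
  taeeq f g -> tint f = tint g.
Proof.
move=> mf mg fg; rewrite /tint /Rintegral; congr (_ * fine _).
apply: ae_eq_integral => //; try exact/measurable_EFinP.
by apply: filterS fg => t fg Dt; rewrite fg.
Qed.

Lemma taeeq_integrable f g : measurable_fun torus g -> taeeq f g ->
  tintegrable f -> tintegrable g.
Proof.
move=> mg fg fi; have mf := tmeasurable fi.
(* The correction g - f vanishes almost everywhere, so its absolute integral is 0 and it is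
   integrable. *)
have -> : g = (fun t => f t + (g t - f t)) by apply/funext => t; ring.
apply: tintegrableD => //; apply/integrableP; split.
  by apply/measurable_EFinP; exact: measurable_funB.
have mgf : measurable_fun torus (EFin \o (fun t => g t - f t)).
  by apply/measurable_EFinP; exact: measurable_funB.
have [_ h] := ae_eq_integral_abs (leb R) mT mgf.
apply: (@le_lt_trans _ _ 0%E); last exact: ltry.
rewrite le_eqVlt; apply/orP; left; apply/eqP; apply: h.
by apply: filterS fg => t fg Dt /=; rewrite fg // subrr.
Qed.

Lemma tint_eq0 f : tintegrable f -> (forall t, torus t -> 0 <= f t) ->
  tint f = 0 -> taeeq f (fun=> 0).
Proof.
move=> fi f0 /eqP; rewrite /tint mulf_eq0 invr_eq0 mulf_eq0 pnatr_eq0 /=.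
rewrite gt_eqF ?pi_gt0 //= => /eqP I0.
have mf := measurable_int _ fi.
have /(ae_eq_integral_abs (leb R) mT mf) : 
    (\int[leb R]_(t in torus) `|(EFin \o f) t| = 0)%E.
  transitivity (\int[leb R]_(t in torus) (EFin \o f) t)%E.
    by apply: eq_integral => t; rewrite inE => Dt; rewrite gee0_abs //= lee_fin f0.
  by have := integrable_fin_num mT fi => /fineK <-; congr (_%:E).
by apply: filterS => t h Dt; have := h Dt => /= -[].
Qed.

Lemma tint_dominated (f_ : (R -> R)^nat) f g :
  (forall n, measurable_fun torus (f_ n)) -> measurable_fun torus f ->
  (forall t, torus t -> f_ ^~ t @ \oo --> f t) -> tintegrable g ->
  (forall n t, torus t -> `|f_ n t| <= g t) ->
  tint (f_ n) @[n --> \oo] --> tint f.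
Proof.
move=> mf_ mf ff gi fg; rewrite /tint; apply: cvgMl_tmp.
have fi : tintegrable f.
  apply: tintegrable_le gi => // t Dt.
  have h : `|f_ n t| @[n --> \oo] --> `|f t| by apply: cvg_norm; exact: ff.
  rewrite -(cvg_lim _ h) //; apply: limr_le; first by apply/cvg_ex; eexists; exact: h.
  by apply: nearW => n; exact: fg.
have ffE t : torus t -> (f_ n t)%:E @[n --> \oo] --> (f t)%:E.
  by move=> Dt; apply: cvg_EFin; [exact: nearW|exact: ff].
have h : (\int[leb R]_(t in torus) (f_ n t)%:E)%E @[n --> \oo] -->
    (\int[leb R]_(t in torus) (f t)%:E)%E.
  apply: (dominated_cvg mT (g := EFin \o g)) => //.
  by move=> n; apply/measurable_EFinP; exact: mf_.
rewrite /Rintegral; apply/fine_cvg; rewrite fineK //.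
exact: integrable_fin_num.
Qed.

End RealIntegral.
#[export] Hint Resolve measurable_torus : core.

(** * Complex scalars: squared modulus and exponentials *)

Section ComplexScalars.
Variable R : realType.
Implicit Types (x y z : R[i]).
Local Notation Re := complex.Re.
Local Notation Im := complex.Im.

Lemma ReD x y : Re (x + y) = Re x + Re y. Proof. by case: x; case: y. Qed.
Lemma ImD x y : Im (x + y) = Im x + Im y. Proof. by case: x; case: y. Qed.
Lemma ReN x : Re (- x) = - Re x. Proof. by case: x. Qed.
Lemma ImN x : Im (- x) = - Im x. Proof. by case: x. Qed.
Lemma ReB x y : Re (x - y) = Re x - Re y. Proof. by rewrite ReD ReN. Qed.
Lemma ImB x y : Im (x - y) = Im x - Im y. Proof. by rewrite ImD ImN. Qed.
Lemma ReM x y : Re (x * y) = Re x * Re y - Im x * Im y.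
Proof. by case: x; case: y. Qed.
Lemma ImM x y : Im (x * y) = Re x * Im y + Im x * Re y.
Proof. by case: x => a b; case: y => c d /=; ring. Qed.
Lemma conjE x : Num.conj x = Re x -i* Im x.
Proof. by case: x. Qed.
Lemma ReJ x : Re (Num.conj x) = Re x. Proof. by rewrite conjE. Qed.
Lemma ImJ x : Im (Num.conj x) = - Im x. Proof. by rewrite conjE. Qed.

Lemma Re_sum (I : Type) (s : seq I) (P : pred I) (F : I -> R[i]) :
  Re (\sum_(i <- s | P i) F i) = \sum_(i <- s | P i) Re (F i).
Proof. exact: (big_morph _ ReD). Qed.

Lemma Im_sum (I : Type) (s : seq I) (P : pred I) (F : I -> R[i]) :
  Im (\sum_(i <- s | P i) F i) = \sum_(i <- s | P i) Im (F i).
Proof. exact: (big_morph _ ImD). Qed.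

Lemma complex_ext x y : Re x = Re y -> Im x = Im y -> x = y.
Proof. by case: x => a b; case: y => c d /= -> ->. Qed.

(** The squared modulus as an element of [R]. The norm of [R[i]] takes values in [R[i]], so
    estimates and integrals go through [nsq], which also avoids square roots. *)
Definition nsq z : R := Re z ^+ 2 + Im z ^+ 2.

Lemma nsq_ge0 z : 0 <= nsq z.
Proof. by rewrite addr_ge0 ?sqr_ge0. Qed.

Lemma nsq0 : nsq 0 = 0. Proof. by rewrite /nsq /=; ring. Qed.
Lemma nsq1 : nsq 1 = 1. Proof. by rewrite /nsq /=; ring. Qed.
Lemma nsqN z : nsq (- z) = nsq z.
Proof. by rewrite /nsq ReN ImN !sqrrN. Qed.
Lemma nsqJ z : nsq (Num.conj z) = nsq z.
Proof. by rewrite /nsq ReJ ImJ sqrrN. Qed.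
Lemma nsqM x y : nsq (x * y) = nsq x * nsq y.
Proof. by rewrite /nsq ReM ImM; ring. Qed.
Lemma nsq_real (a : R) : nsq a%:C = a ^+ 2.
Proof. by rewrite /nsq /=; ring. Qed.

Lemma nsq_eq0 z : (nsq z == 0) = (z == 0).
Proof.
rewrite /nsq paddr_eq0 ?sqr_ge0 // !sqrf_eq0.
by case: z => a b /=; rewrite eq_complex.
Qed.

Lemma nsqV z : nsq z^-1 = (nsq z)^-1.
Proof.
have [->|z0] := eqVneq z 0; first by rewrite invr0 nsq0 invr0.
apply: (mulfI (x := nsq z)); first by rewrite nsq_eq0.
by rewrite -nsqM !mulfV ?nsq1 // nsq_eq0.
Qed.

Lemma nsqX z n : nsq (z ^+ n) = nsq z ^+ n.
Proof. by elim: n => [|n IH]; rewrite ?nsq1 // !exprS nsqM IH. Qed.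

Lemma normc_nsq z : `|z| = (Num.sqrt (nsq z))%:C.
Proof. by rewrite normc_def. Qed.

Lemma Re_normc_sqr z : Re (`|z| ^+ 2) = nsq z.
Proof. by rewrite -add_Re2_Im2. Qed.

Lemma mulcJ_nsq z : z * Num.conj z = (nsq z)%:C.
Proof. by rewrite conjE; case: z => a b; apply: complex_ext; rewrite /nsq /=; ring. Qed.

Lemma Re_nsq z : Re z ^+ 2 <= nsq z. Proof. by rewrite lerDl sqr_ge0. Qed.
Lemma Im_nsq z : Im z ^+ 2 <= nsq z. Proof. by rewrite lerDr sqr_ge0. Qed.

(* [2 ab <= e a^2 + b^2 / e] *)
Lemma nsqD_le (e : R) x y : 0 < e ->
  nsq (x + y) <= (1 + e) * nsq x + (1 + e^-1) * nsq y.
Proof.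
move=> e0; rewrite -subr_ge0.
have -> : (1 + e) * nsq x + (1 + e^-1) * nsq y - nsq (x + y) =
    e^-1 * nsq (e%:C * x - y).
  rewrite /nsq !(ReD, ImD, ReN, ImN, ReM, ImM) /=.
  by field; rewrite gt_eqF.
by rewrite mulr_ge0 ?nsq_ge0 // invr_ge0 ltW.
Qed.

Lemma nsqD_le2 x y : nsq (x + y) <= 2 * nsq x + 2 * nsq y.
Proof. by have := @nsqD_le 1 x y ltr01; rewrite invr1; lra. Qed.

(** Cauchy-Schwarz against the constant vector, by induction: with weight n in [nsqD_le] the new
    term gets the factor 1 + n and the old sum (1 + 1/n) n, which is again 1 + n. *)
Lemma nsq_sum_le (I : Type) (s : seq I) (F : I -> R[i]) :
  nsq (\sum_(i <- s) F i) <= (size s)%:R * \sum_(i <- s) nsq (F i).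
Proof.
elim: s => [|i s IH]; first by rewrite !big_nil nsq0 mul0r.
case: s IH => [_|j s IH].
  by rewrite !big_seq1 mul1r.
rewrite big_cons [in leRHS]big_cons.
move: (\sum_(j0 <- j :: s) F j0) (\sum_(j0 <- j :: s) nsq (F j0)) IH => A B IH.
have n0 : (0 : R) < (size (j :: s))%:R by rewrite ltr0n.
apply: (le_trans (nsqD_le _ _ n0)).
have -> : (size [:: i, j & s])%:R = 1 + (size (j :: s))%:R :> R.
  by rewrite /= -[in LHS]natr1 addrC.
move: (_%:R : R) n0 IH => n n0 IH; rewrite [leRHS]mulrDr lerD2l.
have -> : (1 + n) * B = (1 + n^-1) * (n * B) by field; rewrite gt_eqF.
by rewrite ler_wpM2l // addr_ge0 // invr_ge0 ltW.
Qed.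

Lemma expiD (k l : int) (t : R) : expi (k + l) t = expi k t * expi l t.
Proof.
by rewrite /expi intrD mulrDl cosD sinD; apply: complex_ext; rewrite /=; ring.
Qed.

Lemma expi0 (t : R) : expi 0 t = 1.
Proof. by rewrite /expi mul0r cos0 sin0. Qed.

Lemma expiJ (k : int) (t : R) : Num.conj (expi k t) = expi (- k) t.
Proof. by rewrite conjE /expi /= mulrNz mulNr cosN sinN. Qed.

Lemma expiX (k : nat) (t : R) : expi k%:Z t = expi 1 t ^+ k.
Proof.
elim: k => [|k IH]; first by rewrite expi0.
by rewrite exprS -IH -expiD; congr (expi _ t); rewrite -PoszD.
Qed.

Lemma nsq_expi (k : int) (t : R) : nsq (expi k t) = 1.
Proof. exact: cos2Dsin2. Qed.

Lemma expiNK (k : int) (t : R) : expi (- k) t * expi k t = 1.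
Proof. by rewrite -expiD addNr expi0. Qed.

End ComplexScalars.

(** * Measurability of complex-valued functions *)

Section ComplexMeasurability.
Variable R : realType.
Implicit Types (F G : R -> R[i]) (f g : R -> R).
Local Notation Re := complex.Re.
Local Notation Im := complex.Im.

Lemma cmeasurable_eq F G : (forall t, F t = G t) -> cmeasurable F -> cmeasurable G.
Proof. by move=> /funext ->. Qed.

Lemma cmeasurable_cst (c : R[i]) : cmeasurable (fun=> c).
Proof. by split; exact: measurable_cst. Qed.

Lemma cmeasurableD F G : cmeasurable F -> cmeasurable G ->
  cmeasurable (fun t => F t + G t).
Proof.
move=> [F1 F2] [G1 G2]; split.
- by under eq_fun do rewrite ReD; exact: measurable_funD.
- by under eq_fun do rewrite ImD; exact: measurable_funD.
Qed.

Lemma cmeasurableM F G : cmeasurable F -> cmeasurable G ->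
  cmeasurable (fun t => F t * G t).
Proof.
move=> [F1 F2] [G1 G2]; split.
- by under eq_fun do rewrite ReM; apply: measurable_funB; exact: measurable_funM.
- by under eq_fun do rewrite ImM; apply: measurable_funD; exact: measurable_funM.
Qed.

Lemma cmeasurableN F : cmeasurable F -> cmeasurable (fun t => - F t).
Proof.
move=> mF; apply: cmeasurable_eq (cmeasurableM (cmeasurable_cst (-1)) mF) => t.
by rewrite mulN1r.
Qed.

Lemma cmeasurableB F G : cmeasurable F -> cmeasurable G ->
  cmeasurable (fun t => F t - G t).
Proof. by move=> mF mG; apply: cmeasurableD => //; exact: cmeasurableN. Qed.

Lemma cmeasurableJ F : cmeasurable F -> cmeasurable (fun t => Num.conj (F t)).
Proof.
move=> [F1 F2]; split.
- by under eq_fun do rewrite ReJ.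
- by under eq_fun do rewrite ImJ; exact: measurable_funN.
Qed.

Lemma cmeasurable_sum (I : Type) (s : seq I) (F : I -> R -> R[i]) :
  (forall i, cmeasurable (F i)) -> cmeasurable (fun t => \sum_(i <- s) F i t).
Proof.
move=> mF; elim: s => [|i s IH].
  by apply: cmeasurable_eq (cmeasurable_cst 0) => t; rewrite big_nil.
by apply: cmeasurable_eq (cmeasurableD (mF i) IH) => t; rewrite big_cons.
Qed.

Lemma cmeasurable_prod (I : Type) (s : seq I) (F : I -> R -> R[i]) :
  (forall i, cmeasurable (F i)) -> cmeasurable (fun t => \prod_(i <- s) F i t).
Proof.
move=> mF; elim: s => [|i s IH].
  by apply: cmeasurable_eq (cmeasurable_cst 1) => t; rewrite big_nil.
by apply: cmeasurable_eq (cmeasurableM (mF i) IH) => t; rewrite big_cons.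
Qed.

Lemma measurable_nsq F : cmeasurable F -> measurable_fun torus (fun t => nsq (F t)).
Proof. by move=> [F1 F2]; apply: measurable_funD; exact: measurable_funX. Qed.

Lemma measurable_invr f : measurable_fun torus f ->
  measurable_fun torus (fun t => (f t)^-1).
Proof.
move=> mf.
(* Inversion is continuous only off 0, so the zero set is split off; there the convention 0^-1 = 0
   gives a constant branch. *)
have -> : (fun t => (f t)^-1) = (fun t => if f t == 0 then 0 else (f t)^-1).
  by apply/funext => t; case: eqP => // ->; rewrite invr0.
apply: measurable_fun_if => //; first exact: measurable_torus.
- by apply: measurable_fun_eqr => //; exact: measurable_cst.
- apply: (@measurable_comp _ _ _ _ _ _ [set r : R | r != 0]).
  + exact: open_measurable.
  + move=> _ /= [t [_ /negbT ft0] <-]; exact: ft0.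
  + apply: open_continuous_measurable_fun => // x; rewrite inE /= => x0.
    exact: inv_continuous.
  + by apply: (@measurable_funS _ _ _ _ torus) => //; exact: measurable_torus.
Qed.

Lemma cmeasurableV F : cmeasurable F -> cmeasurable (fun t => (F t)^-1).
Proof.
move=> mF.
have mF' : cmeasurable (fun t => ((nsq (F t))^-1)%:C).
  split; last exact: measurable_cst.
  by apply: measurable_invr; exact: measurable_nsq.
apply: cmeasurable_eq (cmeasurableM mF' (cmeasurableJ mF)) => t.
have [->|F0] := eqVneq (F t) 0; first by rewrite rmorph0 mulr0 invr0.
apply: (mulfI F0); rewrite mulrCA mulcJ_nsq mulfV // -rmorphM /= mulVf //.
by rewrite nsq_eq0.
Qed.

Lemma cmeasurable_expi (k : int) : cmeasurable (@expi R k).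
Proof.
have ck : continuous (fun t : R => k%:~R * t) by exact: mulrl_continuous.
split; apply: measurable_funTS; apply: continuous_measurable_fun => t.
- by apply: (continuous_comp (ck t)); exact: continuous_cos.
- by apply: (continuous_comp (ck t)); exact: continuous_sin.
Qed.

End ComplexMeasurability.

(** * Complex integrals and the scalar space L^2 *)

Section ComplexIntegral.
Variable R : realType.
Implicit Types (F G : R -> R[i]) (f g : R -> R).
Local Notation Re := complex.Re.
Local Notation Im := complex.Im.

Lemma cintegrable_cmeasurable F : cintegrable F -> cmeasurable F.
Proof. by move=> [F1 F2]; split; exact: tmeasurable. Qed.

Lemma cintegrable_eq F G : (forall t, torus t -> F t = G t) ->
  cintegrable F -> cintegrable G.
Proof.
move=> FG [F1 F2]; split.
- by apply: (tintegrable_eq _ F1) => t Dt; rewrite FG.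
- by apply: (tintegrable_eq _ F2) => t Dt; rewrite FG.
Qed.

Lemma cintegrableZ (c : R[i]) F : cintegrable F -> cintegrable (fun t => c * F t).
Proof.
move=> [F1 F2]; split.
- apply: (tintegrable_eq _ (tintegrableB (tintegrableZ (Re c) F1) (tintegrableZ (Im c) F2))).
  by move=> t _; rewrite ReM.
- apply: (tintegrable_eq _ (tintegrableD (tintegrableZ (Re c) F2) (tintegrableZ (Im c) F1))).
  by move=> t _; rewrite ImM.
Qed.

Lemma cintegrable_sum (I : Type) (s : seq I) (F : I -> R -> R[i]) :
  (forall i, cintegrable (F i)) ->
  cintegrable (fun t => \sum_(i <- s) F i t).
Proof.
move=> Fi; split.
- apply: (tintegrable_eq _ (tintegrable_sum s (fun i => (Fi i).1))).
  by move=> t _; rewrite Re_sum.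
- apply: (tintegrable_eq _ (tintegrable_sum s (fun i => (Fi i).2))).
  by move=> t _; rewrite Im_sum.
Qed.

Lemma cint_eq F G : (forall t, torus t -> F t = G t) -> cint F = cint G.
Proof.
by move=> FG; rewrite /cint; congr Complex; apply: tint_eq => t Dt; rewrite FG.
Qed.

Lemma cint_cst (c : R[i]) : cint (fun=> c : R[i]) = c.
Proof. by case: c => a b; rewrite /cint !tint_cst. Qed.

Lemma cintD F G : cintegrable F -> cintegrable G ->
  cint (fun t => F t + G t) = cint F + cint G.
Proof.
move=> [F1 F2] [G1 G2]; rewrite /cint; apply: complex_ext; rewrite ?ReD ?ImD /=.
- by rewrite -tintD //; apply: tint_eq => t _; rewrite ReD.
- by rewrite -tintD //; apply: tint_eq => t _; rewrite ImD.
Qed.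

Lemma cintZ (c : R[i]) F : cintegrable F ->
  cint (fun t => c * F t) = c * cint F.
Proof.
move=> [F1 F2]; rewrite /cint; apply: complex_ext; rewrite ?ReM ?ImM /=.
- rewrite -!tintZ // -tintB; [|exact: tintegrableZ..].
  by apply: tint_eq => t _; rewrite ReM.
- rewrite -!tintZ // -tintD; [|exact: tintegrableZ..].
  by apply: tint_eq => t _; rewrite ImM.
Qed.

Lemma cint_sum (I : Type) (s : seq I) (F : I -> R -> R[i]) :
  (forall i, cintegrable (F i)) ->
  cint (fun t => \sum_(i <- s) F i t) = \sum_(i <- s) cint (F i).
Proof.
move=> Fi; rewrite /cint; apply: complex_ext; rewrite ?Re_sum ?Im_sum /=.
- rewrite -tint_sum; last by move=> i; exact: (Fi i).1.
  by apply: tint_eq => t _; rewrite Re_sum.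
- rewrite -tint_sum; last by move=> i; exact: (Fi i).2.
  by apply: tint_eq => t _; rewrite Im_sum.
Qed.

Lemma cintB F G : cintegrable F -> cintegrable G ->
  cint (fun t => F t - G t) = cint F - cint G.
Proof.
move=> Fi Gi; rewrite -mulN1r -cintZ // -cintD //; last exact: cintegrableZ.
by apply: cint_eq => t _; rewrite mulN1r.
Qed.

Lemma taeeq_cint F G : cmeasurable F -> cmeasurable G -> taeeq F G ->
  cint F = cint G.
Proof.
move=> [F1 F2] [G1 G2] FG; rewrite /cint; congr Complex; apply: taeeq_int => //.
- by apply: filterS FG => t FG Dt; rewrite FG.
- by apply: filterS FG => t FG Dt; rewrite FG.
Qed.

Lemma taeeq_cintegrable F G : cmeasurable G -> taeeq F G -> cintegrable F ->
  cintegrable G.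
Proof.
move=> [G1 G2] FG [F1 F2]; split.
- by apply: (taeeq_integrable G1 _ F1); apply: filterS FG => t FG Dt; rewrite FG.
- by apply: (taeeq_integrable G2 _ F2); apply: filterS FG => t FG Dt; rewrite FG.
Qed.

Lemma cintegrable_le F g : cmeasurable F -> tintegrable g ->
  (forall t, torus t -> nsq (F t) <= g t ^+ 2) ->
  (forall t, torus t -> 0 <= g t) -> cintegrable F.
Proof.
move=> [F1 F2] gi Fg g0; split; apply: (tintegrable_le _ _ gi) => // t Dt.
- rewrite -ler_sqr ?nnegrE ?g0 // real_normK ?num_real //.
  exact: le_trans (Re_nsq _) (Fg _ Dt).
- rewrite -ler_sqr ?nnegrE ?g0 // real_normK ?num_real //.
  exact: le_trans (Im_nsq _) (Fg _ Dt).
Qed.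

Definition cL2 F := cmeasurable F /\ tintegrable (fun t => nsq (F t)).

Lemma cL2_eq F G : (forall t, F t = G t) -> cL2 F -> cL2 G.
Proof. by move=> /funext ->. Qed.

Lemma cL2_le F g : cmeasurable F -> tintegrable g ->
  (forall t, torus t -> nsq (F t) <= g t) -> cL2 F.
Proof.
move=> mF gi Fg; split=> //; apply: (tintegrable_le _ _ gi).
- exact: measurable_nsq.
- by move=> t Dt; rewrite ger0_norm ?nsq_ge0 // Fg.
Qed.

Lemma cL2_bounded F (c : R) : cmeasurable F ->
  (forall t, torus t -> nsq (F t) <= c) -> cL2 F.
Proof. by move=> mF Fc; apply: (cL2_le mF (tintegrable_cst c)). Qed.

Lemma cL2_cst (c : R[i]) : cL2 (fun=> c).
Proof. exact: (cL2_bounded (c := nsq c) (cmeasurable_cst c)). Qed.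

Lemma cL2_expi (k : int) : cL2 (@expi R k).
Proof.
by apply: (cL2_bounded (c := 1) (cmeasurable_expi R k)) => t _; rewrite nsq_expi.
Qed.

Lemma cL2D F G : cL2 F -> cL2 G -> cL2 (fun t => F t + G t).
Proof.
move=> [mF Fi] [mG Gi]; apply: cL2_le (cmeasurableD mF mG)
  (tintegrableD (tintegrableZ 2 Fi) (tintegrableZ 2 Gi)) _ => t _.
exact: nsqD_le2.
Qed.

Lemma cL2M_bounded F G (c : R) : cmeasurable F ->
  (forall t, torus t -> nsq (F t) <= c) -> cL2 G -> cL2 (fun t => F t * G t).
Proof.
move=> mF Fc [mG Gi]; apply: cL2_le (cmeasurableM mF mG) (tintegrableZ c Gi) _.
by move=> t Dt; rewrite nsqM ler_wpM2r ?nsq_ge0 ?Fc.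
Qed.

Lemma cL2Z (c : R[i]) F : cL2 F -> cL2 (fun t => c * F t).
Proof. by apply: (cL2M_bounded (c := nsq c)) => //; exact: cmeasurable_cst. Qed.

Lemma cL2_expiM (k : int) F : cL2 F -> cL2 (fun t => expi k t * F t).
Proof.
apply: (cL2M_bounded (c := 1)); first exact: cmeasurable_expi.
by move=> t _; rewrite nsq_expi.
Qed.

Lemma cL2B F G : cL2 F -> cL2 G -> cL2 (fun t => F t - G t).
Proof.
move=> LF LG; apply: (@cL2_eq (fun t => F t + -1 * G t)).
  by move=> t; rewrite mulN1r.
by apply: cL2D => //; exact: cL2Z.
Qed.

Lemma cL2J F : cL2 F -> cL2 (fun t => Num.conj (F t)).
Proof.
move=> [mF Fi]; apply: cL2_le (cmeasurableJ mF) Fi _ => t _.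
by rewrite nsqJ.
Qed.

Lemma cL2_sum (I : Type) (s : seq I) (F : I -> R -> R[i]) :
  (forall i, cL2 (F i)) -> cL2 (fun t => \sum_(i <- s) F i t).
Proof.
move=> LF; elim: s => [|i s IH].
  by apply: (cL2_eq _ (cL2_cst 0)) => t; rewrite big_nil.
by apply: (cL2_eq _ (cL2D (LF i) IH)) => t; rewrite big_cons.
Qed.

Lemma cL2_cintegrable F : cL2 F -> cintegrable F.
Proof.
move=> [mF Fi]; apply: (cintegrable_le mF (tintegrableD (tintegrable_cst 1) Fi)).
- move=> t _; have := nsq_ge0 (F t); set u := nsq _ => u0.
  by rewrite -subr_ge0; have -> : (1 + u) ^+ 2 - u = 1 + u + u ^+ 2; [ring|]; nra.
- by move=> t _; rewrite addr_ge0 ?nsq_ge0.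
Qed.

Lemma cL2M_cintegrable F G : cL2 F -> cL2 G -> cintegrable (fun t => F t * G t).
Proof.
move=> [mF Fi] [mG Gi].
apply: (cintegrable_le (cmeasurableM mF mG) (tintegrableD Fi Gi)).
- by move=> t _; rewrite nsqM; have := nsq_ge0 (F t); have := nsq_ge0 (G t); nra.
- by move=> t _; rewrite addr_ge0 ?nsq_ge0.
Qed.

(** The variance identity: [a] enters only through its distance to the mean. Applied to e_(-k) F it
    gives all the Fourier analysis that follows. *)
Lemma tint_nsqB F (a : R[i]) : cL2 F ->
  tint (fun t => nsq (F t - a)) =
  tint (fun t => nsq (F t)) - nsq (cint F) + nsq (cint F - a).
Proof.
move=> LF; have [F1 F2] := cL2_cintegrable LF; have [_ Fi] := LF.
transitivity (tint (fun t => nsq (F t) + (- (2 * Re a) * Re (F t) +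
    (- (2 * Im a) * Im (F t) + nsq a)))).
  by apply: tint_eq => t _; rewrite /nsq !(ReB, ImB); ring.
have F1' := tintegrableZ (- (2 * Re a)) F1.
have F2' := tintegrableD (tintegrableZ (- (2 * Im a)) F2) (tintegrable_cst (nsq a)).
rewrite (tintD Fi (tintegrableD F1' F2')) (tintD F1' F2').
rewrite (tintD (tintegrableZ (- (2 * Im a)) F2) (tintegrable_cst (nsq a))).
rewrite (tintZ _ F1) (tintZ _ F2) tint_cst.
by rewrite /nsq !(ReB, ImB) /cint /=; ring.
Qed.

Lemma nsq_cint_le F : cL2 F -> nsq (cint F) <= tint (fun t => nsq (F t)).
Proof.
move=> LF; have := tint_nsqB (cint F) LF; rewrite subrr nsq0 addr0 => E.
by rewrite -subr_ge0 -E tint_ge0 // => t _; exact: nsq_ge0.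
Qed.

Lemma is_derive_scaled (h dh : R -> R) (c k t : R) :
  (forall x, is_derive x (1 : R) h (dh x)) ->
  is_derive t (1 : R) (fun x => c * h (k * x)) (c * (k * dh (k * t))).
Proof.
move=> hd.
have dk : is_derive t (1 : R) (k \*: (@id R)) k.
  by apply: is_derive_eq; rewrite /GRing.scale /= mulr1.
have dhk := @is_derive1_comp R h _ t _ _ (hd _) dk.
rewrite (_ : (fun x => _) = c \*: (h \o (k \*: (@id R)))) //.
by apply: is_derive_eq; rewrite /GRing.scale /= [dh _ * _]mulrC.
Qed.

Lemma tint_derivative f g : continuous f ->
  (forall t : R, is_derive t (1 : R) g (f t)) -> g pi = g (- pi) -> tint f = 0.
Proof.
move=> cf dg gpi; rewrite /tint.
have Npi : - pi < pi :> R by have := pi_gt0 R; lra.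
have cg : continuous g.
  by move=> t; apply: differentiable_continuous; apply/derivable1_diffP.
have fi : (leb R).-integrable `[- pi, pi] (EFin \o f).
  apply: continuous_compact_integrable; first exact: segment_compact.
  by apply: continuous_subspaceT.
have -> : \int[leb R]_(t in torus) f t = \int[leb R]_(t in `[- pi, pi]) f t.
  apply: Rintegral_itv_bndo_bndc.
  apply: (integrableS _ _ _ fi); [exact: measurable_itv..|].
  by move=> t /=; rewrite !in_itv /= => /andP[-> /ltW ->].
rewrite /Rintegral (@continuous_FTC2 _ f g) //.
- by rewrite gpi -EFinB subrr mulr0.
- exact: continuous_subspaceT.
- split; first by move=> x _; exact: ex_derive.
  + by apply: cvg_at_right_filter; exact: cg.
  + by apply: cvg_at_left_filter; exact: cg.
- by move=> x _; rewrite derive1E; exact: derive_val.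
Qed.

Lemma cint_expi (k : int) : cint (@expi R k) = (k == 0)%:R.
Proof.
have [->|k0] := eqVneq k 0.
  by rewrite -[RHS]cint_cst; apply: cint_eq => t _; rewrite expi0.
have k0' : k%:~R != 0 :> R by rewrite intr_eq0.
have ck : continuous (fun t : R => k%:~R * t) by exact: mulrl_continuous.
have sinN (m : nat) : sin (m%:R * pi) = 0 :> R.
  by elim: m => [|m IH]; rewrite ?mul0r ?sin0 // -natr1 mulrDl mul1r sinDpi IH oppr0.
have sinpi : sin (k%:~R * pi) = 0 :> R.
  by case: k {k0 k0' ck} => m; rewrite ?NegzE ?mulrNz ?mulNr ?trigo.sinN -pmulrn sinN ?oppr0.
rewrite /cint; apply: complex_ext => /=.
- apply: (@tint_derivative _ (fun t => (k%:~R)^-1 * sin (k%:~R * t))).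
  + by move=> t; apply: (continuous_comp (ck t)); exact: continuous_cos.
  + move=> t; have := is_derive_scaled k%:~R^-1 k%:~R t (@is_derive_sin R).
    by rewrite mulKf.
  + by rewrite mulrN trigo.sinN sinpi oppr0.
- apply: (@tint_derivative _ (fun t => - (k%:~R)^-1 * cos (k%:~R * t))).
  + by move=> t; apply: (continuous_comp (ck t)); exact: continuous_sin.
  + move=> t; have := is_derive_scaled (- k%:~R^-1) k%:~R t (@is_derive_cos R).
    by rewrite !mulrN mulNr opprK mulKf.
  + by rewrite mulrN cosN.
Qed.

End ComplexIntegral.

(** * Fourier coefficients and Poisson integrals *)

Section FourierCoefficients.
Variable R : realType.
Implicit Types (F G : R -> R[i]).

Definition fcoef F (k : int) : R[i] := cint (fun t => expi (- k) t * F t).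

Lemma fcoef_cintegrable F k : cL2 F -> cintegrable (fun t => expi (- k) t * F t).
Proof. by move=> LF; apply: cL2_cintegrable; exact: cL2_expiM. Qed.

Lemma fcoefB F G k : cL2 F -> cL2 G ->
  fcoef (fun t => F t - G t) k = fcoef F k - fcoef G k.
Proof.
move=> LF LG; rewrite /fcoef -cintB; [|exact: fcoef_cintegrable..].
by apply: cint_eq => t _; rewrite mulrBr.
Qed.

Lemma fcoef_expi (a : R[i]) (l k : int) :
  fcoef (fun t => a * expi l t) k = a * (l == k)%:R.
Proof.
rewrite /fcoef (@cint_eq _ _ (fun t => a * expi (l - k) t)); last first.
  by move=> t _; rewrite mulrCA -expiD [- k + l]addrC.
rewrite cintZ; last exact: cL2_cintegrable (cL2_expi _ _).
by rewrite cint_expi subr_eq0.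
Qed.

Lemma tint_nsqB_expi F (a : R[i]) k : cL2 F ->
  tint (fun t => nsq (F t - a * expi k t)) =
  tint (fun t => nsq (F t)) - nsq (fcoef F k) + nsq (fcoef F k - a).
Proof.
move=> LF.
have := tint_nsqB a (cL2_expiM (- k) LF).
rewrite (@tint_eq _ (fun t => nsq (expi (- k) t * F t)) (fun t => nsq (F t))).
  move=> <-; apply: tint_eq => t _.
  have -> : expi (- k) t * F t - a = expi (- k) t * (F t - a * expi k t).
    by rewrite mulrBr mulrCA expiNK mulr1.
  by rewrite nsqM nsq_expi mul1r.
by move=> t _; rewrite nsqM nsq_expi mul1r.
Qed.

(** Induction on the frequencies: since they are distinct, the part already subtracted has
    coefficient 0 at the new one. Bessel's inequality and the optimality of the Fourier section are
    both read off from this identity. *)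
Lemma tint_nsqB_trig F (s : seq int) (a : int -> R[i]) : cL2 F -> uniq s ->
  tint (fun t => nsq (F t - \sum_(k <- s) a k * expi k t)) =
  tint (fun t => nsq (F t)) - \sum_(k <- s) nsq (fcoef F k) +
  \sum_(k <- s) nsq (fcoef F k - a k).
Proof.
move=> LF; elim: s => [|k s IH].
  by move=> _; rewrite !big_nil subr0 addr0; apply: tint_eq => t _; rewrite big_nil subr0.
move=> /= /andP[ks us].
have LS : cL2 (fun t => \sum_(l <- s) a l * expi l t).
  by apply: cL2_sum => l; apply: cL2Z; exact: cL2_expi.
have := tint_nsqB_expi (a k) k (cL2B LF LS); rewrite IH // fcoefB //.
have -> : fcoef (fun t => \sum_(l <- s) a l * expi l t) k = 0.
  rewrite /fcoef (@cint_eq _ _ (fun t => \sum_(l <- s) (expi (- k) t * (a l * expi l t)))).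
    rewrite cint_sum; last first.
      by move=> l; apply: fcoef_cintegrable; apply: cL2Z; exact: cL2_expi.
    rewrite big_seq big1 // => l ls; rewrite -/(fcoef _ k) fcoef_expi.
    by case: eqP ls ks => [->|_] => [->|] //; rewrite mulr0.
  by move=> t _; rewrite mulr_sumr.
rewrite subr0 => E; rewrite !big_cons.
rewrite (@tint_eq _ _ (fun t => nsq (F t - \sum_(l <- s) a l * expi l t - a k * expi k t))).
  by rewrite E; ring.
by move=> t _; rewrite big_cons opprD addrA addrAC.
Qed.

Lemma bessel F (s : seq int) : cL2 F -> uniq s ->
  \sum_(k <- s) nsq (fcoef F k) <= tint (fun t => nsq (F t)).
Proof.
move=> LF us; have := tint_nsqB_trig (fcoef F) LF us.
rewrite [X in _ + X]big1 ?addr0 => [E|k _]; last by rewrite subrr nsq0.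
by rewrite -subr_ge0 -E tint_ge0 // => t _; exact: nsq_ge0.
Qed.

Lemma nsq_fcoef_le F k : cL2 F -> nsq (fcoef F k) <= tint (fun t => nsq (F t)).
Proof. by move=> LF; have := @bessel F [:: k] LF isT; rewrite big_seq1. Qed.

End FourierCoefficients.

(** * The Poisson kernel and Poisson integrals *)

Section PoissonKernel.
Variable R : realType.
Implicit Types (r x t s : R) (v w : R -> R).
Local Notation Re := complex.Re.

Lemma exprn_small r (c e : R) : 0 <= r -> r < 1 -> 0 < e ->
  exists N, c * r ^+ N < e.
Proof.
move=> r0 r1 e0.
have h : c * r ^+ n @[n --> \oo] --> c * 0.
  by apply: cvgMl_tmp; apply: cvg_expr; rewrite ger0_norm.
rewrite mulr0 in h.
have [N _ /(_ N (leqnn N)) /= hN] := cvgr_lt _ h _ e0.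
by exists N.
Qed.

Definition pkernel r x : R := (1 - r ^+ 2) / (1 - 2 * r * cos x + r ^+ 2).

Lemma pden_ge r x : 0 <= r -> (1 - r) ^+ 2 <= 1 - 2 * r * cos x + r ^+ 2.
Proof. by move=> r0; have := cos_le1 x; nra. Qed.

Lemma pden_gt0 r x : 0 <= r -> r < 1 -> 0 < 1 - 2 * r * cos x + r ^+ 2.
Proof.
move=> r0 r1; apply: lt_le_trans (pden_ge x r0).
by rewrite exprn_gt0 // subr_gt0.
Qed.

Lemma pkernel_ge0 r x : 0 <= r -> r < 1 -> 0 <= pkernel r x.
Proof.
move=> r0 r1; rewrite /pkernel divr_ge0 ?(ltW (pden_gt0 x r0 r1)) //.
by rewrite subr_ge0 expr_le1 // ltW.
Qed.

Lemma cos_recur (k : nat) x :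
  cos (k.+2%:R * x) = 2 * cos x * cos (k.+1%:R * x) - cos (k%:R * x).
Proof.
have -> : k.+2%:R * x = k.+1%:R * x + x by rewrite -natr1 mulrDl mul1r.
have -> : k%:R * x = k.+1%:R * x - x by rewrite -natr1 mulrDl mul1r addrK.
by rewrite cosD cosB; ring.
Qed.

(** The symmetric partial sum of the expansion of the Poisson kernel in r^|k| e^{ikx}, with k and -k
    paired. *)
Definition pkernel_sum r x (N : nat) : R :=
  1 + \sum_(0 <= k < N) 2 * r ^+ k.+1 * cos (k.+1%:R * x).

(** Multiplying by the denominator telescopes the sum, because [cos_recur] is the recurrence whose
    characteristic polynomial is that denominator; only boundary terms remain. *)
Lemma pkernel_sumE r x N :
  (1 - 2 * r * cos x + r ^+ 2) * pkernel_sum r x N =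
  1 - r ^+ 2 - 2 * r ^+ N.+1 * cos (N.+1%:R * x) + 2 * r ^+ N.+2 * cos (N%:R * x).
Proof.
elim: N => [|N IH].
  by rewrite /pkernel_sum big_nil mul1r mul0r cos0; ring.
rewrite /pkernel_sum big_nat_recr //= addrA mulrDr IH cos_recur !exprS; ring.
Qed.

(** The remainder is the two boundary terms of [pkernel_sumE], each at most 2 r^N, over a
    denominator that is at least (1 - r)^2. The bound is uniform in x. *)
Lemma pkernel_sub r x N : 0 <= r -> r < 1 ->
  `|pkernel r x - pkernel_sum r x N| <= 4 / (1 - r) ^+ 2 * r ^+ N.
Proof.
move=> r0 r1; have d0 := pden_gt0 x r0 r1.
have -> : pkernel r x - pkernel_sum r x N =
  (2 * r ^+ N.+1 * cos (N.+1%:R * x) - 2 * r ^+ N.+2 * cos (N%:R * x)) /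
   (1 - 2 * r * cos x + r ^+ 2).
  apply: (mulIf (x := 1 - 2 * r * cos x + r ^+ 2)); first by rewrite gt_eqF.
  rewrite mulfVK ?gt_eqF // mulrBl /pkernel mulfVK ?gt_eqF //.
  by rewrite [pkernel_sum _ _ _ * _]mulrC pkernel_sumE; ring.
rewrite normrM normfV (gtr0_norm d0) [leRHS]mulrAC.
apply: ler_pM => //; [by rewrite invr_ge0 ltW| |]; last first.
  by rewrite lef_pV2 ?posrE ?pden_ge // exprn_gt0 // subr_gt0.
apply: (le_trans (ler_normB _ _)); rewrite !normrM !normrX (ger0_norm r0) ger0_norm //.
have rN : 0 <= r ^+ N by exact: exprn_ge0.
have cl (y : R) : `|cos y| <= 1 by rewrite ler_norml cos_geN1 cos_le1.
have := cl (N.+1%:R * x); have := cl (N%:R * x).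
rewrite !exprS; move: (normr_ge0 (cos (N.+1%:R * x))) (normr_ge0 (cos (N%:R * x))).
move: `|cos (N.+1%:R * x)| `|cos (N%:R * x)| => a b.
move: (r ^+ N) rN => y y0 a0 b0 b1 a1.
have := ler_pM a0 (mulr_ge0 r0 y0) a1 (ler_piMl y0 (ltW r1)).
have := ler_pM b0 (mulr_ge0 r0 (mulr_ge0 r0 y0)) b1
   (le_trans (ler_piMl (mulr_ge0 r0 y0) (ltW r1)) (ler_piMl y0 (ltW r1))).
lra.
Qed.

Lemma Re_realM (a : R) (z : R[i]) : Re (a%:C * z) = a * Re z.
Proof. by rewrite ReM /= mul0r subr0. Qed.

Definition pois r v t : R := tint (fun s => pkernel r (s - t) * v s).

Lemma measurable_pkernel r t : measurable_fun torus (fun s => pkernel r (s - t)).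
Proof.
apply: measurable_funM; first exact: measurable_cst.
apply: measurable_invr; apply: measurable_funD; last exact: measurable_cst.
apply: measurable_funB; first exact: measurable_cst.
apply: measurable_funM; first exact: measurable_cst.
apply: measurable_funTS; apply: continuous_measurable_fun => s.
apply: continuous_comp; last exact: continuous_cos.
by apply: continuousB; [exact: cvg_id|exact: cst_continuous].
Qed.

Lemma pkernel_le r x : 0 <= r -> r < 1 -> pkernel r x <= (1 - r ^+ 2) / (1 - r) ^+ 2.
Proof.
move=> r0 r1; rewrite ler_wpM2l ?subr_ge0 ?expr_le1 ?(ltW r1) //.
rewrite lef_pV2 ?posrE ?pden_ge ?pden_gt0 //.
by rewrite exprn_gt0 // subr_gt0.
Qed.

Lemma pois_integrable r v t : 0 <= r -> r < 1 -> tintegrable v ->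
  tintegrable (fun s => pkernel r (s - t) * v s).
Proof.
move=> r0 r1 vi; apply: (tintegrable_le _ _ 
  (tintegrableZ ((1 - r ^+ 2) / (1 - r) ^+ 2) (tintegrable_norm vi))).
  by apply: measurable_funM; [exact: measurable_pkernel|exact: tmeasurable].
move=> s _; rewrite normrM ler_wpM2r // ger0_norm ?pkernel_ge0 //.
exact: pkernel_le.
Qed.

Lemma pkernel_integrable r t : 0 <= r -> r < 1 -> tintegrable (fun s => pkernel r (s - t)).
Proof.
move=> r0 r1; apply: tintegrable_eq (pois_integrable t r0 r1 (tintegrable_cst 1)) => s _.
by rewrite mulr1.
Qed.

Lemma le_pois r v w t : 0 <= r -> r < 1 -> tintegrable v -> tintegrable w ->
  (forall s, torus s -> v s <= w s) -> pois r v t <= pois r w t.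
Proof.
move=> r0 r1 vi wi vw; apply: le_tint; [exact: pois_integrable..|] => s Ds.
by rewrite ler_wpM2l ?pkernel_ge0 ?vw.
Qed.

Lemma poisB r v w t : 0 <= r -> r < 1 -> tintegrable v -> tintegrable w ->
  pois r (fun s => v s - w s) t = pois r v t - pois r w t.
Proof.
move=> r0 r1 vi wi; rewrite /pois -tintB; [|exact: pois_integrable..].
by apply: tint_eq => s _; rewrite mulrBr.
Qed.

(** A Poisson integral is the real part of an analytic function, and truncating the kernel makes
    that function a polynomial. The value at 0 is exact, so means can later be read as values at
    0. *)
Lemma pois_approx r v (e : R) : 0 <= r -> r < 1 -> tintegrable v -> 0 < e ->
  exists p : {poly R[i]}, p.[0] = (tint v)%:C /\
    forall t, `|pois r v t - Re p.[expi 1 t]| <= e.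
Proof.
move=> r0 r1 vi e0.
have [N hN] := exprn_small (4 / (1 - r) ^+ 2 * tint (fun s => `|v s|)) r0 r1 e0.
pose c k : R[i] := cint (fun s => expi (- k%:Z) s * (v s)%:C).
have ci k : cintegrable (fun s => expi (- k%:Z) s * (v s)%:C).
  apply: (cintegrable_le _ (tintegrable_norm vi)) => // [|t _].
    apply: cmeasurableM; first exact: cmeasurable_expi.
    by split; [exact: tmeasurable|exact: measurable_cst].
  by rewrite nsqM nsq_expi mul1r nsq_real real_normK // num_real.
(* The factor 2 makes up for keeping only the positive frequencies: the negative ones come back with
   the real part. *)
pose p := (tint v)%:C%:P + 'X * \poly_(k < N) ((2 * r ^+ k.+1)%:C * c k.+1).
exists p; split; first by rewrite /p hornerD hornerC hornerM hornerX mul0r addr0.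
move=> t.
have cosE (k : nat) s : Re (expi k.+1 t * (expi (- k.+1%:Z) s * (v s)%:C)) =
    cos (k.+1%:R * (s - t)) * v s.
  have -> : k.+1%:R * (s - t) = - ((k.+1 : int)%:~R * t + (- k.+1%:Z)%:~R * s).
    by rewrite mulrNz -pmulrn; ring.
  by rewrite cosN mulrA ReM /= mulr0 subr0 cosD.
have term k : Re ((2 * r ^+ k.+1)%:C * c k.+1 * expi 1 t ^+ k.+1) =
   tint (fun s => 2 * r ^+ k.+1 * cos (k.+1%:R * (s - t)) * v s).
  rewrite -mulrA [c _ * _]mulrC -expiX -(cintZ _ (ci _)) Re_realM -tintZ; last first.
    exact: (cintegrableZ (expi k.+1 t) (ci k.+1)).1.
  by apply: tint_eq => s _; rewrite cosE mulrA.
have -> : Re p.[expi 1 t] = tint (fun s => pkernel_sum r (s - t) N * v s).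
  rewrite /p hornerD hornerC hornerM hornerX horner_poly mulr_sumr ReD Re_sum /=.
  have ti (k : nat) : tintegrable (fun s => 2 * r ^+ k.+1 * cos (k.+1%:R * (s - t)) * v s).
    apply: (tintegrable_eq _ (tintegrableZ (2 * r ^+ k.+1)
      (cintegrableZ (expi k.+1 t) (ci k.+1)).1)) => s _.
    by rewrite cosE mulrA.
  rewrite (@tint_eq _ (fun s => pkernel_sum r (s - t) N * v s) (fun s => v s + \sum_(0 <= k < N) 2 * r ^+ k.+1 * cos (k.+1%:R * (s - t)) * v s)); last first.
    by move=> s _; rewrite /pkernel_sum mulrDl mul1r mulr_suml.
  rewrite (tintD vi (tintegrable_sum _ ti)).
  rewrite tint_sum // big_mkord; congr (_ + _); apply: eq_bigr => k _.
  by rewrite -term mulrCA -(exprS (expi 1 t)).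
have si : tintegrable (fun s => pkernel_sum r (s - t) N * v s).
  have h1 := pois_integrable t r0 r1 vi.
  have h2 : tintegrable (fun s => (pkernel r (s - t) - pkernel_sum r (s - t) N) * v s).
    apply: (tintegrable_le _ _ (tintegrableZ (4 / (1 - r) ^+ 2 * r ^+ N) (tintegrable_norm vi))).
      apply: measurable_funM; last exact: tmeasurable.
      apply: measurable_funB; first exact: measurable_pkernel.
      apply: measurable_funD; first exact: measurable_cst.
      apply: measurable_sum => k; apply: measurable_funM; first exact: measurable_cst.
      apply: measurable_funTS; apply: continuous_measurable_fun => s.
      apply: continuous_comp; last exact: continuous_cos.
      apply: continuousM; first exact: cst_continuous.
      by apply: continuousB; [exact: cvg_id|exact: cst_continuous].
    by move=> s _; rewrite normrM ler_wpM2r // pkernel_sub.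
  by apply: (tintegrable_eq _ (tintegrableB h1 h2)) => s _; ring.
rewrite /pois -tintB //; last exact: pois_integrable.
apply: (le_trans (normr_tint (tintegrableB (pois_integrable t r0 r1 vi) si))).
apply: (le_trans _ (ltW hN)).
have -> : 4 / (1 - r) ^+ 2 * tint (fun s => `|v s|) * r ^+ N =
  tint (fun s => 4 / (1 - r) ^+ 2 * r ^+ N * `|v s|).
  by rewrite (tintZ (4 / (1 - r) ^+ 2 * r ^+ N) (tintegrable_norm vi)) mulrAC.
apply: le_tint.
- by apply: tintegrable_norm; apply: tintegrableB => //; exact: pois_integrable.
- by apply: tintegrableZ; exact: tintegrable_norm.
- by move=> s _; rewrite -mulrBl normrM ler_wpM2r // pkernel_sub.
Qed.

End PoissonKernel.

(** * Functions that are Lipschitz for the chordal distance, and their uniform approximation *)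

Section ChordLipschitz.
Variable R : realType.
Implicit Types (F G : R -> R[i]) (v : R -> R).
Local Notation Re := complex.Re.

(* [2 * (1 - cos (s - t))] is the squared chord between e^{is} and e^{it}. *)
Definition chordlip F := exists2 L : R, 0 <= L &
  forall s t, nsq (F s - F t) <= L * (1 - cos (s - t)).

Definition chordlipr v := chordlip (fun t => (v t)%:C).

Lemma onem_cos_ge0 (x : R) : 0 <= 1 - cos x.
Proof. by rewrite subr_ge0 cos_le1. Qed.

Lemma chordlip_bounded F : chordlip F -> exists2 C : R, 0 <= C & forall t, nsq (F t) <= C.
Proof.
move=> [L L0 FL]; exists (4 * L + 2 * nsq (F 0)).
  by rewrite addr_ge0 ?mulr_ge0 ?nsq_ge0.
move=> t; rewrite -[F t](subrK (F 0)); apply: (le_trans (nsqD_le2 _ _)).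
rewrite lerD2r.
have -> : 4 * L = 2 * (L * 2) by ring.
rewrite ler_wpM2l //; apply: (le_trans (FL _ _)); rewrite ler_wpM2l //.
by have := cos_geN1 (t - 0); lra.
Qed.

Lemma chordlip_cst (c : R[i]) : chordlip (fun=> c).
Proof. by exists 0 => // s t; rewrite subrr nsq0 mul0r. Qed.

Lemma chordlipD F G : chordlip F -> chordlip G -> chordlip (fun t => F t + G t).
Proof.
move=> [L L0 FL] [K K0 GK]; exists (2 * L + 2 * K).
  by rewrite addr_ge0 ?mulr_ge0.
move=> s t; rewrite opprD addrACA; apply: (le_trans (nsqD_le2 _ _)).
by rewrite [leRHS]mulrDl -!mulrA lerD // ler_wpM2l.
Qed.

Lemma chordlipM F G : chordlip F -> chordlip G -> chordlip (fun t => F t * G t).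
Proof.
move=> FL GK; have [C C0 FC] := chordlip_bounded FL.
have [D D0 GD] := chordlip_bounded GK.
case: FL => L L0 FL; case: GK => K K0 GK; exists (2 * C * K + 2 * L * D).
  by rewrite addr_ge0 ?mulr_ge0.
move=> s t.
have -> : F s * G s - F t * G t = F s * (G s - G t) + (F s - F t) * G t by ring.
apply: (le_trans (nsqD_le2 _ _)); rewrite !nsqM [leRHS]mulrDl lerD //.
- rewrite -!mulrA ler_wpM2l // ler_pM ?nsq_ge0 //.
- rewrite -!mulrA ler_wpM2l // [D * _]mulrC mulrA ler_pM ?nsq_ge0 //.
Qed.

Lemma chordlipJ F : chordlip F -> chordlip (fun t => Num.conj (F t)).
Proof. by move=> [L L0 FL]; exists L => // s t; rewrite -rmorphB nsqJ. Qed.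

Lemma chordlip_sum (I : Type) (s : seq I) (F : I -> R -> R[i]) :
  (forall i, chordlip (F i)) -> chordlip (fun t => \sum_(i <- s) F i t).
Proof.
move=> LF; elim: s => [|i s IH].
  by under eq_fun do rewrite big_nil; exact: chordlip_cst.
by under eq_fun do rewrite big_cons; exact: chordlipD.
Qed.

Lemma chordlip_expi : chordlip (@expi R 1).
Proof.
exists 2 => // s t; rewrite /nsq !(ReB, ImB) /expi /= !mul1r cosB.
have := cos2Dsin2 s; have := cos2Dsin2 t; nra.
Qed.

Lemma chordlip_poly (p : {poly R[i]}) : chordlip (fun t => p.[expi 1 t]).
Proof.
elim/poly_ind: p => [|p c IH].
  by under eq_fun do rewrite horner0; exact: chordlip_cst.
under eq_fun do rewrite hornerMXaddC.
by apply: chordlipD; [apply: chordlipM => //; exact: chordlip_expi|exact: chordlip_cst].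
Qed.

Lemma chordlip_nsq F : chordlip F -> chordlipr (fun t => nsq (F t)).
Proof.
move=> LF; rewrite /chordlipr; under eq_fun do rewrite -mulcJ_nsq.
by apply: chordlipM => //; exact: chordlipJ.
Qed.

Lemma chordlipr_comp (phi : R -> R) (K : R) v : 0 <= K ->
  (forall s t, (phi (v s) - phi (v t)) ^+ 2 <= K * (v s - v t) ^+ 2) ->
  chordlipr v -> chordlipr (fun t => phi (v t)).
Proof.
move=> K0 phiK [L L0 vL]; exists (K * L); first exact: mulr_ge0.
move=> s t; rewrite -rmorphB nsq_real; apply: (le_trans (phiK _ _)).
by rewrite -mulrA ler_wpM2l //; have := vL s t; rewrite -rmorphB nsq_real.
Qed.

Lemma cmeasurable_poly (p : {poly R[i]}) : cmeasurable (fun t => p.[expi 1 t]).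
Proof.
elim/poly_ind: p => [|p c IH].
  by apply: cmeasurable_eq (cmeasurable_cst 0) => t; rewrite horner0.
apply: cmeasurable_eq (cmeasurableD (cmeasurableM IH (cmeasurable_expi R 1)) (cmeasurable_cst c)).
by move=> t; rewrite hornerMXaddC.
Qed.

Lemma nsq_poly_bounded (p : {poly R[i]}) :
  exists2 C : R, 0 <= C & forall t, nsq p.[expi 1 t] <= C.
Proof. by apply: chordlip_bounded; exact: chordlip_poly. Qed.

Lemma cL2_poly (p : {poly R[i]}) : cL2 (fun t => p.[expi 1 t]).
Proof.
have [C C0 pC] := nsq_poly_bounded p.
exact: (cL2_bounded (cmeasurable_poly p) (fun t _ => pC t)).
Qed.

Lemma cint_poly (p : {poly R[i]}) : cint (fun t => p.[expi 1 t]) = p.[0].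
Proof.
rewrite (@cint_eq _ _ (fun t => \sum_(k < size p) p`_k * expi k%:Z t)); last first.
  by move=> t _; rewrite horner_coef; apply: eq_bigr => k _; rewrite expiX.
have ce (k : int) : cintegrable (@expi R k) by exact: cL2_cintegrable (cL2_expi _ _).
rewrite cint_sum; last by move=> k; exact: cintegrableZ.
rewrite horner_coef; apply: eq_bigr => k _.
rewrite cintZ // cint_expi expr0n; congr (_ * _%:R).
Qed.

Lemma tint_cos (k : nat) (t : R) : tint (fun s => cos (k.+1%:R * (s - t))) = 0.
Proof.
have := cintZ (expi (- k.+1%:Z) t) (cL2_cintegrable (cL2_expi R k.+1%:Z)).
rewrite cint_expi mulr0 => /(congr1 (@complex.Re R)) /= <-; apply: tint_eq => s _.
by rewrite -cosD; congr cos; rewrite mulrNz -!pmulrn; ring.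
Qed.

Lemma tint_pkernel (r t : R) : 0 <= r -> r < 1 -> tint (fun s => pkernel r (s - t)) = 1.
Proof.
move=> r0 r1.
have ci (k : nat) : tintegrable (fun s => cos (k.+1%:R * (s - t))).
  apply: (tintegrable_bounded (c := 1)).
    apply: measurable_funTS; apply: continuous_measurable_fun => s.
    apply: continuous_comp; last exact: continuous_cos.
    apply: continuousM; first exact: cst_continuous.
    by apply: continuousB; [exact: cvg_id|exact: cst_continuous].
  by move=> s _; rewrite ler_norml cos_geN1 cos_le1.
have si N : tintegrable (fun s => \sum_(0 <= k < N) 2 * r ^+ k.+1 * cos (k.+1%:R * (s - t))).
  by apply: tintegrable_sum => k; exact: tintegrableZ.
have pi := pkernel_integrable t r0 r1.
apply/eqP; rewrite eq_le; apply/andP.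
(* The truncated kernels have integral exactly 1 and converge uniformly at a geometric rate. *)
suff h N : `|tint (fun s => pkernel r (s - t)) - 1| <= 4 / (1 - r) ^+ 2 * r ^+ N.
  have : tint (fun s => pkernel r (s - t)) - 1 = 0.
    apply/eqP; rewrite -normr_eq0 eq_le normr_ge0 andbT leNgt; apply/negP => e0.
    have [N hN] := exprn_small (4 / (1 - r) ^+ 2) r0 r1 e0.
    by have := le_lt_trans (h N) hN; rewrite ltxx.
  by move=> /subr0_eq ->.
have E1 : tint (fun s => pkernel_sum r (s - t) N) = 1.
  rewrite (tintD (tintegrable_cst 1) (si N)) tint_cst tint_sum; last first.
    by move=> k; exact: tintegrableZ.
  by rewrite big1 ?addr0 // => k _; rewrite tintZ // tint_cos mulr0.
have psi : tintegrable (fun s => pkernel_sum r (s - t) N).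
  exact: tintegrableD (tintegrable_cst 1) (si N).
rewrite -[X in `|_ - X|]E1 -tintB //; apply: (le_trans (normr_tint (tintegrableB pi psi))).
rewrite -[leRHS]tint_cst; apply: le_tint.
- exact: tintegrable_norm (tintegrableB pi psi).
- exact: tintegrable_cst.
- by move=> s _; exact: pkernel_sub.
Qed.

Lemma pois_cst (r t c : R) : 0 <= r -> r < 1 -> pois r (fun=> c) t = c.
Proof.
move=> r0 r1; rewrite -[RHS]mulr1 -(tint_pkernel t r0 r1) -tintZ; last first.
  exact: pkernel_integrable.
by apply: tint_eq => s _; rewrite mulrC.
Qed.

(** The factor 1 - cos in the chordal bound cancels the peak of the Poisson kernel, so the Poisson
    integrals converge uniformly to [v]; [pois_approx] then supplies the polynomial and its exact
    value at 0. *)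
Lemma chordlipr_approx v (e : R) : chordlipr v -> measurable_fun torus v -> 0 < e ->
  exists p : {poly R[i]}, p.[0] = (tint v)%:C /\
    forall t, `|v t - Re p.[expi 1 t]| <= e.
Proof.
move=> vlip mv e0; have [C C0 vC] := chordlip_bounded vlip.
have vi : tintegrable v.
  apply: (tintegrable_bounded (c := 1 + C)) => // t _.
  have := vC t; rewrite nsq_real -(real_normK (num_real _)) => h.
  by have := normr_ge0 (v t); nra.
case: vlip => L L0 vL.
(* Three errors of size d occur: two between [v] and its Poisson integral, one for the
   polynomial. *)
pose d := e / 4; have d0 : 0 < d by rewrite divr_gt0.
(* [pkernel r x * (1 - cos x) <= (1 - r^2) / (2 r) <= 2 (1 - r)] when [1/2 <= r] *)
pose r : R := 1 - (2 + 2 * L / d / d)^-1.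
have K0 : 0 <= 2 * L / d / d by rewrite !(divr_ge0, mulr_ge0) // ltW.
have K2 : 0 < 2 + 2 * L / d / d by lra.
have rE : (1 - r) * (2 + 2 * L / d / d) = 1 by rewrite /r subKr mulVf // gt_eqF.
have r1 : r < 1 by rewrite /r ltrBlDr ltrDl invr_gt0.
have r12 : 2^-1 <= r.
  rewrite /r; have : (2 + 2 * L / d / d)^-1 <= 2^-1 by rewrite lef_pV2 ?posrE // lerDl.
  lra.
have r0 : 0 <= r by rewrite (le_trans _ r12).
clearbody r.
have [p [p0 pv]] := pois_approx r0 r1 vi d0.
exists p; split=> // t.
have h : `|v t - pois r v t| <= d + d.
  have vti : tintegrable (fun s => v s - v t) by apply: tintegrableB => //; exact: tintegrable_cst.
  have -> : v t - pois r v t = - pois r (fun s => v s - v t) t.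
    rewrite poisB //; last exact: tintegrable_cst.
    by rewrite opprB pois_cst.
  rewrite normrN.
  have pi := pois_integrable t r0 r1 vti.
  apply: (le_trans (normr_tint pi)).
  have ki := pkernel_integrable t r0 r1.
  have -> : d + d = tint (fun s => d * pkernel r (s - t) + d).
    rewrite tintD; [|exact: tintegrableZ|exact: tintegrable_cst].
    by rewrite tintZ // tint_pkernel // mulr1 tint_cst.
  apply: le_tint.
  - exact: tintegrable_norm.
  - by apply: tintegrableD; [exact: tintegrableZ|exact: tintegrable_cst].
  move=> s _; rewrite normrM (ger0_norm (pkernel_ge0 _ r0 r1)).
  have pk0 := pkernel_ge0 (s - t) r0 r1.
  (* The bound u <= d + u^2 / d replaces the square root of the chordal bound by a term linear in 1
     - cos, which the kernel can absorb. *)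
  have h1 : `|v s - v t| <= d + L / d * (1 - cos (s - t)).
    have := vL s t; rewrite -rmorphB nsq_real -(real_normK (num_real _)).
    set u := `|_|; move=> uL.
    have u0 : 0 <= u by exact: normr_ge0.
    have h2 : u ^+ 2 / d <= L / d * (1 - cos (s - t)).
      by rewrite [leRHS]mulrAC ler_wpM2r // invr_ge0 ltW.
    apply: (@le_trans _ _ (d + u ^+ 2 / d)); last by rewrite lerD2l.
    have -> : u ^+ 2 / d = (u / d) ^+ 2 * d by field; rewrite gt_eqF.
    have -> : u = (u / d) * d by field; rewrite gt_eqF.
    set w := u / d; rewrite mulfK ?gt_eqF //.
    have : 0 <= (1 - w + w ^+ 2) * d by rewrite mulr_ge0 ?(ltW d0) //; nra.
    lra.
  have h2 : pkernel r (s - t) * (1 - cos (s - t)) <= 2 * (1 - r).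
    rewrite /pkernel mulrAC ler_pdivrMr ?pden_gt0 //.
    have := onem_cos_ge0 (s - t); set c := cos _ => c0.
    rewrite -subr_ge0.
    have -> : 2 * (1 - r) * (1 - 2 * r * c + r ^+ 2) - (1 - r ^+ 2) * (1 - c) =
      (1 - r) * (2 * (1 - r) ^+ 2 + (3 * r - 1) * (1 - c)) by ring.
    apply: mulr_ge0; first lra.
    by apply: addr_ge0; apply: mulr_ge0 => //; [exact: sqr_ge0|lra].
  have h3 : pkernel r (s - t) * (L / d * (1 - cos (s - t))) <= d.
    rewrite mulrCA; apply: (@le_trans _ _ (L / d * (2 * (1 - r)))).
      by rewrite ler_wpM2l // divr_ge0 // ltW.
    have -> : L / d * (2 * (1 - r)) = ((1 - r) * (2 * L / d / d)) * d by field; rewrite gt_eqF.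
    rewrite -[leRHS]mul1r ler_wpM2r ?(ltW d0) // -[leRHS]rE ler_wpM2l ?lerDr //.
    by rewrite subr_ge0 ltW.
  apply: (le_trans (ler_wpM2l pk0 h1)).
  by rewrite mulrDr lerD // mulrC.
rewrite -[v t](subrK (pois r v t)) -addrA (le_trans (ler_normD _ _)) //.
apply: (le_trans (lerD h (pv t))); rewrite /d; lra.
Qed.

End ChordLipschitz.

(** * Density of trigonometric polynomials in L^2 *)

Section TrigDensity.
Import HBSimple HBNNSimple.
Variable R : realType.
Implicit Types (v w : R -> R) (A : set R).
Local Notation Re := complex.Re.
Local Notation Im := complex.Im.

Definition rL2 v := measurable_fun torus v /\ tintegrable (fun t => v t ^+ 2).

Lemma rL2_le v (g : R -> R) : measurable_fun torus v -> tintegrable g ->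
  (forall t, torus t -> v t ^+ 2 <= g t) -> rL2 v.
Proof.
move=> mv gi vg; split=> //; apply: (tintegrable_le _ _ gi).
  exact: measurable_funX.
by move=> t Dt; rewrite ger0_norm ?sqr_ge0 // vg.
Qed.

Lemma rL2D v w : rL2 v -> rL2 w -> rL2 (fun t => v t + w t).
Proof.
move=> [mv vi] [mw wi]; apply: (rL2_le _
  (tintegrableD (tintegrableZ 2 vi) (tintegrableZ 2 wi))).
  exact: measurable_funD.
by move=> t _; have := sqr_ge0 (v t - w t); lra.
Qed.

Lemma rL2Z (c : R) v : rL2 v -> rL2 (fun t => c * v t).
Proof.
move=> [mv vi]; apply: (rL2_le _ (tintegrableZ (c ^+ 2) vi)).
  by apply: measurable_funM => //; exact: measurable_cst.
by move=> t _; rewrite exprMn.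
Qed.

Lemma rL2B v w : rL2 v -> rL2 w -> rL2 (fun t => v t - w t).
Proof.
move=> Lv Lw; have := rL2D Lv (rL2Z (-1) Lw).
by under eq_fun do rewrite mulN1r.
Qed.

Lemma rL2_Re F : cL2 F -> rL2 (fun t => Re (F t)).
Proof.
move=> [[mF _] Fi]; apply: (rL2_le mF Fi) => t _; exact: Re_nsq.
Qed.

Lemma rL2_Im F : cL2 F -> rL2 (fun t => Im (F t)).
Proof.
move=> [[_ mF] Fi]; apply: (rL2_le mF Fi) => t _; exact: Im_nsq.
Qed.

Lemma rL2_bounded v (c : R) : measurable_fun torus v ->
  (forall t, torus t -> v t ^+ 2 <= c) -> rL2 v.
Proof. by move=> mv vc; exact: (rL2_le mv (tintegrable_cst c)). Qed.

Lemma tint_sqD v w : rL2 v -> rL2 w ->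
  tint (fun t => (v t + w t) ^+ 2) <=
  2 * tint (fun t => v t ^+ 2) + 2 * tint (fun t => w t ^+ 2).
Proof.
move=> Lv Lw; rewrite -!tintZ ?Lv.2 ?Lw.2 // -tintD; last 2 first.
- by apply: tintegrableZ; exact: Lv.2.
- by apply: tintegrableZ; exact: Lw.2.
apply: le_tint; first exact: (rL2D Lv Lw).2.
  by apply: tintegrableD; apply: tintegrableZ; [exact: Lv.2|exact: Lw.2].
by move=> t _; have := sqr_ge0 (v t - w t); lra.
Qed.

(** Membership in the real L^2 is part of the definition, so that the class is a linear space closed
    under dominated limits, as the measure-theoretic induction requires. Real parts of analytic
    polynomials already give all real trigonometric polynomials. *)
Definition trigapprox v := rL2 v /\ forall e : R, 0 < e ->
  exists p : {poly R[i]}, tint (fun t => (v t - Re p.[expi 1 t]) ^+ 2) <= e.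

Lemma rL2_poly (p : {poly R[i]}) : rL2 (fun t => Re p.[expi 1 t]).
Proof. exact: rL2_Re (cL2_poly p). Qed.

Lemma trigapproxD v w : trigapprox v -> trigapprox w -> trigapprox (fun t => v t + w t).
Proof.
move=> [Lv vp] [Lw wp]; split; first exact: rL2D.
move=> e e0; have e4 : 0 < e / 4 by rewrite divr_gt0.
have [p hp] := vp _ e4; have [p' hp'] := wp _ e4.
exists (p + p'); under eq_fun do rewrite hornerD ReD opprD addrACA.
apply: (le_trans (tint_sqD (rL2B Lv (rL2_poly p)) (rL2B Lw (rL2_poly p')))).
lra.
Qed.

Lemma trigapproxZ (c : R) v : trigapprox v -> trigapprox (fun t => c * v t).
Proof.
move=> [Lv vp]; split; first exact: rL2Z.
move=> e e0; have d0 : 0 < e / (c ^+ 2 + 1).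
  by rewrite divr_gt0 // ltr_wpDl ?sqr_ge0.
have [p hp] := vp _ d0.
exists (c%:C *: p); under eq_fun do rewrite hornerZ Re_realM -mulrBr exprMn.
rewrite tintZ; last exact: (rL2B Lv (rL2_poly p)).2.
apply: (@le_trans _ _ (c ^+ 2 * (e / (c ^+ 2 + 1)))).
  by rewrite ler_wpM2l ?sqr_ge0.
rewrite mulrA ler_pdivrMr ?ltr_wpDl ?sqr_ge0 // mulrC ler_wpM2l ?(ltW e0) //.
by rewrite lerDl.
Qed.

Lemma trigapprox_ext v w : (forall t, torus t -> v t = w t) ->
  trigapprox v -> trigapprox w.
Proof.
move=> vw [[mv vi] vp]; split.
  split; first by apply: eq_measurable_fun mv => t; rewrite inE => /vw.
  by apply: tintegrable_eq vi => t Dt; rewrite vw.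
move=> e e0; have [p hp] := vp e e0; exists p.
rewrite (@tint_eq _ _ (fun t => (v t - Re p.[expi 1 t]) ^+ 2)) // => t Dt.
by rewrite vw.
Qed.

Lemma trigapprox_chordlip v : chordlipr v -> measurable_fun torus v -> trigapprox v.
Proof.
move=> vlip mv; split.
  have [C C0 vC] := chordlip_bounded vlip.
  by apply: (rL2_bounded mv (c := C)) => t _; have := vC t; rewrite nsq_real.
move=> e e0; pose d := Num.min 1 e.
have d0 : 0 < d by rewrite lt_min ltr01.
have [p [_ hp]] := chordlipr_approx vlip mv d0; exists p.
rewrite -[leRHS]tint_cst; apply: le_tint.
- apply: (tintegrable_bounded (c := d ^+ 2)).
    by apply: measurable_funX; apply: measurable_funB => //; exact: (cmeasurable_poly p).1.
  by move=> t _; rewrite normrX; have := hp t; have := normr_ge0 (v t - Re p.[expi 1 t]); nra.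
- exact: tintegrable_cst.
- move=> t _; rewrite -(real_normK (num_real _)).
  have h := hp t; have u0 := normr_ge0 (v t - Re p.[expi 1 t]).
  have d1 : d <= 1 by rewrite ge_min lexx.
  have de : d <= e by rewrite ge_min lexx orbT.
  by move: u0 h; set u := `|_|; move=> u0 h; nra.
Qed.

Lemma trigapprox_cst (c : R) : trigapprox (fun=> c).
Proof.
by apply: trigapprox_chordlip; [exact: chordlip_cst|exact: measurable_cst].
Qed.

Lemma trigapprox_sum (I : Type) (s : seq I) (v : I -> R -> R) :
  (forall i, trigapprox (v i)) -> trigapprox (fun t => \sum_(i <- s) v i t).
Proof.
move=> av; elim: s => [|i s IH].
  by under eq_fun do rewrite big_nil; exact: trigapprox_cst.
by under eq_fun do rewrite big_cons; exact: trigapproxD.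
Qed.

Lemma trigapprox_lim (v_ : nat -> R -> R) v (g : R -> R) :
  (forall m, trigapprox (v_ m)) -> rL2 v ->
  (forall t, torus t -> v_ m t @[m --> \oo] --> v t) -> tintegrable g ->
  (forall m t, torus t -> (v t - v_ m t) ^+ 2 <= g t) -> trigapprox v.
Proof.
move=> av Lv vlim gi vg; split=> // e e0.
have h : tint (fun t => (v t - v_ m t) ^+ 2) @[m --> \oo] --> tint (fun=> 0 : R).
  apply: (tint_dominated (g := g)) => //.
  - by move=> m; apply: measurable_funX; apply: measurable_funB; [exact: Lv.1|exact: (av m).1.1].
  - move=> t Dt; have : v t - v_ m t @[m --> \oo] --> v t - v t.
      by apply: cvgB; [exact: cvg_cst|exact: vlim].
    rewrite subrr => h0.
    have : (v t - v_ m t) * (v t - v_ m t) @[m --> \oo] --> (0 : R) * 0 by exact: cvgM.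
    by rewrite mulr0.
  - by move=> m t Dt; rewrite ger0_norm ?sqr_ge0 // vg.
rewrite tint_cst in h; have e4 : 0 < e / 4 by rewrite divr_gt0.
have [N _ /(_ N (leqnn N)) /= hN] := cvgr_lt _ h _ e4.
have [p hp] := (av N).2 _ e4; exists p.
rewrite (@tint_eq _ _ (fun t => (v t - v_ N t + (v_ N t - Re p.[expi 1 t])) ^+ 2)); last first.
  by move=> t _; rewrite addrA subrK.
apply: (le_trans (tint_sqD (rL2B Lv (av N).1) (rL2B (av N).1 (rL2_poly p)))).
lra.
Qed.

Lemma rL2_indic A : measurable A -> rL2 (\1_A).
Proof.
move=> mA; apply: (rL2_bounded (c := 1)); first exact: measurable_indic.
by move=> t _; rewrite indicE; case: (_ \in _); rewrite ?expr1n ?expr0n.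
Qed.

Lemma chordlipr_cos (a : R) : chordlipr (fun t => cos (t - a)).
Proof.
have [L L0 h] := chordlip_expi R; exists L => // s t.
have := h (s - a) (t - a); rewrite (_ : s - a - (t - a) = s - t); last by ring.
apply: le_trans; rewrite -rmorphB nsq_real.
by apply: le_trans (Re_nsq _); rewrite ReB /expi /= !mul1r.
Qed.

(** Rays are the generators in the Dynkin argument below. Clipped continuous functions reach them
    while staying under the constant majorant 1. *)
Lemma trigapprox_ray (x : R) : trigapprox (\1_(`]x, +oo[%classic : set R)).
Proof.
have mr : measurable (`]x, +oo[%classic : set R) by exact: measurable_itv.
have pi0 := pi_gt0 R.
have [xpi|xpi] := leP pi x.
  apply: trigapprox_ext (trigapprox_cst 0) => t; rewrite /torus /= in_itv /= => /andP[_ tpi].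
  rewrite indicE memNset //= in_itv /= andbT => xt; lra.
have [xNpi|xNpi] := ltP x (- pi).
  apply: trigapprox_ext (trigapprox_cst 1) => t; rewrite /torus /= in_itv /= => /andP[tpi _].
  by rewrite indicE mem_set //= in_itv /= andbT; lra.
(* on the torus this is positive exactly on ]x, pi[ *)
pose s t : R := cos (t - (x + pi) / 2) - cos ((pi - x) / 2).
have sE t : s t = 2 * (sin ((t - x) / 2) * sin ((pi - t) / 2)).
  rewrite /s; have -> : t - (x + pi) / 2 = (t - x) / 2 - (pi - t) / 2 by field.
  have -> : (pi - x) / 2 = (t - x) / 2 + (pi - t) / 2 by field.
  by rewrite cosB cosD; ring.
have slip : chordlipr s.
  rewrite /chordlipr /s; under eq_fun do rewrite rmorphB.
  by apply: chordlipD; [exact: chordlipr_cos|exact: chordlip_cst].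
have ms : measurable_fun torus s.
  apply: measurable_funTS; apply: continuous_measurable_fun => t.
  apply: continuousB; last exact: cst_continuous.
  apply: continuous_comp; last exact: continuous_cos.
  by apply: continuousB; [exact: cvg_id|exact: cst_continuous].
have clip (y : R) : [\/ y <= 0 /\ Num.min 1 (Num.max 0 y) = 0,
    0 <= y <= 1 /\ Num.min 1 (Num.max 0 y) = y | 1 <= y /\ Num.min 1 (Num.max 0 y) = 1].
  have [y0|y0] := leP y 0; first by constructor 1; rewrite min_r.
  have [y1|y1] := leP y 1; first by constructor 2; rewrite (ltW y0).
  by constructor 3; rewrite ltW.
(* Clipping m y to [0, 1]: as m grows this tends to the indicator of y > 0. *)
pose phi (m : nat) (y : R) := Num.min 1 (Num.max 0 (m%:R * y)).
have phi01 m y : 0 <= phi m y <= 1.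
  by rewrite /phi le_min ler01 le_max lexx /= ge_min lexx.
apply: (@trigapprox_lim (fun m t => phi m (s t)) _ (fun=> 1)).
- move=> m; apply: trigapprox_chordlip.
    apply: (@chordlipr_comp _ (phi m) (m%:R ^+ 2)) => //.
    move=> a b; rewrite -exprMn mulrBr /phi.
    move: (m%:R * s a) (m%:R * s b) => y z.
    by case: (clip y) => -[hy ->]; case: (clip z) => -[hz ->]; rewrite ?subrr ?expr0n ?sqr_ge0 //; nra.
  apply: measurable_minr; first exact: measurable_cst.
  apply: measurable_maxr; first exact: measurable_cst.
  by apply: measurable_funM => //; exact: measurable_cst.
- exact: rL2_indic.
- move=> t; rewrite /torus /= in_itv /= => /andP[tpi1 tpi2].
  rewrite indicE; have [xt|tx] := ltP x t.
    rewrite mem_set /=; last by rewrite in_itv /= xt.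
    have st : 0 < s t.
      rewrite sE mulr_gt0 // mulr_gt0 // sin_gt0_pi //; apply/andP; split; lra.
    apply: cvg_near_cst; exists (Num.truncn (s t)^-1).+1 => // m /= hm.
    have : 1 <= m%:R * s t.
      rewrite -ler_pdivrMr // mul1r; apply/ltW/(lt_le_trans (truncnS_gt _)).
      by rewrite ler_nat.
    by rewrite /phi; case: (clip (m%:R * s t)) => -[hy ->] h; lra.
  rewrite memNset /=; last by rewrite in_itv /= andbT; lra.
  have st : s t <= 0.
    rewrite sE pmulr_rle0 // mulr_le0_ge0 //.
      rewrite -oppr_ge0 -sinN sin_ge0_pi //; apply/andP; split; lra.
    by rewrite sin_ge0_pi //; apply/andP; split; lra.
  apply: cvg_near_cst; apply: nearW => m.
  have : m%:R * s t <= 0 by rewrite mulr_ge0_le0.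
  by rewrite /phi; case: (clip (m%:R * s t)) => -[hy ->] h; lra.
- exact: tintegrable_cst.
- move=> m t _; have /andP[h0 h1] := phi01 m (s t).
  by rewrite indicE; move: (phi m _) h0 h1 => y; case: (_ \in _) => /= h0 h1; nra.
Qed.

(** Open rays are stable under intersection and generate the Borel sets, and the sets with
    approximable indicator are stable under complement and countable disjoint union, so Dynkin's
    theorem applies. *)
Lemma trigapprox_indic A : measurable A -> trigapprox (\1_A).
Proof.
move=> mA.
have sA : (@RGenOInfty.G R).-sigma.-measurable A.
  by rewrite -RGenOInfty.measurableE; exact: mA.
move: A sA {mA}; apply: (@dynkin_induction _ R (@RGenOInfty.G R) (fun A => trigapprox (\1_A))).
- exact: RGenOInfty.measurableE.
- move=> _ _ [x ->] [y ->]; exists (Num.max x y); apply/seteqP; split => t /=.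
    by rewrite !in_itv /= !andbT gt_max => -[-> ->].
  by rewrite !in_itv /= !andbT gt_max => /andP[].
- by rewrite indicT; exact: trigapprox_cst.
- by move=> _ [x ->]; exact: trigapprox_ray.
- move=> S mS aS; apply: trigapprox_ext (trigapproxD (trigapprox_cst 1) (trigapproxZ (-1) aS)).
  by move=> t _; rewrite !indicE in_setC; case: (_ \in _); rewrite /= ?mulr1 ?mulr0 ?subrr ?addr0.
- move=> F mF tF aF.
  (* Disjointness leaves at most one nonzero indicator, so the partial sums are themselves 0 or 1
     and the constant 1 dominates the squared errors. *)
  pose v_ m t : R := \sum_(0 <= k < m) \1_(F k) t.
  have v_1 m k t : F k t -> v_ m t = (k < m)%:R.
    move=> Fkt; rewrite /v_ (eq_bigr (fun j => (j == k)%:R)).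
      rewrite big_mkord.
      have [km|mk] := ltnP k m.
        rewrite (bigD1 (Ordinal km)) //= eqxx big1 ?addr0 // => j jk.
        by rewrite -(inj_eq val_inj) /= in jk; rewrite (negbTE jk).
      by rewrite big1 // => j _; case: eqP => // jk; move: (ltn_ord j); rewrite jk ltnNge mk.
    move=> j _; rewrite indicE; have [->|jk] := eqVneq j k; first by rewrite mem_set.
    rewrite memNset // => Fjt; move/trivIsetP: tF => /(_ j k I I jk) h.
    by have : (F j `&` F k) t by []; rewrite h.
  have v_0 m t : ~ (\bigcup_k F k) t -> v_ m t = 0.
    move=> nF; rewrite /v_ big1 // => k _; rewrite indicE memNset // => Fk.
    by apply: nF; exists k.
  have mU : measurable (\bigcup_k F k) by exact: bigcup_measurable.
  apply: (@trigapprox_lim v_ _ (fun=> 1)).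
  + by move=> m; exact: trigapprox_sum.
  + exact: rL2_indic.
  + move=> t _; rewrite indicE; have [[k _ Fk]|nF] := pselect ((\bigcup_k F k) t).
      rewrite mem_set //=; last by exists k.
      apply: cvg_near_cst; exists k.+1 => // m /= km.
      by rewrite (v_1 _ _ _ Fk) km.
    by rewrite memNset //; apply: cvg_near_cst; apply: nearW => m; rewrite v_0.
  + exact: tintegrable_cst.
  + move=> m t _; rewrite indicE; have [[k _ Fk]|nF] := pselect ((\bigcup_k F k) t).
      rewrite mem_set //=; last by exists k.
      by rewrite (v_1 _ _ _ Fk); case: (_ < _)%N; rewrite ?subrr ?subr0 ?expr0n ?expr1n.
    by rewrite memNset // v_0 // subrr expr0n.
Qed.

Lemma trigapprox_ge0 v : rL2 v -> (forall t, torus t -> 0 <= v t) -> trigapprox v.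
Proof.
move=> Lv v0; have mv : measurable_fun torus (EFin \o v) by apply/measurable_EFinP; exact: Lv.1.
pose v_ := nnsfun_approx (@measurable_torus R) mv.
have vlim t : torus t -> v_ m t @[m --> \oo] --> v t.
  move=> Dt; have v0' x : torus x -> (0 <= (EFin \o v) x)%E by move=> Dx; rewrite lee_fin v0.
  exact: (fine_cvg (cvg_nnsfun_approx (@measurable_torus R) mv v0' Dt)).
have v_le m t : torus t -> v_ m t <= v t.
  move=> Dt; have := vlim t Dt => h; rewrite -(cvg_lim _ h) //.
  apply: nondecreasing_cvgn_le.
    by move=> a b ab; have /lefP := nd_nnsfun_approx (@measurable_torus R) mv ab; apply.
  by apply/cvg_ex; eexists; exact: h.
have v_ge0 m t : 0 <= v_ m t by exact: fun_ge0.
apply: (@trigapprox_lim (fun m => v_ m) _ (fun t => v t ^+ 2)) => //.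
- move=> m; rewrite (funext (fimfunEord (v_ m))).
  apply: trigapprox_sum => i; apply: trigapproxZ; apply: trigapprox_indic.
  exact: measurable_funPTI.
- exact: Lv.2.
- move=> m t Dt; have := v_le m t Dt; have := v_ge0 m t; nra.
Qed.

Lemma trigapprox_rL2 v : rL2 v -> trigapprox v.
Proof.
move=> Lv.
have h (w : R -> R) : rL2 w -> rL2 (fun t => Num.max 0 (w t)).
  move=> [mw wi]; apply: (rL2_le _ wi).
    by apply: measurable_maxr => //; exact: measurable_cst.
  by move=> t _; case: (leP 0 (w t)) => // _; rewrite expr0n sqr_ge0.
have h' (w : R -> R) : rL2 w -> trigapprox (fun t => Num.max 0 (w t)).
  by move=> Lw; apply: trigapprox_ge0; [exact: h|move=> t _; rewrite le_max lexx].
apply: trigapprox_ext (trigapproxD (h' _ Lv) (trigapproxZ (-1) (h' _ (rL2Z (-1) Lv)))).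
by move=> t _; rewrite !mulN1r; case: (leP 0 (v t)) => ?; case: (leP 0 (- v t)) => ?; lra.
Qed.

(** Density gives a trigonometric polynomial close to [F]; the Fourier section over the same
    frequencies is at least as close, and its negative part contributes nothing. *)
Lemma parseval_nonneg_freq (F : R -> R[i]) (e : R) : cL2 F -> 0 < e ->
  (forall k : int, k < 0 -> fcoef F k = 0) ->
  exists N : nat, tint (fun t => nsq (F t)) - \sum_(0 <= k < N) nsq (fcoef F k%:Z) <= e.
Proof.
move=> LF e0 F0; have e2 : 0 < e / 2 by rewrite divr_gt0.
have [p hp] := (trigapprox_rL2 (rL2_Re LF)).2 _ e2.
have [p' hp'] := (trigapprox_rL2 (rL2_Im LF)).2 _ e2.
pose n := maxn (size p) (size p').
(* Re p + i Re p' written in exponentials: [al] collects the coefficients at frequencies k, [ga]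
   those at -k, and frequency 0 receives both. *)
pose al k : R[i] := (p`_k + 'i%C * p'`_k) / 2.
pose ga k : R[i] := (Num.conj p`_k + 'i%C * Num.conj p'`_k) / 2.
pose a (k : int) : R[i] := match k with
  Posz m => if m == 0%N then al 0%N + ga 0%N else al m | Negz m => ga m.+1 end.
(* The frequencies 0, ..., n and -1, ..., -n, as [Negz m] is -(m + 1). *)
pose s : seq int := map Posz (iota 0 n.+1) ++ map Negz (iota 0 n).
have us : uniq s.
  rewrite cat_uniq !map_inj_uniq ?iota_uniq /=; try by move=> ? ? [].
  by rewrite andbT; apply/hasPn => _ /mapP[k _ ->]; apply/mapP => -[].
have aE t : \sum_(k <- s) a k * expi k t =
    (Re p.[expi 1 t])%:C + 'i%C * (Re p'.[expi 1 t])%:C.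
  have hornE (u : {poly R[i]}) : (size u <= n)%N ->
      (Re u.[expi 1 t])%:C = (\sum_(0 <= k < n.+1) u`_k * expi k%:Z t) / 2 +
        (\sum_(0 <= k < n.+1) Num.conj u`_k * expi (- k%:Z) t) / 2.
    move=> un; have uE : u.[expi 1 t] = \sum_(0 <= k < n.+1) u`_k * expi k%:Z t.
      rewrite (@horner_coef_wide _ n.+1); last by rewrite (leq_trans un).
      by rewrite big_mkord; apply: eq_bigr => k _; rewrite expiX.
    have -> : \sum_(0 <= k < n.+1) Num.conj u`_k * expi (- k%:Z) t = Num.conj u.[expi 1 t].
      by rewrite uE rmorph_sum; apply: eq_bigr => k _; rewrite rmorphM /= expiJ.
    rewrite -uE -mulrDl conjE; apply: (mulIf (x := 2)); first by rewrite pnatr_eq0.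
    rewrite divfK ?pnatr_eq0 //; case: u.[_] => x y /=.
    by apply: complex_ext; rewrite /=; ring.
  rewrite !hornE ?leq_maxr ?leq_maxl // /s big_cat !big_map.
  have -> : \sum_(j <- iota 0 n.+1) a j * expi j t =
      ga 0%N + \sum_(0 <= k < n.+1) al k * expi k%:Z t.
    rewrite -/(index_iota 0 n.+1) !big_nat_recl // !expi0 !mulr1 addrA.
    by rewrite [ga _ + _]addrC.
  have -> : \sum_(j <- iota 0 n) a (Negz j) * expi (Negz j) t =
      \sum_(0 <= k < n.+1) ga k * expi (- k%:Z) t - ga 0%N.
    rewrite big_nat_recl // expi0 mulr1 [ga _ + _]addrC addrK /index_iota subn0.
    by apply: eq_bigr => k _; rewrite NegzE.
  have cancel (x y z : R[i]) : x + y + (z - x) = y + z by ring.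
  rewrite /= cancel.
  rewrite mulrDr addrACA !mulr_suml !mulr_sumr -!big_split /=.
  by apply: eq_bigr => k _; rewrite /al /ga; ring.
exists n.+1.
have := tint_nsqB_trig a LF us; rewrite [\sum_(k <- s) nsq (fcoef F k)]big_cat !big_map.
rewrite [X in _ - (_ + X)]big1_seq ?addr0; last first.
  by move=> k _; rewrite F0 ?nsq0.
rewrite -/(index_iota 0 n.+1) => E.
apply: (@le_trans _ _ (tint (fun t => nsq (F t - \sum_(k <- s) a k * expi k t)))).
  by rewrite E lerDl sumr_ge0 // => k _; exact: nsq_ge0.
have -> : e = e / 2 + e / 2 by field.
apply: le_trans (lerD hp hp'); rewrite -tintD; last 2 first.
- exact: (rL2B (rL2_Re LF) (rL2_poly p)).2.
- exact: (rL2B (rL2_Im LF) (rL2_poly p')).2.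
rewrite le_eqVlt; apply/orP; left; apply/eqP; apply: tint_eq => t _.
by rewrite aE /nsq ReB ImB !(ReD, ImD, ReM, ImM) /=; ring.
Qed.

End TrigDensity.

(** * Uniform limits through products and determinants *)

Section UniformLimits.
Variables (R : realType) (X : Type).
Implicit Types (T : nat -> X -> R[i]) (S : X -> R[i]).

(** Boundedness of the limit is included because it is what makes uniform convergence stable under
    products, hence under determinants. *)
Definition uconv T S := (exists2 C : R, 0 <= C & forall x, nsq (S x) <= C) /\
  forall e : R, 0 < e -> exists N0, forall N, (N0 <= N)%N -> forall x,
    nsq (T N x - S x) <= e.

Lemma uconv_cst (c : R[i]) : uconv (fun _ _ => c) (fun=> c).
Proof.
split; first by exists (nsq c) => //; exact: nsq_ge0.
by move=> e e0; exists 0%N => N _ x; rewrite subrr nsq0 ltW.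
Qed.

Lemma uconvD T S T' S' : uconv T S -> uconv T' S' ->
  uconv (fun N x => T N x + T' N x) (fun x => S x + S' x).
Proof.
move=> [[C C0 SC] TS] [[C' C'0 SC'] TS']; split.
  exists (2 * C + 2 * C'); first by rewrite addr_ge0 ?mulr_ge0.
  by move=> x; apply: (le_trans (nsqD_le2 _ _)); rewrite lerD // ler_wpM2l.
move=> e e0; have e4 : 0 < e / 4 by rewrite divr_gt0.
have [N0 h] := TS _ e4; have [N0' h'] := TS' _ e4.
exists (maxn N0 N0') => N; rewrite geq_max => /andP[hN hN'] x.
rewrite opprD addrACA; apply: (le_trans (nsqD_le2 _ _)).
by have := h _ hN x; have := h' _ hN' x; lra.
Qed.

Lemma uconvM T S T' S' : uconv T S -> uconv T' S' ->
  uconv (fun N x => T N x * T' N x) (fun x => S x * S' x).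
Proof.
move=> [[C C0 SC] TS] [[C' C'0 SC'] TS']; split.
  exists (C * C'); first by rewrite mulr_ge0.
  by move=> x; rewrite nsqM ler_pM ?nsq_ge0.
move=> e e0.
pose d := Num.min 1 (e / (4 * (1 + 4 * C' + C))).
have D0 : 0 < 4 * (1 + 4 * C' + C) by lra.
have d0 : 0 < d by rewrite lt_min ltr01 divr_gt0.
have d1 : d <= 1 by rewrite ge_min lexx.
have de : d * (4 * (1 + 4 * C' + C)) <= e.
  by rewrite -ler_pdivlMr // ge_min lexx orbT.
have [N0 h] := TS _ d0; have [N0' h'] := TS' _ d0.
exists (maxn N0 N0') => N; rewrite geq_max => /andP[hN hN'] x.
have hA := h _ hN x; have hB := h' _ hN' x.
have -> : T N x * T' N x - S x * S' x =
  (T N x - S x) * T' N x + S x * (T' N x - S' x) by ring.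
apply: (le_trans (nsqD_le2 _ _)); rewrite !nsqM.
have hT' : nsq (T' N x) <= 2 + 2 * C'.
  rewrite -[T' N x](subrK (S' x)); apply: (le_trans (nsqD_le2 _ _)).
  by have := SC' x; lra.
have := ler_pM (nsq_ge0 _) (nsq_ge0 _) hA hT'.
have := ler_pM (nsq_ge0 _) (nsq_ge0 _) (SC x) hB.
nra.
Qed.

Lemma uconv_sum (I : Type) (s : seq I) (T : I -> nat -> X -> R[i])
    (S : I -> X -> R[i]) :
  (forall i, uconv (T i) (S i)) ->
  uconv (fun N x => \sum_(i <- s) T i N x) (fun x => \sum_(i <- s) S i x).
Proof.
move=> TS; elim: s => [|i s IH].
  by under eq_fun do [under eq_fun do rewrite big_nil];
     under [X in uconv _ X]eq_fun do rewrite big_nil; exact: uconv_cst.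
have -> : (fun N x => \sum_(j <- i :: s) T j N x) =
     (fun N x => T i N x + \sum_(j <- s) T j N x).
  by apply/funext => N; apply/funext => x; rewrite big_cons.
by under [X in uconv _ X]eq_fun do rewrite big_cons; exact: uconvD.
Qed.

Lemma uconv_prod (I : Type) (s : seq I) (T : I -> nat -> X -> R[i])
    (S : I -> X -> R[i]) :
  (forall i, uconv (T i) (S i)) ->
  uconv (fun N x => \prod_(i <- s) T i N x) (fun x => \prod_(i <- s) S i x).
Proof.
move=> TS; elim: s => [|i s IH].
  by under eq_fun do [under eq_fun do rewrite big_nil];
     under [X in uconv _ X]eq_fun do rewrite big_nil; exact: uconv_cst.
have -> : (fun N x => \prod_(j <- i :: s) T j N x) =
     (fun N x => T i N x * \prod_(j <- s) T j N x).
  by apply/funext => N; apply/funext => x; rewrite big_cons.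
by under [X in uconv _ X]eq_fun do rewrite big_cons; exact: uconvM.
Qed.

Lemma uconv_det (n : nat) (T : nat -> X -> 'M[R[i]]_n) (S : X -> 'M[R[i]]_n) :
  (forall i j, uconv (fun N x => T N x i j) (fun x => S x i j)) ->
  uconv (fun N x => \det (T N x)) (fun x => \det (S x)).
Proof.
move=> TS; rewrite /determinant; apply: uconv_sum => s.
by apply: uconvM; [exact: uconv_cst|exact: uconv_prod].
Qed.

Lemma uconv_nsq_le T S (e : R) : uconv T S -> 0 < e ->
  exists N0, forall N, (N0 <= N)%N -> forall x, nsq (T N x) <= nsq (S x) + e.
Proof.
move=> [[C C0 SC] TS] e0.
pose d := e / (2 * (C + 1)); have d0 : 0 < d by rewrite divr_gt0 //; lra.
have dC : d * C <= e / 2.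
  have -> : e / 2 = d * (C + 1) by rewrite /d; field; rewrite gt_eqF //; lra.
  by rewrite ler_wpM2l ?(ltW d0) //; lra.
have e2 : 0 < e / (2 * (1 + d^-1)).
  by rewrite divr_gt0 // mulr_gt0 // addr_gt0 // invr_gt0.
have [N0 h] := TS _ e2; exists N0 => N hN x.
rewrite -[T N x](subrK (S x)) addrC; apply: (le_trans (nsqD_le _ _ d0)).
have i0 : 0 < 1 + d^-1 by rewrite addr_gt0 // invr_gt0.
have h1 : (1 + d^-1) * nsq (T N x - S x) <= e / 2.
  apply: (@le_trans _ _ ((1 + d^-1) * (e / (2 * (1 + d^-1))))).
    by rewrite ler_wpM2l ?h // ltW.
  rewrite le_eqVlt; apply/orP; left; apply/eqP; move: (1 + d^-1) i0 => y y0.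
  by field; rewrite gt_eqF.
have := ler_wpM2l (ltW d0) (SC x); lra.
Qed.

End UniformLimits.

(** * Complex power series with geometric tails *)

Section ComplexSeries.
Variable R : realType.
Implicit Types (u c : nat -> R[i]) (l z : R[i]).
Local Notation Re := complex.Re.
Local Notation Im := complex.Im.

Lemma normc_lt (z : R[i]) (e : R) : 0 < e -> (`|z| < e%:C) = (nsq z < e ^+ 2).
Proof.
move=> e0; rewrite normc_nsq ltcR -[X in _ < X](ger0_norm (ltW e0)) -sqrtr_sqr.
by rewrite ltr_sqrt // exprn_gt0.
Qed.

(** The radii in the topology of [R[i]^o] are positive elements of [R[i]], that is, real ones; this
    passes to real radii and [nsq]. *)
Lemma cvgc_nsq u l : (u : nat -> R[i]^o) @ \oo --> (l : R[i]^o) <->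
  forall e : R, 0 < e -> exists N0, forall N, (N0 <= N)%N -> nsq (l - u N) < e ^+ 2.
Proof.
split.
- move=> /cvgrPdist_lt ul e e0.
  have /ul [N0 _ h] : 0 < e%:C :> R[i] by rewrite ltcR.
  by exists N0 => N hN; rewrite -normc_lt //; exact: h.
- move=> h; apply/cvgrPdist_lt => -[e e']; rewrite ltcE /= => /andP[/eqP -> e0].
  have [N0 hN0] := h _ e0; exists N0 => // N hN.
  by rewrite /= (normc_lt _ e0); exact: hN0.
Qed.

Lemma cvgc_Re_Im u (a b : R) : (fun n => Re (u n)) @ \oo --> a ->
  (fun n => Im (u n)) @ \oo --> b -> (u : nat -> R[i]^o) @ \oo --> (a +i* b : R[i]^o).
Proof.
move=> /cvgrPdist_lt ua /cvgrPdist_lt ub; apply/cvgc_nsq => e e0.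
have e2 : 0 < e / 2 by rewrite divr_gt0.
have [N1 _ h1] := ua _ e2; have [N2 _ h2] := ub _ e2.
exists (maxn N1 N2) => N; rewrite geq_max => /andP[hN1 hN2].
have := h1 _ hN1; have := h2 _ hN2; rewrite /= /nsq ReB ImB /=.
rewrite -(real_normK (num_real (a - _))) -(real_normK (num_real (b - _))).
have := normr_ge0 (a - Re (u N)); have := normr_ge0 (b - Im (u N)).
move: `|a - _| `|b - _| => x y; nra.
Qed.

Lemma real_power_series_tail (a : nat -> R) (M r : R) : 0 <= r -> r < 1 ->
  (forall k, `|a k| <= M * r ^+ k) ->
  exists l : R, series a @ \oo --> l /\
    forall N, `|l - \sum_(0 <= k < N) a k| <= M / (1 - r) * r ^+ N.
Proof.
move=> r0 r1 aM; have M0 : 0 <= M by have := le_trans (normr_ge0 _) (aM 0%N); rewrite expr0 mulr1.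
have r1' : 0 < 1 - r by rewrite subr_gt0.
have geo m n : (m <= n)%N -> \sum_(m <= k < n) M * r ^+ k <= M / (1 - r) * r ^+ m.
  move=> mn; have -> : \sum_(m <= k < n) M * r ^+ k = M / (1 - r) * (r ^+ m - r ^+ n).
    elim: n mn => [|n IH].
      by rewrite leqn0 => /eqP ->; rewrite big_geq // subrr mulr0.
    rewrite leq_eqVlt => /predU1P[->|]; first by rewrite big_geq // subrr mulr0.
    rewrite ltnS => mn; rewrite big_nat_recr //= IH // exprS.
    by field; rewrite gt_eqF.
  by rewrite ler_wpM2l ?lerBlDr ?lerDl ?exprn_ge0 ?divr_ge0 // ltW.
have tail m n : (m <= n)%N -> `|\sum_(m <= k < n) a k| <= M / (1 - r) * r ^+ m.
  move=> mn; apply: le_trans (geo m n mn); apply: (le_trans (ler_norm_sum _ _ _)).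
  by apply: ler_sum => k _; exact: aM.
have cva : cvgn (series a).
  apply: normed_cvg; apply: (@series_le_cvg _ _ (fun k => M * r ^+ k)).
  - by move=> k; exact: normr_ge0.
  - by move=> k; rewrite mulr_ge0 ?exprn_ge0.
  - exact: aM.
  - by apply: is_cvg_geometric_series; rewrite ger0_norm.
exists (limn (series a)); split => // N.
have h : (fun n => `|series a n - \sum_(0 <= k < N) a k|) @ \oo -->
    `|limn (series a) - \sum_(0 <= k < N) a k|.
  by apply: cvg_norm; apply: cvgB => //; exact: cvg_cst.
rewrite -(cvg_lim _ h) //; apply: limr_le; first by apply/cvg_ex; eexists; exact: h.
exists N => // n /= Nn.
by rewrite /series /= (big_cat_nat _ Nn) //= [X in `|X|]addrC addKr; exact: tail.
Qed.

Lemma power_series_tail c (M r : R) z : 0 <= r -> r < 1 -> 0 <= M ->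
  (forall k, nsq (c k) <= M ^+ 2) -> nsq z <= r ^+ 2 ->
  exists l, (series (fun k => c k * z ^+ k : R[i]^o)) @ \oo --> (l : R[i]^o) /\
    forall N, nsq (l - \sum_(0 <= k < N) c k * z ^+ k) <= 2 * (M / (1 - r) * r ^+ N) ^+ 2.
Proof.
move=> r0 r1 M0 cM zr.
have h k : nsq (c k * z ^+ k) <= (M * r ^+ k) ^+ 2.
  rewrite nsqM nsqX exprMn -exprM mulnC exprM ler_pM ?nsq_ge0 ?exprn_ge0 ?nsq_ge0 //.
  by rewrite lerXn2r ?nnegrE ?nsq_ge0 ?sqr_ge0.
have Mr k : 0 <= M * r ^+ k by rewrite mulr_ge0 ?exprn_ge0.
have hre k : `|Re (c k * z ^+ k)| <= M * r ^+ k.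
  rewrite -ler_sqr ?nnegrE // real_normK ?num_real //.
  exact: le_trans (Re_nsq _) (h k).
have him k : `|Im (c k * z ^+ k)| <= M * r ^+ k.
  rewrite -ler_sqr ?nnegrE // real_normK ?num_real //.
  exact: le_trans (Im_nsq _) (h k).
have [a [ca ta]] := real_power_series_tail r0 r1 hre.
have [b [cb tb]] := real_power_series_tail r0 r1 him.
exists (a +i* b); split.
  apply: cvgc_Re_Im.
  - by rewrite (_ : (fun n => _) = series (fun k => Re (c k * z ^+ k))) //;
       apply/funext => n; rewrite /series /= Re_sum.
  - by rewrite (_ : (fun n => _) = series (fun k => Im (c k * z ^+ k))) //;
       apply/funext => n; rewrite /series /= Im_sum.
move=> N; rewrite /nsq ReB ImB Re_sum Im_sum /=.
have := ta N; have := tb N.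
rewrite -(real_normK (num_real (a - _))) -(real_normK (num_real (b - _))).
move: (normr_ge0 (a - \sum_(0 <= i < N) Re (c i * z ^+ i))) (normr_ge0 (b - \sum_(0 <= i < N) Im (c i * z ^+ i))).
move: `|a - _| `|b - _| (M / (1 - r) * r ^+ N) => x y w; nra.
Qed.

Lemma limn_powser c (M r : R) z : 0 <= r -> r < 1 -> 0 <= M ->
  (forall k, nsq (c k) <= M ^+ 2) -> nsq z <= r ^+ 2 -> forall N,
  nsq (limn (series (fun k => c k * z ^+ k : R[i]^o)) - \sum_(0 <= k < N) c k * z ^+ k)
    <= 2 * (M / (1 - r) * r ^+ N) ^+ 2.
Proof.
move=> r0 r1 M0 cM zr; have [l [cl tl]] := power_series_tail r0 r1 M0 cM zr.
by rewrite (cvg_lim _ cl).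
Qed.

End ComplexSeries.

(** * Square-integrable matrix functions *)

Section Frobenius.
Variables (R : realType) (q : nat).
Implicit Types (A B : 'M[R[i]]_q).

Definition fro A : R := \sum_i \sum_j nsq (A i j).

Lemma fro_ge0 A : 0 <= fro A.
Proof. by apply: sumr_ge0 => i _; apply: sumr_ge0 => j _; exact: nsq_ge0. Qed.

Lemma nsq_le_fro A i j : nsq (A i j) <= fro A.
Proof.
rewrite /fro (bigD1 i) //= (bigD1 j) //= -addrA lerDl addr_ge0 //.
  by apply: sumr_ge0 => k _; exact: nsq_ge0.
by apply: sumr_ge0 => k _; apply: sumr_ge0 => l _; exact: nsq_ge0.
Qed.

Lemma fro_eq0 A : fro A = 0 -> A = 0.
Proof.
move=> A0; apply/matrixP => i j; rewrite mxE; apply/eqP; rewrite -nsq_eq0.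
by rewrite eq_le nsq_ge0 andbT -A0 nsq_le_fro.
Qed.

Lemma fro0 : fro 0 = 0.
Proof. by rewrite /fro big1 // => i _; rewrite big1 // => j _; rewrite mxE nsq0. Qed.

Lemma fro_adjoint A : fro (A ^t*) = fro A.
Proof.
rewrite /fro exchange_big /=; apply: eq_bigr => i _; apply: eq_bigr => j _.
by rewrite !mxE nsqJ.
Qed.

Lemma froN A : fro (- A) = fro A.
Proof. by apply: eq_bigr => i _; apply: eq_bigr => j _; rewrite mxE nsqN. Qed.

Lemma froZ (a : R[i]) A : fro (a *: A) = nsq a * fro A.
Proof.
rewrite /fro mulr_sumr; apply: eq_bigr => i _; rewrite mulr_sumr.
by apply: eq_bigr => j _; rewrite mxE nsqM.
Qed.

Lemma fro1 : fro 1%:M = q%:R.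
Proof.
rewrite /fro (eq_bigr (fun=> 1)) ?sumr_const ?card_ord // => i _.
rewrite (bigD1 i) //= big1 ?addr0 => [|j ij]; rewrite mxE ?eqxx ?nsq1 //.
by rewrite eq_sym (negbTE ij) nsq0.
Qed.

Lemma froD_le (e : R) A B : 0 < e ->
  fro (A + B) <= (1 + e) * fro A + (1 + e^-1) * fro B.
Proof.
move=> e0; rewrite /fro !mulr_sumr -big_split; apply: ler_sum => i _ /=.
rewrite !mulr_sumr -big_split; apply: ler_sum => j _ /=.
by rewrite mxE nsqD_le.
Qed.

Lemma froD_le2 A B : fro (A + B) <= 2 * fro A + 2 * fro B.
Proof. by have := froD_le A B ltr01; rewrite invr1. Qed.

(** The factor q comes from using [nsq_sum_le] in place of the sharp Cauchy-Schwarz inequality;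
    constants depending on q alone are harmless in what follows. *)
Lemma fro_mulmx A B : fro (A *m B) <= q%:R * fro A * fro B.
Proof.
have h i j : nsq ((A *m B) i j) <= q%:R * \sum_k nsq (A i k) * nsq (B k j).
  rewrite mxE; apply: (le_trans (nsq_sum_le _ _)).
  rewrite -[index_enum _]enumT size_enum_ord ler_wpM2l //.
  by apply: ler_sum => k _; rewrite nsqM.
apply: (@le_trans _ _ (\sum_i \sum_j q%:R * \sum_k nsq (A i k) * nsq (B k j))).
  by apply: ler_sum => i _; apply: ler_sum => j _; exact: h.
rewrite -mulrA {1}/fro mulr_suml mulr_sumr; apply: ler_sum => i _.
rewrite -mulr_sumr ler_wpM2l // exchange_big mulr_suml; apply: ler_sum => k _ /=.
rewrite -mulr_sumr ler_wpM2l ?nsq_ge0 // /fro [leRHS](bigD1 k) //= lerDl.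
by apply: sumr_ge0 => l _; apply: sumr_ge0 => j _; exact: nsq_ge0.
Qed.

Lemma nsq_prod (I : Type) (s : seq I) (F : I -> R[i]) :
  nsq (\prod_(i <- s) F i) = \prod_(i <- s) nsq (F i).
Proof. by apply: (big_morph _ (@nsqM R)); exact: nsq1. Qed.

End Frobenius.

Lemma nsq_det_le (R : realType) (n : nat) (A : 'M[R[i]]_n) (c : R) : 0 <= c ->
  (forall i j, nsq (A i j) <= c) -> nsq (\det A) <= (n`!%:R) ^+ 2 * c ^+ n.
Proof.
move=> c0 Ac; rewrite /determinant; apply: (le_trans (nsq_sum_le _ _)).
rewrite -[X in size X]enumT -cardE card_Sn.
rewrite expr2 -mulrA ler_wpM2l //.
apply: (@le_trans _ _ (\sum_(s : {perm 'I_n}) c ^+ n)).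
  apply: ler_sum => s _; rewrite nsqM nsqX nsqN nsq1 expr1n mul1r nsq_prod.
  rewrite -[in leRHS](card_ord n) -prodr_const; apply: ler_prod => i _.
  by rewrite nsq_ge0 Ac.
by rewrite sumr_const card_Sn mulr_natl.
Qed.

(** Cofactors are determinants of order q - 1. The factorial and the exponent are enlarged to q and
    the base to 1 + [fro A], the shape that [entropy_bound] can absorb factor by factor. *)
Lemma fro_adj_le (R : realType) (q : nat) (A : 'M[R[i]]_q) :
  fro (\adj A) <= (q%:R * q%:R * (q`!%:R) ^+ 2) * (1 + fro A) ^+ q.
Proof.
have f0 := fro_ge0 A.
have h i j : nsq (\adj A i j) <= (q`!%:R) ^+ 2 * (1 + fro A) ^+ q.
  rewrite mxE /cofactor nsqM nsqX nsqN nsq1 expr1n mul1r.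
  apply: (le_trans (nsq_det_le f0 _)).
    by move=> k l; rewrite !mxE; exact: nsq_le_fro.
  apply: ler_pM; rewrite ?exprn_ge0 //.
    rewrite ler_sqr ?nnegrE // ler_nat; case: (q) => // k /=.
    by rewrite factS leq_pmull.
  apply: (@le_trans _ _ ((1 + fro A) ^+ q.-1)).
    by rewrite lerXn2r ?nnegrE ?addr_ge0 // lerDr.
  by rewrite ler_weXn2l ?lerDl // leq_pred.
rewrite /fro; apply: (@le_trans _ _ (\sum_(i < q) \sum_(j < q) ((q`!%:R) ^+ 2 * (1 + fro A) ^+ q))).
  by apply: ler_sum => i _; apply: ler_sum => j _; exact: h.
rewrite (eq_bigr (fun=> q%:R * ((q`!%:R) ^+ 2 * (1 + fro A) ^+ q))) => [|i _].
  by rewrite sumr_const card_ord -[leLHS]mulr_natl !mulrA.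
by rewrite sumr_const card_ord mulr_natl.
Qed.

Section MatrixFunctions.
Variables (R : realType) (q : nat).
Implicit Types (F G : R -> 'M[R[i]]_q).

Definition mL2 F := forall i j, cL2 (fun t => F t i j).

Definition n2 F : R := tint (fun t => fro (F t)).

Lemma mL2_fro F : mL2 F -> tintegrable (fun t => fro (F t)).
Proof.
move=> LF; apply: tintegrable_sum => i; apply: tintegrable_sum => j.
exact: (LF i j).2.
Qed.

Lemma n2E F : mL2 F -> n2 F = \sum_i \sum_j tint (fun t => nsq (F t i j)).
Proof.
move=> LF; rewrite /n2 /fro tint_sum.
  apply: eq_bigr => i _; rewrite tint_sum // => j; exact: (LF i j).2.
by move=> i; apply: tintegrable_sum => j; exact: (LF i j).2.
Qed.

Lemma n2_ge0 F : 0 <= n2 F.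
Proof. by apply: tint_ge0 => t _; exact: fro_ge0. Qed.

Lemma mL2_cst A : mL2 (fun=> A).
Proof. by move=> i j; exact: cL2_cst. Qed.

Lemma mL2_eq F G : (forall t, F t = G t) -> mL2 F -> mL2 G.
Proof. by move=> /funext ->. Qed.

Lemma mL2D F G : mL2 F -> mL2 G -> mL2 (fun t => F t + G t).
Proof. by move=> LF LG i j; under eq_fun do rewrite mxE; exact: cL2D. Qed.

Lemma mL2B F G : mL2 F -> mL2 G -> mL2 (fun t => F t - G t).
Proof. by move=> LF LG i j; under eq_fun do rewrite !mxE; exact: cL2B. Qed.

Lemma mL2_sum (I : Type) (s : seq I) (F : I -> R -> 'M[R[i]]_q) :
  (forall i, mL2 (F i)) -> mL2 (fun t => \sum_(i <- s) F i t).
Proof.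
move=> LF i j; under eq_fun do rewrite summxE.
by apply: cL2_sum => k; exact: LF.
Qed.

Lemma mL2_adjoint F : mL2 F -> mL2 (fun t => F t ^t*).
Proof. by move=> LF i j; under eq_fun do rewrite !mxE; exact: cL2J. Qed.

Lemma n2_adjoint F : n2 (fun t => F t ^t*) = n2 F.
Proof. by apply: tint_eq => t _; rewrite fro_adjoint. Qed.

Definition mbounded F := mxmeasurable F /\ exists2 C : R, 0 <= C & forall t, fro (F t) <= C.

Lemma mL2_bounded F : mbounded F -> mL2 F.
Proof.
move=> [mF [C C0 FC]] i j; apply: (cL2_bounded (c := C)); first exact: mF.
by move=> t _; exact: le_trans (nsq_le_fro _ _ _) (FC t).
Qed.

Lemma mL2M_boundedr F G : mL2 F -> mbounded G -> mL2 (fun t => F t *m G t).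
Proof.
move=> LF [mG [C C0 GC]] i j; under eq_fun do rewrite mxE.
apply: cL2_sum => k; under eq_fun do rewrite mulrC.
apply: (cL2M_bounded (F := fun t => G t k j) (c := C)) => //.
by move=> t _; exact: le_trans (nsq_le_fro _ _ _) (GC t).
Qed.

Lemma mL2M_boundedl F G : mL2 F -> mbounded G -> mL2 (fun t => G t *m F t).
Proof.
move=> LF [mG [C C0 GC]] i j; under eq_fun do rewrite mxE.
apply: cL2_sum => k.
apply: (cL2M_bounded (F := fun t => G t i k) (c := C)) => //.
by move=> t _; exact: le_trans (nsq_le_fro _ _ _) (GC t).
Qed.

Lemma mbounded_cst A : mbounded (fun=> A).
Proof.
split; first by move=> i j; exact: cmeasurable_cst.
by exists (fro A) => //; exact: fro_ge0.
Qed.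

Lemma n2D_le (e : R) F G : mL2 F -> mL2 G -> 0 < e ->
  n2 (fun t => F t + G t) <= (1 + e) * n2 F + (1 + e^-1) * n2 G.
Proof.
move=> LF LG e0; have Fi := mL2_fro LF; have Gi := mL2_fro LG.
rewrite /n2 -(tintZ (1 + e) Fi) -(tintZ (1 + e^-1) Gi).
rewrite -(tintD (tintegrableZ (1 + e) Fi) (tintegrableZ (1 + e^-1) Gi)).
apply: le_tint.
- exact: mL2_fro (mL2D LF LG).
- exact: tintegrableD (tintegrableZ _ Fi) (tintegrableZ _ Gi).
- by move=> t _; exact: froD_le.
Qed.

Lemma n2D_le2 F G : mL2 F -> mL2 G ->
  n2 (fun t => F t + G t) <= 2 * n2 F + 2 * n2 G.
Proof. by move=> LF LG; have := n2D_le LF LG ltr01; rewrite invr1. Qed.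

Lemma n2_le F (g : R -> R) : mL2 F -> tintegrable g ->
  (forall t, torus t -> fro (F t) <= g t) -> n2 F <= tint g.
Proof. by move=> LF gi Fg; apply: le_tint => //; exact: mL2_fro. Qed.

Lemma n2M_boundedr F G (C : R) : mL2 F -> mbounded G -> 0 <= C ->
  (forall t, fro (G t) <= C) -> n2 (fun t => F t *m G t) <= q%:R * C * n2 F.
Proof.
move=> LF bG C0 GC; rewrite {2}/n2 -(tintZ _ (mL2_fro LF)); apply: n2_le.
- exact: mL2M_boundedr.
- exact: tintegrableZ (mL2_fro LF).
- move=> t _; apply: (le_trans (fro_mulmx _ _)).
  by rewrite -[leRHS]mulrA [C * _]mulrC mulrA ler_wpM2l // mulr_ge0 ?fro_ge0.
Qed.

Lemma n2M_boundedl F G (C : R) : mL2 F -> mbounded G -> 0 <= C ->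
  (forall t, fro (G t) <= C) -> n2 (fun t => G t *m F t) <= q%:R * C * n2 F.
Proof.
move=> LF bG C0 GC; rewrite {2}/n2 -(tintZ _ (mL2_fro LF)); apply: n2_le.
- exact: mL2M_boundedl.
- exact: tintegrableZ (mL2_fro LF).
- move=> t _; apply: (le_trans (fro_mulmx _ _)).
  by rewrite ler_wpM2r ?fro_ge0 // ler_wpM2l.
Qed.

Lemma fro_mxint_le F : mL2 F -> fro (mxint F) <= n2 F.
Proof.
move=> LF; rewrite n2E //; apply: ler_sum => i _; apply: ler_sum => j _.
by rewrite mxE; exact: nsq_cint_le.
Qed.

Lemma n2_variance F : mL2 F -> n2 (fun t => F t - mxint F) = n2 F - fro (mxint F).
Proof.
move=> LF; rewrite !n2E //; last by apply: mL2B => //; exact: mL2_cst.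
rewrite /fro -sumrB; apply: eq_bigr => i _; rewrite -sumrB; apply: eq_bigr => j _.
rewrite mxE -[RHS]addr0 -nsq0 -[in X in _ = _ + nsq X](subrr (cint (fun t => F t i j))).
by rewrite -tint_nsqB //; apply: tint_eq => t _; rewrite !mxE.
Qed.

Lemma mxint_eq F G : (forall t, torus t -> F t = G t) -> mxint F = mxint G.
Proof.
by move=> FG; apply/matrixP => i j; rewrite !mxE; apply: cint_eq => t Dt; rewrite FG.
Qed.

End MatrixFunctions.

(** * L^2 approximation by Taylor sections of dilations *)

Section HardyApproximation.
Variables (R : realType).

Definition dilated (c : nat -> R[i]) (r : R) (N : nat) : {poly R[i]} :=
  \poly_(k < N) ((r ^+ k)%:C * c k).

Lemma dilatedE c r N (t : R) :
  (dilated c r N).[expi 1 t] = \sum_(0 <= k < N) c k * (r%:C * expi 1 t) ^+ k.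
Proof.
rewrite horner_poly big_mkord; apply: eq_bigr => k _.
by rewrite exprMn -rmorphXn /=; ring.
Qed.

(** Frequencies below N0 lose only the factor 1 - r^k <= k (1 - r). All later ones, damped or cut
    off at N, contribute at most the Parseval tail. One K thus serves every r near 1 and every large
    N, which can be tuned afterwards. *)
Lemma dilated_approx (F : R -> R[i]) (e : R) : cL2 F -> 0 < e ->
  (forall k : int, k < 0 -> fcoef F k = 0) ->
  exists K : nat, forall (r : R) N, 0 <= r <= 1 -> (1 - r) * K%:R <= 1 -> (K <= N)%N ->
    tint (fun t => nsq (F t - (dilated (fun k => fcoef F k%:Z) r N).[expi 1 t])) <= e.
Proof.
move=> LF e0 F0; have e2 : 0 < e / 2 by rewrite divr_gt0.
have [N0 hN0] := parseval_nonneg_freq LF e2 F0.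
set M := tint (fun t => nsq (F t)) in hN0.
have M0 : 0 <= M by apply: tint_ge0 => t _; exact: nsq_ge0.
(* The second entry makes N0 (1 - r) M at most e / 2 as soon as (1 - r) K <= 1. *)
pose K := maxn N0 (Num.truncn (N0%:R * M / (e / 2))).+1.
exists K => r N /andP[r0 r1] rK KN.
have N0N : (N0 <= N)%N by rewrite (leq_trans _ KN) // leq_maxl.
pose a (k : int) : R[i] := (r ^+ `|k|%N)%:C * fcoef F k.
pose s : seq int := map Posz (index_iota 0 N).
have us : uniq s by rewrite map_inj_uniq ?iota_uniq // => ? ? [].
rewrite (@tint_eq _ _ (fun t => nsq (F t - \sum_(k <- s) a k * expi k t))); last first.
  move=> t _; congr (nsq (_ - _)); rewrite horner_poly big_map -(big_mkord xpredT (fun k => (r ^+ k)%:C * fcoef F k * expi 1 t ^+ k)).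
  by apply: eq_bigr => k _; rewrite expiX.
rewrite tint_nsqB_trig // -/M !big_map.
pose b k := nsq (fcoef F (Posz k)).
have b0 k : 0 <= b k by exact: nsq_ge0.
have dE k : nsq (fcoef F (Posz k) - a (Posz k)) = (1 - r ^+ k) ^+ 2 * b k.
  rewrite /a /= -[X in X - _]mul1r -mulrBl nsqM; congr (_ * _).
  by rewrite -(rmorph1 (real_complex R)) -rmorphB nsq_real.
under [X in _ + X]eq_bigr do rewrite dE.
have rk k : 0 <= 1 - r ^+ k <= 1.
  by rewrite subr_ge0 exprn_ile1 //= lerBlDr lerDl exprn_ge0.
have bern k : 1 - r ^+ k <= k%:R * (1 - r).
  elim: k => [|k IH]; first by rewrite expr0 subrr mul0r.
  have := rk k; have := exprn_ge0 k r0; rewrite exprS -natr1 mulrDl mul1r.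
  move: (r ^+ k) (k%:R * (1 - r)) IH => x y IH x0 /andP[x1 _].
  have : 0 <= (1 - x) * (1 - r) by apply: mulr_ge0; [exact: x1|rewrite subr_ge0].
  by lra.
have split (f : nat -> R) : \sum_(i <- index_iota 0 N) f i =
   \sum_(0 <= i < N0) f i + \sum_(N0 <= i < N) f i by rewrite (big_cat_nat (leq0n N0) N0N).
rewrite !split -/b.
have h1 : \sum_(0 <= i < N0) (1 - r ^+ i) ^+ 2 * b i <= e / 2.
  apply: (@le_trans _ _ (N0%:R * (1 - r) * M)).
    apply: (@le_trans _ _ (N0%:R * (1 - r) * \sum_(0 <= i < N0) b i)).
      rewrite mulr_sumr; apply: ler_sum_nat => i /andP[_ iN0].
      rewrite ler_wpM2r //; have /andP[h0 h1] := rk i.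
      apply: (@le_trans _ _ (1 - r ^+ i)); first by rewrite expr2 ler_piMl.
      apply: (le_trans (bern i)); rewrite ler_wpM2r ?subr_ge0 // ler_nat ltnW //.
    rewrite ler_wpM2l ?mulr_ge0 ?subr_ge0 //.
    have := bessel LF (s := map Posz (index_iota 0 N0)); rewrite big_map -/M; apply.
    by rewrite map_inj_uniq ?iota_uniq // => ? ? [].
  have hK : N0%:R * M / (e / 2) <= K%:R.
    apply/ltW/(lt_le_trans (truncnS_gt _)); rewrite ler_nat; exact: leq_maxr.
  rewrite ler_pdivrMr // in hK.
  have r1' : 0 <= 1 - r by rewrite subr_ge0.
  have := ler_wpM2l r1' hK; have := ler_wpM2r (ltW e2) rK; nra.
have h2 : \sum_(N0 <= i < N) (1 - r ^+ i) ^+ 2 * b i <= \sum_(N0 <= i < N) b i.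
  apply: ler_sum => i _; rewrite -[leRHS]mul1r ler_wpM2r // expr_le1 //; by case/andP: (rk i).
have -> : \sum_(0 <= i < N0) nsq (fcoef F (Posz i)) = \sum_(0 <= i < N0) b i by [].
move: h2; rewrite /b => h2; lra.
Qed.

End HardyApproximation.

Section PolynomialMatrices.
Variables (R : realType) (q : nat).
Implicit Types (P : 'M[{poly R[i]}]_q) (F : R -> 'M[R[i]]_q).

Definition meval P (z : R[i]) : 'M[R[i]]_q := map_mx (horner_eval z) P.

Lemma mevalE P z i j : meval P z i j = (P i j).[z].
Proof. by rewrite mxE. Qed.

Lemma meval_det P z : \det (meval P z) = (\det P).[z].
Proof. by rewrite /meval det_map_mx. Qed.

Lemma meval_adj P z : meval (\adj P) z = \adj (meval P z).
Proof. by rewrite /meval map_mx_adj. Qed.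

Lemma mevalZ (h : {poly R[i]}) P z : meval (h *: P) z = h.[z] *: meval P z.
Proof. by apply/matrixP => i j; rewrite !mxE /horner_eval hornerM. Qed.

Lemma mbounded_meval P : mbounded (fun t => meval P (expi 1 t)).
Proof.
split.
  by move=> i j; apply: cmeasurable_eq (cmeasurable_poly (P i j)) => t; rewrite mevalE.
have h (ij : 'I_q * 'I_q) : exists C : R, 0 <= C /\
    forall t, nsq (P ij.1 ij.2).[expi 1 t] <= C.
  by have [C C0 hC] := nsq_poly_bounded (P ij.1 ij.2); exists C.
have [C hC] := choice h.
exists (\sum_i \sum_j C (i, j)).
  by apply: sumr_ge0 => i _; apply: sumr_ge0 => j _; exact: (hC (i, j)).1.
move=> t; apply: ler_sum => i _; apply: ler_sum => j _.
by rewrite mevalE; exact: (hC (i, j)).2.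
Qed.

End PolynomialMatrices.

Section HardyMatrix.
Variables (R : realType) (q : nat) (Phi : R -> 'M[R[i]]_q).

Lemma fourierE (F : R -> 'M[R[i]]_q) k i j :
  fourier F k i j = fcoef (fun t => F t i j) k.
Proof. by rewrite mxE; apply: cint_eq => t _; rewrite mxE. Qed.

Lemma fourier0 (F : R -> 'M[R[i]]_q) : fourier F 0 = mxint F.
Proof.
apply/matrixP => i j; rewrite fourierE [RHS]mxE; apply: cint_eq => t _.
by rewrite oppr0 expi0 mul1r.
Qed.

Hypothesis hPhi : hardy2 Phi.

Lemma hardy2_mL2 : mL2 Phi.
Proof.
case: hPhi => mP iP _ i j; split; first exact: mP.
by apply: tintegrable_eq (iP i j) => t _; rewrite Re_normc_sqr.
Qed.

Lemma hardy2_fcoef i j (k : int) : k < 0 -> fcoef (fun t => Phi t i j) k = 0.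
Proof. by case: hPhi => _ _ h /h; rewrite -fourierE => ->; rewrite mxE. Qed.

Definition taylor_section (r : R) (N : nat) : 'M[{poly R[i]}]_q :=
  \matrix_(i, j) dilated (fun k => fourier Phi k%:Z i j) r N.

Lemma hardy2_approx (e : R) : 0 < e ->
  exists K : nat, forall (r : R) N, 0 <= r <= 1 -> (1 - r) * K%:R <= 1 -> (K <= N)%N ->
    n2 (fun t => Phi t - meval (taylor_section r N) (expi 1 t)) <= e.
Proof.
(* There are q^2 entries; the successor keeps the divisor nonzero when q = 0. *)
move=> e0; pose d := e / (q * q).+1%:R; have d0 : 0 < d by rewrite divr_gt0 ?ltr0n.
have h (ij : 'I_q * 'I_q) : exists K : nat, forall r N, 0 <= r <= 1 ->
     (1 - r) * K%:R <= 1 -> (K <= N)%N ->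
    tint (fun t => nsq (Phi t ij.1 ij.2 -
       (dilated (fun k => fourier Phi k%:Z ij.1 ij.2) r N).[expi 1 t])) <= d.
  case: ij => i j /=.
  have [K hK] := dilated_approx (hardy2_mL2 i j) d0 (@hardy2_fcoef i j).
  exists K => r N r01 rK KN.
  have -> : (fun k : nat => fourier Phi k%:Z i j) = (fun k => fcoef (fun t => Phi t i j) k%:Z).
    by apply/funext => k; rewrite fourierE.
  exact: hK.
have [K hK] := choice h.
exists (\max_ij K ij) => r N r01 rK KN.
have /andP[r0 r1] := r01.
rewrite n2E; last first.
  by apply: mL2B; [exact: hardy2_mL2|apply: mL2_bounded; exact: mbounded_meval].
apply: (@le_trans _ _ (\sum_(i < q) \sum_(j < q) d)).
  apply: ler_sum => i _; apply: ler_sum => j _.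
  have le := leq_bigmax (F := K) (i, j).
  apply: le_trans (hK (i, j) r N r01 _ (leq_trans le KN)); last first.
    by apply: le_trans rK; rewrite ler_wpM2l ?subr_ge0 // ler_nat.
  by rewrite le_eqVlt; apply/orP; left; apply/eqP; apply: tint_eq => t _; rewrite !mxE.
rewrite !sumr_const !card_ord -mulrnA -[leLHS]mulr_natl /d mulrCA -[leRHS]mulr1.
by rewrite ler_wpM2l ?(ltW e0) // ler_pdivrMr ?ltr0n // mul1r ler_nat.
Qed.

Lemma fourier_nsq_bound : exists2 M : R, 0 <= M &
  forall i j (k : nat), nsq (fourier Phi k%:Z i j) <= M ^+ 2.
Proof.
exists (1 + n2 Phi); first by rewrite addr_ge0 ?n2_ge0.
move=> i j k; rewrite fourierE; apply: (le_trans (nsq_fcoef_le _ (hardy2_mL2 i j))).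
have h : tint (fun t => nsq (Phi t i j)) <= n2 Phi.
  apply: le_tint; [exact: (hardy2_mL2 i j).2|exact: mL2_fro hardy2_mL2|].
  by move=> t _; exact: nsq_le_fro.
apply: (le_trans h); have := n2_ge0 Phi; nra.
Qed.

Lemma disc_ext_tail (r : R) : 0 <= r -> r < 1 ->
  exists2 M : R, 0 <= M & forall z i j N, nsq z <= r ^+ 2 ->
    nsq (disc_ext Phi z i j - \sum_(0 <= k < N) fourier Phi k%:Z i j * z ^+ k) <= M * r ^+ N.
Proof.
move=> r0 r1; have [M M0 hM] := fourier_nsq_bound.
exists (2 * (M / (1 - r)) ^+ 2); first by rewrite pmulr_rge0 ?sqr_ge0.
move=> z i j N zr; rewrite mxE.
apply: (le_trans (limn_powser r0 r1 M0 (hM i j) zr N)).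
rewrite exprMn mulrA; apply: ler_wpM2l; first by rewrite pmulr_rge0 ?sqr_ge0.
rewrite expr2 ler_piMl ?exprn_ge0 //.
by rewrite exprn_ile1 // ltW.
Qed.

Lemma disc_ext0 : disc_ext Phi 0 = mxint Phi.
Proof.
have z0 : nsq (0 : R[i]) <= 0 ^+ 2 by rewrite nsq0 expr0n.
apply/matrixP => i j; have [M M0 h] := disc_ext_tail (lexx 0) ltr01.
have := h _ i j 1%N z0; rewrite big_nat1 expr0 mulr1 expr1 mulr0 -fourier0 => hh.
by apply/eqP; rewrite -subr_eq0 -nsq_eq0 eq_le nsq_ge0 hh.
Qed.

Lemma taylor_section0 (r : R) N : (0 < N)%N -> meval (taylor_section r N) 0 = mxint Phi.
Proof.
move=> N0; apply/matrixP => i j; rewrite mevalE mxE -fourier0 /dilated horner_poly.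
case: N N0 => // N _; rewrite big_ord_recl big1 ?addr0 /=.
  by rewrite !expr0 mul1r mulr1.
by move=> k _; rewrite [0 ^+ _]expr0n mulr0.
Qed.

(** At a radius r < 1 the Taylor series converges uniformly on the circle. This is where the
    holomorphic function [disc_ext Phi] is tied to trigonometric polynomials. *)
Lemma taylor_section_uconv (r : R) i j : 0 <= r -> r < 1 ->
  uconv (fun N t => meval (taylor_section r N) (expi 1 t) i j)
        (fun t => disc_ext Phi (r%:C * expi 1 t) i j).
Proof.
move=> r0 r1.
have zr t : nsq (r%:C * expi 1 t) <= r ^+ 2 by rewrite nsqM nsq_expi nsq_real mulr1.
have [D D0 hD] := disc_ext_tail r0 r1; have tail N t := hD _ i j N (zr t).
split.
  by exists D => // t; have := tail 0%N t; rewrite big_nil subr0 expr0 mulr1.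
move=> e e0; have [N0 hN0] := exprn_small D r0 r1 e0.
exists N0 => N hN t; rewrite mevalE mxE dilatedE -nsqN opprB.
apply: (le_trans (tail N t)); apply: le_trans (ltW hN0).
by rewrite ler_wpM2l // ler_wiXn2l // ltW.
Qed.

(** Both factors have only nonnegative frequencies, so the constant term of the product is the
    product of the constant terms. *)
Lemma mxint_mul_meval P :
  mxint (fun t => Phi t *m meval P (expi 1 t)) = mxint Phi *m meval P 0.
Proof.
have entry i j k : cint (fun t => Phi t i j * (P j k).[expi 1 t]) =
    cint (fun t => Phi t i j) * (P j k).[0].
  have LP := hardy2_mL2 i j.
  elim/poly_ind: (P j k) => [|p c IH].
    rewrite horner0 mulr0 -[RHS](cint_cst (0 : R[i])).
    by apply: cint_eq => t _; rewrite horner0 mulr0.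
  (* A multiple of X pairs [Phi] with e_(l+1), l >= 0, and so picks out coefficients of [Phi] at
     negative frequencies. *)
  have pos (m : {poly R[i]}) : cint (fun t => Phi t i j * (m * 'X).[expi 1 t]) = 0.
    rewrite (@cint_eq _ _ (fun t => \sum_(l < size m) m`_l * (expi (- (- (l.+1%:Z))) t * Phi t i j))).
      rewrite cint_sum => [|l]; last first.
        by apply: cintegrableZ; apply: fcoef_cintegrable.
      rewrite big1 // => l _; rewrite cintZ; last exact: fcoef_cintegrable.
      by rewrite -/(fcoef _ _) hardy2_fcoef ?mulr0 // oppr_lt0.
    move=> t _; rewrite hornerM hornerX horner_coef mulr_suml mulr_sumr.
    by apply: eq_bigr => l _; rewrite opprK expiX exprS; ring.
  rewrite hornerMXaddC mulr0 add0r.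
  rewrite (@cint_eq _ _ (fun t => Phi t i j * (p * 'X).[expi 1 t] + c * Phi t i j)); last first.
    by move=> t _; rewrite hornerMXaddC hornerM hornerX mulrDr [c * _]mulrC.
  rewrite cintD; last 2 first.
  - by apply: cL2M_cintegrable => //; exact: cL2_poly.
  - by apply: cintegrableZ; exact: cL2_cintegrable.
  by rewrite pos add0r (cintZ c (cL2_cintegrable LP)) mulrC.
apply/matrixP => i k; rewrite mxE [RHS]mxE.
rewrite (@cint_eq _ _ (fun t => \sum_j Phi t i j * (P j k).[expi 1 t])).
  rewrite cint_sum; last first.
    by move=> j; apply: cL2M_cintegrable; [exact: hardy2_mL2|exact: cL2_poly].
  by apply: eq_bigr => j _; rewrite mxE mevalE; exact: entry.
by move=> t _; rewrite mxE; apply: eq_bigr => j _; rewrite mevalE.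
Qed.

End HardyMatrix.

(** * Cyclicity of outer functions *)

Section OuterModulus.
Variable R : realType.
Local Notation Re := complex.Re.
Local Notation Im := complex.Im.

Lemma Re_div (x y : R[i]) : Re (x / y) = (Re x * Re y + Im x * Im y) / nsq y.
Proof.
have -> : y^-1 = ((nsq y)^-1)%:C * Num.conj y.
  have [->|y0] := eqVneq y 0; first by rewrite invr0 rmorph0 mulr0.
  apply: (mulfI y0); rewrite mulrCA mulcJ_nsq mulfV // -rmorphM /= mulVf //.
  by rewrite nsq_eq0.
by rewrite mulrCA Re_realM ReM ReJ ImJ mulrC; congr (_ / _); ring.
Qed.

(** The Herglotz kernel in the definition of a scalar outer function has the Poisson kernel as its
    real part. *)
Lemma Re_herglotz (r s t : R) :
  Re ((expi 1 s + r%:C * expi 1 t) / (expi 1 s - r%:C * expi 1 t)) = pkernel r (s - t).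
Proof.
rewrite Re_div /pkernel /nsq !(ReD, ImD, ReN, ImN, ReM, ImM) /expi /= !mul1r !mul0r cosB.
have hs := cos2Dsin2 s; have ht := cos2Dsin2 t.
congr (_ / _).
- transitivity ((cos s ^+ 2 + sin s ^+ 2) - r ^+ 2 * (cos t ^+ 2 + sin t ^+ 2)); first by ring.
  by rewrite hs ht mulr1.
- transitivity ((cos s ^+ 2 + sin s ^+ 2) - 2 * r * (cos s * cos t + sin s * sin t) +
     r ^+ 2 * (cos t ^+ 2 + sin t ^+ 2)); first by ring.
  by rewrite hs ht mulr1.
Qed.

Lemma nsq_cexp (z : R[i]) : nsq (cexp z) = expR (2 * Re z).
Proof.
rewrite /cexp nsqM nsq_real /nsq /= cos2Dsin2 mulr1.
by rewrite -expRM_natl.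
Qed.

(** The modulus of an exponential depends on the real part of the exponent alone, and the constant
    [c] is unimodular. So outerness is used only as: log |f| is the Poisson integral of an
    integrable function. *)
Lemma outer_modulus (f : R[i] -> R[i]) : scalar_outer f ->
  exists2 u : R -> R, tintegrable u & forall r t : R, 0 <= r -> r < 1 ->
    nsq (f (r%:C * expi 1 t)) = expR (2 * pois r u t).
Proof.
move=> [c [psi [c1 psi0 lpsi hf]]]; exists (fun s => ln (psi s)) => // r t r0 r1.
have nc : nsq c = 1.
  by have := Re_normc_sqr c; rewrite c1 expr1n => <-.
rewrite hf; last first.
  rewrite normc_nsq nsqM nsq_expi nsq_real mulr1 sqrtr_sqr ger0_norm //.
  by rewrite -(rmorph1 (real_complex R)) ltcR.
rewrite nsqM nc mul1r nsq_cexp; congr (expR (2 * _)).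
apply: tint_eq => s _; rewrite [X in Re X]mulrC Re_realM Re_herglotz.
by rewrite mulrC.
Qed.

Lemma pois0 (u : R -> R) (t : R) : pois 0 u t = tint u.
Proof.
apply: tint_eq => s _.
by rewrite /pkernel expr0n /= mulr0 mul0r !subr0 addr0 divr1 mul1r.
Qed.

End OuterModulus.

(** * Elementary inequalities for logarithms and exponentials *)

Section RealEstimates.
Variable R : realType.

Lemma ln_le_sub1 (x : R) : 0 < x -> ln x <= x - 1.
Proof.
move=> x0; have := expR_ge1Dx (ln x); rewrite lnK ?posrE //; lra.
Qed.

Lemma ln_lip (a b c : R) : 0 < c -> c <= a -> c <= b ->
  (2^-1 * ln a - 2^-1 * ln b) ^+ 2 <= (c ^- 2) * (a - b) ^+ 2.
Proof.
move=> c0; wlog ab : a b / b <= a.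
  move=> h ca cb; have [ab|ba] := leP b a; first exact: h.
  by rewrite -sqrrN opprB -[X in _ <= _ * X]sqrrN opprB h // ltW.
move=> ca cb; have b0 : 0 < b by exact: lt_le_trans cb.
have a0 : 0 < a by exact: lt_le_trans ca.
have h0 : 0 <= ln a - ln b by rewrite subr_ge0 ler_ln ?posrE.
have h1 : ln a - ln b <= (a - b) / c.
  rewrite -ln_div ?posrE //; apply: (le_trans (ln_le_sub1 _)); first exact: divr_gt0.
  have -> : a / b - 1 = (a - b) / b by field; rewrite gt_eqF.
  by rewrite ler_wpM2l ?subr_ge0 // lef_pV2 ?posrE.
rewrite -exprVn -exprMn [c^-1 * _]mulrC -mulrBr.
by move: (ln a - ln b) ((a - b) / c) h0 h1 => y w h0 h1; nra.
Qed.

Lemma exp_small (a c e : R) : 0 <= a -> 0 < c -> 0 < e ->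
  exists m0 : nat, forall m, (m0 <= m)%N -> a * expR (- (c * m%:R)) <= e.
Proof.
move=> a0 c0 e0; exists (Num.truncn (a / (c * e))).+1 => m hm.
have h : a / (c * e) <= m%:R.
  by apply/ltW/(lt_le_trans (truncnS_gt _)); rewrite ler_nat.
rewrite expRN ler_pdivrMr ?expR_gt0 //; rewrite ler_pdivrMr ?mulr_gt0 // in h.
have := expR_ge1Dx (c * m%:R); have := ler_wpM2l (ltW e0) (expR_ge1Dx (c * m%:R)).
nra.
Qed.

(** (1 + z/M)^M stands in for e^z because it is a polynomial in z. Its base has squared modulus 1 +
    2 Re z / M + |z|^2 / M^2, and 1 + y <= e^y gives the bound. *)
Lemma power_exp_le (z : R[i]) (M : nat) : (0 < M)%N ->
  nsq ((1 + (M%:R^-1)%:C * z) ^+ M) <= expR (2 * complex.Re z + nsq z / M%:R).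
Proof.
move=> M0; have M0' : (0 : R) < M%:R by rewrite ltr0n.
rewrite nsqX -[2 * _ + _](mulfVK (x := M%:R)) ?gt_eqF // expRM_natr.
rewrite lerXn2r ?nnegrE ?nsq_ge0 ?expR_ge0 //.
apply: le_trans (expR_ge1Dx _); rewrite le_eqVlt; apply/orP; left; apply/eqP.
rewrite /nsq !(ReD, ImD, ReM, ImM) /=; field; rewrite gt_eqF //.
Qed.

(** The matching lower bound, needed only at a real point: ln (1 + y) >= y - 2 y^2 for |y| <= 1/2,
    multiplied by M. *)
Lemma exp_le_power (x : R) (M : nat) : (0 < M)%N -> `|x| / M%:R <= 2^-1 ->
  expR (x - 2 * x ^+ 2 / M%:R) <= (1 + x / M%:R) ^+ M.
Proof.
move=> M0 xM; have M0' : (0 : R) < M%:R by rewrite ltr0n.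
set y := x / M%:R.
have y2 : `|y| <= 2^-1 by rewrite /y normrM normfV [`|M%:R|]ger0_norm // ltW.
have -> : x - 2 * x ^+ 2 / M%:R = (y - 2 * y ^+ 2) * M%:R.
  by rewrite /y; field; rewrite gt_eqF.
move: y2; rewrite ler_norml => /andP[y2 y2'].
rewrite expRM_natr lerXn2r ?nnegrE ?expR_ge0 //; first by lra.
have y1 : 0 < 1 + y by lra.
rewrite -[leRHS]lnK ?posrE // ler_expR.
have h : - ln (1 + y) <= (1 + y)^-1 - 1.
  by rewrite -lnV ?posrE //; apply: ln_le_sub1; rewrite invr_gt0.
have : (1 + y)^-1 - 1 <= - (y - 2 * y ^+ 2); last by lra.
rewrite lerBlDr -div1r ler_pdivrMr //; have := sqr_ge0 y; nra.
Qed.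

End RealEstimates.

(** * Pointwise bound for the regularized determinant *)

Section EntropyBound.
Variables (R : realType) (q : nat).
Hypothesis q_gt0 : (0 < q)%N.

(** The constant of [fro_adj_le], plus 2: one unit for the 1 next to [b] in [entropy_bound], one for
    the slack [kap K] allowed on [d]. *)
Definition adjC : R := 2 + q%:R * q%:R * (q`!%:R) ^+ 2.
(** This is l^4 / [adjC] with l = e^{-2K}. The fourth power leaves l^2 after a square root, one l
    for each of the two factors into which the bound is split. *)
Definition kap (K : R) : R := expR (- (2 * K)) ^+ 4 / adjC.

Lemma adjC_ge2 : 2 <= adjC.
Proof. by rewrite lerDl !mulr_ge0 // sqr_ge0. Qed.

Lemma kap_gt0 K : 0 < kap K.
Proof. by rewrite divr_gt0 ?exprn_gt0 ?expR_gt0 // (lt_le_trans _ adjC_ge2). Qed.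

(* With [l = e^{-2K}] and [Y = (1 + a)^q], the left-hand side is at most
   [(e^w + l^2 Y)^2 <= (e^w (1 + l Y) (1 + l e^{-w}))^2]. *)
Lemma entropy_bound (K w a b d : R) : 0 <= a ->
  b <= q%:R * q%:R * (q`!%:R) ^+ 2 * (1 + a) ^+ q -> d <= expR (2 * w) + kap K ->
  d + kap K * (1 + b) <= expR (2 * (w + q%:R * expR (- (2 / q%:R * K)) * (1 + a) +
    expR (- K) + Num.max 0 (- w - K))).
Proof.
move=> a0 hb hd; have C2 := adjC_ge2; have k0 := kap_gt0 K.
have qR : (0 : R) < q%:R by rewrite ltr0n.
set Y := (1 + a) ^+ q in hb; have Y1 : 1 <= Y by rewrite exprn_ege1 // lerDl.
set l := expR (- (2 * K)); have l0 : 0 < l by exact: expR_gt0.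
have h1 : d + kap K * (1 + b) <= expR w ^+ 2 + l ^+ 4 * Y.
  have -> : l ^+ 4 * Y = kap K * (adjC * Y) by rewrite /kap -/l mulrA divfK // gt_eqF //; lra.
  have h : 2 + b <= adjC * Y by rewrite /adjC mulrDl; lra.
  have := ler_wpM2l (ltW k0) h; rewrite -expRM_natl; lra.
have h2 : expR w ^+ 2 + l ^+ 4 * Y <= (expR w + l ^+ 2 * Y) ^+ 2.
  have e0 := expR_gt0 w; have : 0 <= (l ^+ 2) ^+ 2 * (Y * (Y - 1)).
    by rewrite !mulr_ge0 ?sqr_ge0 ?subr_ge0 //; lra.
  have : 0 <= expR w * (l ^+ 2 * Y) by rewrite !mulr_ge0 ?sqr_ge0 ?(ltW e0) //; lra.
  have -> : l ^+ 4 = (l ^+ 2) ^+ 2 by rewrite -exprM.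
  move: (l ^+ 2) (expR w) => m e; nra.
apply: (le_trans h1); apply: (le_trans h2); rewrite -[2 * (w + _ + _ + _)]/(2%:R * _) expRM_natl.
have lY : 0 <= l ^+ 2 * Y by rewrite mulr_ge0 ?sqr_ge0 //; lra.
rewrite lerXn2r ?nnegrE ?expR_ge0 //; first by rewrite addr_ge0 ?expR_ge0.
(* Since l = nu^q, the power (1 + a)^q is absorbed factor by factor and the exponent is only linear
   in [a], with a small coefficient; an L^2 bound suffices to integrate it. *)
have h3 : 1 + l * Y <= expR (q%:R * expR (- (2 / q%:R * K)) * (1 + a)).
  set nu := expR (- _); have nu0 : 0 < nu by exact: expR_gt0.
  have lE : l = nu ^+ q.
    by rewrite /l /nu -expRM_natl; congr expR; field; rewrite gt_eqF.
  rewrite lE /Y -exprMn -mulrA expRM_natl.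
  set x := nu * (1 + a); have x0 : 0 <= x by rewrite mulr_ge0 ?(ltW nu0) //; lra.
  apply: (@le_trans _ _ ((1 + x) ^+ q)); last first.
    by rewrite lerXn2r ?nnegrE ?addr_ge0 ?expR_ge0 // expR_ge1Dx.
  case: (q) q_gt0 => // k _; elim: k => [|k IH]; first by rewrite !expr1.
  rewrite exprS [in leRHS]exprS; have := exprn_ge0 k.+1 x0.
  have := ler_wpM2l (addr_ge0 ler01 x0) IH.
  move: (x ^+ k.+1) ((1 + x) ^+ k.+1) => y z; nra.
(* There is no lower bound on w. Splitting l as e^{-K} e^{-K} charges only the excess of -w over K,
   up to the factor 1 + e^{-K}. *)
have h4 : 1 + l * expR (- w) <= expR (expR (- K) + Num.max 0 (- w - K)).
  have -> : l * expR (- w) = expR (- K) * expR (- w - K).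
    by rewrite /l -!expRD; congr expR; ring.
  rewrite expRD; set e := expR (- K); have e0 : 0 < e by exact: expR_gt0.
  set m := Num.max 0 _; have m1 : 1 <= expR m by rewrite -expR0 ler_expR le_max lexx.
  have m2 : expR (- w - K) <= expR m by rewrite ler_expR le_max lexx orbT.
  apply: (@le_trans _ _ ((1 + e) * expR m)).
    by rewrite mulrDl mul1r lerD // ler_wpM2l // ltW.
  by rewrite ler_wpM2r ?expR_ge0 // expR_ge1Dx.
have -> : w + q%:R * expR (- (2 / q%:R * K)) * (1 + a) + expR (- K) + Num.max 0 (- w - K) =
   w + (q%:R * expR (- (2 / q%:R * K)) * (1 + a) + (expR (- K) + Num.max 0 (- w - K))) by ring.
rewrite expRD [expR (_ * (1 + a) + _)]expRD.
have le0 : 0 <= l * expR (- w) by rewrite mulr_ge0 ?expR_ge0 // ltW.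
have lY0 : 0 <= l * Y by rewrite mulr_ge0 ?(ltW l0) //; lra.
apply: (@le_trans _ _ (expR w * ((1 + l * Y) * (1 + l * expR (- w))))); last first.
  rewrite ler_wpM2l ?expR_ge0 // ler_pM // addr_ge0 //.
have ww : expR w * expR (- w) = 1 by rewrite -expRD subrr expR0.
have -> : expR w * ((1 + l * Y) * (1 + l * expR (- w))) =
   expR w + expR w * (l * Y) + (expR w * expR (- w)) * (l + l ^+ 2 * Y) by ring.
rewrite ww mul1r; have := mulr_ge0 (expR_ge0 w) lY0; lra.
Qed.

End EntropyBound.

(** * Polynomial near-inverses of an outer function *)

Section KeyEstimate.
Variables (R : realType) (q : nat) (Phi : R -> 'M[R[i]]_q).
Hypothesis q_gt0 : (0 < q)%N.
Hypothesis hPhi : outer2 Phi.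
Local Notation Re := complex.Re.

Let hardyPhi : hardy2 Phi := hPhi.1.

Lemma excess_integrable (u : R -> R) (K : R) : tintegrable u ->
  tintegrable (fun s => Num.max 0 (- u s - K)).
Proof.
move=> ui; apply: (tintegrable_le _ _ (tintegrableD (tintegrable_norm ui) (tintegrable_cst `|K|))).
    apply: measurable_maxr; first exact: measurable_cst.
    apply: measurable_funB; last exact: measurable_cst.
    by apply: measurable_funN; exact: tmeasurable.
  move=> s _; have h1 := ler_norm (- u s); have h2 := ler_norm (- K); rewrite !normrN in h1 h2.
  have h3 := normr_ge0 (u s); have h4 := normr_ge0 K.
  case: (leP 0 (- u s - K)) => h; last by rewrite normr0; lra.
  by rewrite (ger0_norm h); lra.
Qed.

(** Jensen's inequality for the convex function max(0, -x - K), the Poisson kernel being a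
    probability density. It transfers the excess from the Poisson integral to its density, whose
    excess is small in mean. *)
Lemma pois_neg_excess (u : R -> R) (r K t : R) : 0 <= r -> r < 1 -> tintegrable u ->
  Num.max 0 (- pois r u t - K) <= pois r (fun s => Num.max 0 (- u s - K)) t.
Proof.
move=> r0 r1 ui.
have vi := excess_integrable K ui.
rewrite ge_max; apply/andP; split.
  by apply: tint_ge0 => s _; rewrite mulr_ge0 ?pkernel_ge0 // le_max lexx.
have ci := tintegrable_cst K; have Nui := tintegrableN ui.
have -> : - pois r u t - K = pois r (fun s => - u s - K) t.
  rewrite (poisB t r0 r1 Nui ci) pois_cst //; congr (_ - _).
  rewrite /pois -tintN; last exact: pois_integrable.
  by apply: tint_eq => s _; rewrite mulrN.
apply: le_pois => // [|s _]; first exact: tintegrableB.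
by rewrite le_max lexx orbT.
Qed.

Lemma excess_small (u : R -> R) (e : R) : tintegrable u -> 0 < e ->
  exists m0 : nat, forall m, (m0 <= m)%N ->
   tint (fun s => Num.max 0 (- u s - m%:R)) <= e.
Proof.
move=> ui e0.
have h : tint (fun s => Num.max 0 (- u s - m%:R)) @[m --> \oo] --> tint (fun=> 0 : R).
  apply: (tint_dominated (g := fun s => `|u s|)).
  - move=> m; apply: measurable_maxr; first exact: measurable_cst.
    apply: measurable_funB; last exact: measurable_cst.
    by apply: measurable_funN; exact: tmeasurable.
  - exact: measurable_cst.
  - move=> s _; apply: cvg_near_cst; exists (Num.truncn `|u s|).+1 => // m /= hm.
    have : `|u s| <= m%:R by apply/ltW/(lt_le_trans (truncnS_gt _)); rewrite ler_nat.
    have := ler_norm (- u s); rewrite normrN => h1 h2.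
    by apply: max_l; lra.
  - exact: tintegrable_norm.
  - move=> m s _; have := ler_norm (- u s); rewrite normrN => h1.
    have m0 : (0 : R) <= m%:R by [].
    case: (leP 0 (- u s - m%:R)) => h; last by rewrite normr0.
    by rewrite (ger0_norm h); lra.
rewrite tint_cst in h; have [m0 _ hm0] := cvgr_lt _ h _ e0.
by exists m0 => m hm; apply/ltW; exact: hm0.
Qed.

Lemma polynomial_near_inverse (eta : R) : 0 < eta ->
  exists (P : 'M[{poly R[i]}]_q) (c : R[i]),
    [/\ mxint Phi *m meval P 0 = c%:M, expR (- (12 * eta)) <= nsq c &
        n2 (fun t => Phi t *m meval P (expi 1 t)) <=
          (1 + eta) * (q%:R * expR (3 * eta)) + eta].
Proof.
move=> eta0; have [u ui hu] := outer_modulus hPhi.2.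
have LPhi := hardy2_mL2 hardyPhi.
have qR : (0 : R) < q%:R by rewrite ltr0n.
(* This bounds [n2 T] for every T used below, before any other choice: [K] and hence [k] depend on
   it, whereas [r] and [N] come last. *)
pose M := 2 * n2 Phi + 2; have M0 : 0 <= M.
  by have := n2_ge0 Phi; rewrite /M; lra.
have [m1 hm1] := excess_small ui eta0.
have [m2 hm2] := exp_small ler01 ltr01 eta0.
have qM : 0 <= q%:R * (1 + M) by apply: mulr_ge0; [exact: ltW|lra].
have [m3 hm3] := exp_small qM (divr_gt0 (ltr0Sn R 1) qR) eta0.
pose m := maxn m1 (maxn m2 m3); pose K : R := m%:R.
have {hm1}K1 : tint (fun s => Num.max 0 (- u s - K)) <= eta.
  by apply: hm1; rewrite leq_maxl.
have {hm2}K2 : expR (- K) <= eta.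
  by have := hm2 m; rewrite mul1r mul1r; apply; rewrite /m maxnCA leq_maxl.
have {hm3}K3 : q%:R * (1 + M) * expR (- (2 / q%:R * K)) <= eta.
  by apply: hm3; rewrite /m maxnA leq_maxr.
clearbody K; clear m m1 m2 m3.
have k0 := kap_gt0 q K; set k := kap q K in k0.
(* The factor that multiplies [n2 (Phi - T)] in the last estimate: 1 + 1/eta from [n2D_le], and q
   times the bound e^{3 eta} / k on [fro P]. *)
pose D := (1 + eta^-1) * (q%:R * (expR (3 * eta) / k)).
have D0 : 0 < D.
  by rewrite !mulr_gt0 ?invr_gt0 ?expR_gt0 // addr_gt0 ?invr_gt0.
pose d1 := Num.min 1 (eta / D); have d10 : 0 < d1 by rewrite lt_min ltr01 divr_gt0.
have [K' hK'] := hardy2_approx hardyPhi d10.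
pose r : R := 1 - K'.+1%:R^-1.
have r01 : 0 <= r < 1.
  by rewrite /r subr_ge0 invf_le1 ?ltr0n // ler1n ltrBlDr ltrDl invr_gt0 ltr0n.
have /andP[r0 r1] := r01.
have rK : (1 - r) * K'%:R <= 1.
  by rewrite /r subKr mulrC ler_pdivrMr ?ltr0n // mul1r ler_nat.
(* Uniform convergence of the determinants at radius r: |det T|^2 exceeds the squared modulus of the
   outer function by at most k, the slack that [entropy_bound] allows. *)
have [N1 hN1] := uconv_nsq_le (uconv_det (fun i j => taylor_section_uconv hardyPhi i j r0 r1)) k0.
pose N := maxn K' (maxn N1 1).
have NK : (K' <= N)%N by rewrite leq_maxl.
have NN1 : (N1 <= N)%N by rewrite /N maxnCA leq_maxl.
have N0 : (0 < N)%N by rewrite /N maxnA leq_maxr.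
pose TP := taylor_section Phi r N; pose T t := meval TP (expi 1 t).
have hT : n2 (fun t => Phi t - T t) <= d1.
  by apply: hK' => //; rewrite r0 ltW.
have LT : mL2 T by apply: mL2_bounded; exact: mbounded_meval.
have n2T : n2 T <= M.
  have -> : n2 T = n2 (fun t => Phi t + - (Phi t - T t)).
    by apply: tint_eq => t _; rewrite opprB addrC subrK.
  have LD : mL2 (fun t => - (Phi t - T t)).
    apply: (@mL2_eq _ _ (fun t => T t - Phi t)); first by move=> t; rewrite opprB.
    exact: mL2B.
  apply: (le_trans (n2D_le2 LPhi LD)); rewrite lerD2l.
  have -> : n2 (fun t => - (Phi t - T t)) = n2 (fun t => Phi t - T t).
    by apply: tint_eq => t _; rewrite froN.
  have : d1 <= 1 by rewrite ge_min lexx.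
  lra.
pose w t := pois r u t.
have hdet t : nsq (\det (T t)) <= expR (2 * w t) + k.
  by rewrite -hu //; exact: hN1.
pose tau t : R := nsq (\det (T t)) + k * (1 + fro (\adj (T t))).
have tau_k t : k <= tau t.
  have := fro_ge0 (\adj (T t)); have := nsq_ge0 (\det (T t)).
  by rewrite /tau mulrDr mulr1 => h1 h2; have := mulr_ge0 (ltW k0) h2; lra.
have tau0 t : 0 < tau t by exact: lt_le_trans k0 (tau_k t).
pose B t := w t + q%:R * expR (- (2 / q%:R * K)) * (1 + fro (T t)) + expR (- K) + Num.max 0 (- w t - K).
have htau t : 2^-1 * ln (tau t) <= B t.
  have : tau t <= expR (2 * B t).
    by apply: entropy_bound => //; [exact: fro_ge0|exact: fro_adj_le].
  rewrite -[X in _ -> 2^-1 * X <= _]/(ln (tau t)) => h.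
  have : ln (tau t) <= 2 * B t by rewrite -[leRHS]expRK ler_ln ?posrE ?expR_gt0.
  lra.
pose v t := - (2^-1 * ln (tau t)).
have taulip : chordlipr tau.
  pose rc := real_complex R.
  have -> : chordlipr tau = chordlip (fun t => rc (nsq (\det TP).[expi 1 t]) +
      rc k * (rc 1 + \sum_i \sum_j rc (nsq (\adj TP i j).[expi 1 t]))).
    congr chordlip; apply/funext => t.
    rewrite /tau /T meval_det -meval_adj (rmorphD rc (nsq _)) (rmorphM rc k) (rmorphD rc 1).
    congr (_ + _ * (_ + _)); rewrite /fro rmorph_sum; apply: eq_bigr => i _.
    by rewrite rmorph_sum; apply: eq_bigr => j _; rewrite mevalE.
  apply: chordlipD; first exact: (chordlip_nsq (chordlip_poly (\det TP))).
  apply: chordlipM; first exact: chordlip_cst.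
  apply: chordlipD; first exact: chordlip_cst.
  apply: chordlip_sum => i; apply: chordlip_sum => j.
  exact: (chordlip_nsq (chordlip_poly (\adj TP i j))).
have mtau : measurable_fun torus tau.
  apply: measurable_funD.
    have -> : (fun t => nsq (\det (T t))) = (fun t => nsq (\det TP).[expi 1 t]).
      by apply/funext => t; rewrite /T meval_det.
    by apply: measurable_nsq; exact: cmeasurable_poly.
  apply: measurable_funM; first exact: measurable_cst.
  apply: measurable_funD; first exact: measurable_cst.
  have -> : (fun t => fro (\adj (T t))) = (fun t => fro (meval (\adj TP) (expi 1 t))).
    by apply/funext => t; rewrite /T meval_adj.
  by apply: tmeasurable; apply: mL2_fro; apply: mL2_bounded; exact: mbounded_meval.
have mv : measurable_fun torus v.
  apply: measurable_funN; apply: measurable_funM; first exact: measurable_cst.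
  by apply: measurableT_comp => //; exact: measurable_ln.
have vlip : chordlipr v.
  apply: (@chordlipr_comp _ (fun y => - (2^-1 * ln y)) (k ^- 2) tau) => //.
    by rewrite invr_ge0 sqr_ge0.
  by move=> s t; rewrite -opprD sqrrN; exact: ln_lip.
have [g [g0 hg]] := chordlipr_approx vlip mv eta0.
have vi : tintegrable v.
  have [C C0 gC] := nsq_poly_bounded g.
  apply: (tintegrable_bounded mv (c := eta + (1 + C))) => t _.
  rewrite -[v t](subrK (Re g.[expi 1 t])) (le_trans (ler_normD _ _)) // lerD //.
  have := le_trans (Re_nsq _) (gC t); rewrite -(real_normK (num_real _)).
  by move: `|_| (normr_ge0 (Re g.[expi 1 t])) => x; nra.
(* One eta each for the mean excess, for [expR (- K)] and for the term in 1 + [fro (T t)], and two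
   for replacing Poisson integrals by polynomials, whose means are values at 0. *)
have tv : - tint u - 5 * eta <= tint v.
  have [p1 [p10 hp1]] := pois_approx r0 r1 ui eta0.
  have [p2 [p20 hp2]] := pois_approx r0 r1 (excess_integrable K ui) eta0.
  set nu := expR (- (2 / q%:R * K)) in B htau K3.
  pose b := 2 * eta + q%:R * nu + expR (- K).
  have tRe (p : {poly R[i]}) : tintegrable (fun t => Re p.[expi 1 t]) by exact: (cL2_cintegrable (cL2_poly p)).1.
  have tReE (p : {poly R[i]}) : tint (fun t => Re p.[expi 1 t]) = Re p.[0].
    by rewrite -cint_poly.
  have i2 := tintegrableD (tRe p2) (tintegrable_cst b).
  have i1 := tintegrableD (tintegrableZ (q%:R * nu) (mL2_fro LT)) i2.
  have : tint (fun t => - v t) <=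
     tint (fun t => Re p1.[expi 1 t] + (q%:R * nu * fro (T t) + (Re p2.[expi 1 t] + b))).
    apply: le_tint; [exact: tintegrableN|exact: tintegrableD (tRe p1) i1|].
    move=> t _; rewrite opprK; apply: (le_trans (htau t)); rewrite /B /b.
    have := hp1 t; have := hp2 t; have := pois_neg_excess K t r0 r1 ui; rewrite -/(w t).
    by rewrite !ler_norml => h1 /andP[h2 h3] /andP[h4 h5]; lra.
  rewrite (tintD (tRe p1) i1) (tintD (tintegrableZ (q%:R * nu) (mL2_fro LT)) i2).
  rewrite (tintD (tRe p2) (tintegrable_cst b)) (tintZ _ (mL2_fro LT)) !tReE p10 p20 tint_cst /=.
  rewrite -/(n2 T) tintN // => h.
  have : q%:R * nu * n2 T <= q%:R * nu * M by rewrite ler_wpM2l // mulr_ge0 ?expR_ge0 // ltW.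
  have : q%:R * (1 + M) * nu = q%:R * nu + q%:R * nu * M by ring.
  rewrite /b in h; lra.
have [G G0 gG] := nsq_poly_bounded g.
(* [Mn] is the exponent in the polynomial substitute for e^g. It is large against the bound of |g|^2
   for the upper estimate on the circle, and against x = g(0) for the lower one at 0. *)
pose x := tint v; pose Mn := (Num.truncn (G / eta + 2 * `|x| + 2 * x ^+ 2 / eta)).+1.
have Mn0 : (0 : R) < Mn%:R by rewrite ltr0n.
have [hM1 hM2 hM3] : [/\ G / Mn%:R <= eta, `|x| / Mn%:R <= 2^-1 & 2 * x ^+ 2 / Mn%:R <= eta].
  have := truncnS_gt (G / eta + 2 * `|x| + 2 * x ^+ 2 / eta); rewrite -/Mn => hMn.
  have y1 : 0 <= G / eta by rewrite divr_ge0 // ltW.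
  have y2 : 0 <= 2 * x ^+ 2 / eta by rewrite divr_ge0 ?(ltW eta0) // pmulr_rge0 ?sqr_ge0.
  have y3 := normr_ge0 x.
  split; rewrite ler_pdivrMr //.
  - by rewrite [leRHS]mulrC -ler_pdivrMr //; lra.
  - by lra.
  - by rewrite [leRHS]mulrC -ler_pdivrMr //; lra.
pose h : {poly R[i]} := (1 + (Mn%:R^-1)%:C *: g) ^+ Mn.
have hE z : h.[z] = (1 + (Mn%:R^-1)%:C * g.[z]) ^+ Mn.
  by rewrite /h horner_exp hornerD hornerZ hornerC.
(* The exponent is at most 2 (v + eta) + eta, and 2 v = - ln tau. This one bound controls both h det
   T, hence T P, and h adj T, hence P. *)
have hh t : nsq h.[expi 1 t] * tau t <= expR (3 * eta).
  rewrite -ler_pdivlMr // hE; apply: (le_trans (power_exp_le _ _)); first by [].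
  have -> : expR (3 * eta) / tau t = expR (3 * eta - ln (tau t)).
    by rewrite expRB lnK // posrE.
  rewrite ler_expR; have := hg t; rewrite ler_norml /v => /andP[h1 _].
  have : nsq g.[expi 1 t] / Mn%:R <= eta.
    by apply: le_trans hM1; rewrite ler_wpM2r // invr_ge0 ltW.
  lra.
pose P := h *: \adj TP; exists P, (h.[0] * \det (mxint Phi)).
have PE t : meval P (expi 1 t) = h.[expi 1 t] *: \adj (T t) by rewrite /P mevalZ meval_adj.
split.
- rewrite /P mevalZ meval_adj taylor_section0 // -scalemxAr mul_mx_adj.
  by rewrite scale_scalar_mx.
- rewrite nsqM -(disc_ext0 hardyPhi).
  have -> : (0 : R[i]) = 0%:C * expi 1 0 by rewrite rmorph0 mul0r.
  rewrite hu // pois0 mul0r.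
  have -> : nsq h.[0] = ((1 + x / Mn%:R) ^+ Mn) ^+ 2.
    rewrite hE g0 -rmorphM -(rmorph1 (real_complex R)) -rmorphD -rmorphXn nsq_real.
    by rewrite mulrC.
  (* With x >= - int u - 5 eta, the total exponent 2 (x - eta) + 2 int u is at least - 12 eta. *)
  have e1 : expR (x - eta) <= (1 + x / Mn%:R) ^+ Mn.
    by apply: le_trans (exp_le_power _ hM2); rewrite // ler_expR lerD2l lerN2.
  apply: (@le_trans _ _ (expR (x - eta) ^+ 2 * expR (2 * tint u))).
    have tv' : - tint u - 5 * eta <= x := tv.
    rewrite -(expRM_natl 2 (x - eta)) -expRD ler_expR.
    clear -tv' eta0; lra.
  rewrite ler_wpM2r ?expR_ge0 // lerXn2r ?nnegrE ?expR_ge0 //.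
  exact: le_trans (expR_ge0 _) e1.
- have bP := mbounded_meval P.
  have LD : mL2 (fun t => Phi t - T t) by exact: mL2B.
  have L2 := mL2M_boundedr LD bP.
  have L1 : mL2 (fun t => T t *m meval P (expi 1 t)) by exact: mL2M_boundedr.
  have -> : n2 (fun t => Phi t *m meval P (expi 1 t)) =
     n2 (fun t => T t *m meval P (expi 1 t) + (Phi t - T t) *m meval P (expi 1 t)).
    by apply: tint_eq => t _; rewrite -mulmxDl addrC subrK.
  apply: (le_trans (n2D_le L1 L2 eta0)); apply: lerD.
    rewrite ler_wpM2l ?addr_ge0 ?(ltW eta0) // -[leRHS]tint_cst.
    apply: n2_le => // [|t _]; first exact: tintegrable_cst.
    rewrite PE -scalemxAr mul_mx_adj -scalemx1 !froZ fro1 mulrA mulrC ler_wpM2l ?(ltW qR) //.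
    apply: le_trans (hh t); rewrite ler_wpM2l ?nsq_ge0 // lerDl.
    by rewrite mulr_ge0 ?addr_ge0 ?fro_ge0 // ltW.
  have Pb t : fro (meval P (expi 1 t)) <= expR (3 * eta) / k.
    rewrite PE froZ ler_pdivlMr //; apply: le_trans (hh t).
    rewrite -mulrA ler_wpM2l ?nsq_ge0 // /tau mulrC mulrDr mulr1 addrA lerDr.
    by rewrite addr_ge0 ?nsq_ge0 // ltW.
  have Pb0 : 0 <= expR (3 * eta) / k by rewrite divr_ge0 ?expR_ge0 // ltW.
  have i0 : 0 <= 1 + eta^-1 by rewrite addr_ge0 // invr_ge0 ltW.
  apply: (le_trans (ler_wpM2l i0 (n2M_boundedr LD bP Pb0 Pb))).
  rewrite [(1 + eta^-1) * (_ * n2 _)]mulrA -/D; apply: (@le_trans _ _ (D * (eta / D))).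
    by apply: ler_wpM2l; [exact: ltW|apply: (le_trans hT); rewrite ge_min lexx orbT].
  by rewrite mulrC divfK // gt_eqF.
Qed.

Lemma outer_cyclic (e : R) : 0 < e ->
  exists P : 'M[{poly R[i]}]_q, mxint Phi *m meval P 0 = 1%:M /\
    n2 (fun t => Phi t *m meval P (expi 1 t) - 1%:M) <= e.
Proof.
move=> e0; have q1 : (1 : R) <= q%:R by rewrite ler1n.
(* The bound 1/24 lets e^y <= 1 + 2 y be used at y = 12 eta. The 42 comes from (1 + 24 eta) (1 + 9
   eta) = 1 + 33 eta + 216 eta^2, where 216 eta <= 9. *)
pose eta := Num.min 24^-1 (e / (42 * q%:R)).
have eta0 : 0 < eta by rewrite lt_min invr_gt0 ltr0n divr_gt0 // mulr_gt0 // (lt_le_trans _ q1).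
have eta1 : eta <= 24^-1 by rewrite ge_min lexx.
have eta2 : 42 * q%:R * eta <= e.
  rewrite mulrC -ler_pdivlMr ?ge_min ?lexx ?orbT // mulr_gt0 //; exact: lt_le_trans q1.
have expR_le (y : R) : 0 <= y -> y <= 2^-1 -> expR y <= 1 + 2 * y.
  move=> y0 y1; have := expR_ge1Dx (- y); rewrite expRN => h.
  have E0 := expR_gt0 y; move: h; rewrite -[X in _ <= X]div1r ler_pdivlMr // => h.
  have : (1 - y) * (1 + 2 * y) >= 1 by nra.
  have y2 : 0 < 1 - y by lra.
  by move=> h2; rewrite -(ler_pM2l y2) (le_trans h h2).
have [P [c [Pc cge hP]]] := polynomial_near_inverse eta0.
have c0 : 0 < nsq c by apply: lt_le_trans cge; exact: expR_gt0.
have c0' : c != 0 by rewrite -nsq_eq0 gt_eqF.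
(* Dividing by c makes the mean exactly I, so the squared distance to I is the excess of the squared
   norm over q. *)
exists (c^-1%:P *: P).
have P0 : mxint Phi *m meval (c^-1%:P *: P) 0 = 1%:M.
  by rewrite mevalZ hornerC -scalemxAr Pc scale_scalar_mx mulVf.
split=> //; have LP : mL2 (fun t => Phi t *m meval (c^-1%:P *: P) (expi 1 t)).
  by apply: mL2M_boundedr; [exact: hardy2_mL2 hardyPhi|exact: mbounded_meval].
have := n2_variance LP; rewrite mxint_mul_meval // P0 fro1 => ->.
have -> : n2 (fun t => Phi t *m meval (c^-1%:P *: P) (expi 1 t)) =
    (nsq c)^-1 * n2 (fun t => Phi t *m meval P (expi 1 t)).
  rewrite -nsqV /n2 -tintZ; last first.
    by apply: mL2_fro; apply: mL2M_boundedr; [exact: hardy2_mL2 hardyPhi|exact: mbounded_meval].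
  by apply: tint_eq => t _; rewrite mevalZ hornerC -scalemxAr froZ.
have ic : (nsq c)^-1 <= 1 + 24 * eta.
  have : (nsq c)^-1 <= expR (12 * eta).
    by rewrite -[leRHS]invrK lef_pV2 ?posrE ?invr_gt0 ?expR_gt0 // -expRN.
  by move=> h; apply: (le_trans h); have := expR_le (12 * eta); rewrite mulrA; lra.
have e3 : expR (3 * eta) <= 1 + 6 * eta.
  by have := expR_le (3 * eta); lra.
have ic0 : 0 <= (nsq c)^-1 by rewrite invr_ge0 ltW.
have hP' : n2 (fun t => Phi t *m meval P (expi 1 t)) <= q%:R * (1 + 9 * eta).
  apply: (le_trans hP).
  have : (1 + eta) * expR (3 * eta) <= 1 + 8 * eta.
    have h : 0 <= 1 + eta by lra.
    by apply: (le_trans (ler_wpM2l h e3)); nra.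
  have q0 : (0 : R) <= q%:R by lra.
  move=> h; have := ler_wpM2l q0 h; nra.
have := ler_pM ic0 (n2_ge0 _) ic hP'.
set N := _ * n2 _ => h; apply: le_trans eta2; move: h; move: N => N.
have : (1 + 24 * eta) * (1 + 9 * eta) <= 1 + 42 * eta by nra.
move=> h1 h2; have q0 : (0 : R) <= q%:R by lra.
have := ler_wpM2l q0 h1; nra.
Qed.

End KeyEstimate.

(** * Taylor coefficients of the inverse *)

Section TaylorInverse.
Variable R : realType.
Implicit Types (p : {poly R[i]}).

Lemma nsq_horner_bounded p : exists2 C : R, 0 <= C &
  forall x : R, 0 <= x <= 1 -> nsq p.[x%:C] <= C.
Proof.
elim/poly_ind: p => [|p c [C C0 IH]].
  by exists 0 => // x _; rewrite horner0 nsq0.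
exists (2 * C + 2 * nsq c); first by have := nsq_ge0 c; lra.
move=> x /[dup] x01 /IH h; rewrite hornerMXaddC; apply: (le_trans (nsqD_le2 _ _)).
rewrite lerD2r ler_wpM2l // nsqM nsq_real.
case/andP: x01 => x0 x1; apply: le_trans h.
by rewrite ler_piMr ?nsq_ge0 // expr_le1.
Qed.

(** The constant term vanishes by letting x tend to 0; dividing by X lowers the order by one and the
    induction continues. *)
Lemma poly_small_coef0 p (N : nat) (C rho : R) : 0 < rho ->
  (forall x : R, 0 < x -> x < rho -> nsq p.[x%:C] <= C * (x ^+ N.+1) ^+ 2) ->
  forall k, (k <= N)%N -> p`_k = 0.
Proof.
move=> rho0.
have step (f a : {poly R[i]}) (c : R[i]) (n : nat) : f = a * 'X + c%:P ->
    (forall x : R, 0 < x -> x < rho -> nsq f.[x%:C] <= C * (x ^+ n.+1) ^+ 2) -> c = 0.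
  move=> -> hp; apply/eqP; rewrite -nsq_eq0; apply/negPn/negP => c0.
  have {}c0 : 0 < nsq c by rewrite lt_def c0 nsq_ge0.
  have [Q Q0 hQ] := nsq_horner_bounded a.
  pose D := 2 * `|C| + 2 * Q + 1; have D0 : 0 < D by have := normr_ge0 C; rewrite /D; lra.
  (* The last entry is chosen against nsq c <= D x: it would give nsq c <= nsq c / 2. *)
  pose x := Num.min (Num.min (rho / 2) 2^-1) (nsq c / (2 * D)).
  have x0 : 0 < x.
    by rewrite /x !lt_min; apply/andP; split; [apply/andP; split; lra|rewrite divr_gt0 //; lra].
  have x1 : x <= 2^-1 by rewrite !ge_min lexx orbT.
  have x2 : x < rho.
    by apply: (@le_lt_trans _ _ (rho / 2)); [rewrite !ge_min lexx|lra].
  have x3 : x * (2 * D) <= nsq c by rewrite -ler_pdivlMr ?mulr_gt0 // ge_min lexx orbT.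
  have x01 : 0 <= x <= 1 by rewrite ltW //=; lra.
  have xn : (x ^+ n.+1) ^+ 2 <= x.
    have y0 : 0 <= x ^+ n by rewrite exprn_ge0 // ltW.
    have y1 : x ^+ n <= 1 by have /andP[xp x1'] := x01; rewrite exprn_ile1.
    rewrite expr2 exprS -[leRHS]mulr1; apply: ler_pM; rewrite ?mulr_ge0 ?(ltW x0) //.
      by rewrite ler_piMr // ltW.
    by have /andP[xp x1'] := x01; rewrite mulr_ile1.
  have h1 := hp x x0 x2; have h2 := hQ x x01.
  have h3 : nsq c <= D * x.
    have -> : c = (a * 'X + c%:P).[x%:C] - a.[x%:C] * x%:C.
      by rewrite hornerMXaddC addrC addKr.
    apply: (le_trans (nsqD_le2 _ _)); rewrite nsqN nsqM nsq_real.
    have h4 : C * (x ^+ n.+1) ^+ 2 <= `|C| * x.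
      apply: (@le_trans _ _ (`|C| * (x ^+ n.+1) ^+ 2)).
        by rewrite ler_wpM2r ?sqr_ge0 ?ler_norm.
      by rewrite ler_wpM2l.
    have h5 : nsq a.[x%:C] * x ^+ 2 <= Q * x.
      apply: ler_pM; rewrite ?nsq_ge0 ?sqr_ge0 //; nra.
    by rewrite /D; lra.
  lra.
elim: N p => [|N IH] p hp k.
  rewrite leqn0 => /eqP ->; elim/poly_ind: p hp => [|q c _] hp; first by rewrite coef0.
  by rewrite (step _ _ _ _ erefl hp) addr0 coefMX.
elim/poly_ind: p hp => [|q c _] hp; first by rewrite coef0.
have c0 := step _ _ _ _ erefl hp; rewrite c0 addr0 coefMX in hp *.
case: k => // k; rewrite ltnS => kN /=; apply: IH => // x x0 xr.
have := hp x x0 xr; rewrite hornerM hornerX nsqM nsq_real => h.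
rewrite -(ler_pM2r (exprn_gt0 2 x0)); apply: (le_trans h).
by rewrite (exprS x N.+1) exprMn [x ^+ 2 * _]mulrC mulrA.
Qed.

Variables (q : nat) (Phi : R -> 'M[R[i]]_q) (B : nat -> 'M[R[i]]_q).
Hypothesis hPhi : outer2 Phi.
Hypothesis hB : taylor_coefs (fun z => invmx (disc_ext Phi z)) B.

Lemma disc_ext_unit (x : R) : 0 <= x -> x < 1 -> disc_ext Phi x%:C \in unitmx.
Proof.
move=> x0 x1; have [u ui hu] := outer_modulus hPhi.2.
rewrite unitmxE unitfE -nsq_eq0; have := hu x 0 x0 x1.
rewrite /expi mulr0 cos0 sin0 (_ : 1 +i* 0 = 1) // mulr1 => ->.
by rewrite gt_eqF // expR_gt0.
Qed.

(** The relation O(x^N) as x decreases to 0 along the positive reals, with moduli squared. A real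
    segment is enough to identify Taylor coefficients, so no theory of holomorphic functions is
    called upon. *)
Definition bigO_pow (N : nat) (s : R -> R[i]) := exists C rho : R,
  [/\ 0 <= C, 0 < rho, rho <= 1 & forall x : R, 0 < x -> x < rho ->
    nsq (s x) <= C * (x ^+ N) ^+ 2].

Lemma bigO_powD N s s' : bigO_pow N s -> bigO_pow N s' ->
  bigO_pow N (fun x => s x + s' x).
Proof.
move=> [C [rho [C0 rho0 rho1 h]]] [C' [rho' [C'0 rho'0 rho'1 h']]].
exists (2 * C + 2 * C'), (Num.min rho rho'); split.
- by lra.
- by rewrite lt_min rho0.
- by rewrite ge_min rho1.
- move=> x x0; rewrite lt_min => /andP[xr xr'].
  by apply: (le_trans (nsqD_le2 _ _)); have := h x x0 xr; have := h' x x0 xr'; lra.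
Qed.

Lemma bigO_pow_sum (I : Type) (l : seq I) N (s : I -> R -> R[i]) :
  (forall i, bigO_pow N (s i)) -> bigO_pow N (fun x => \sum_(i <- l) s i x).
Proof.
move=> hs; elim: l => [|i l IH].
  by exists 0, 1; split=> // x _ _; rewrite big_nil nsq0 mul0r.
by under eq_fun do rewrite big_cons; exact: bigO_powD.
Qed.

Lemma bigO_pow_mul N (a b : {poly R[i]}) (A' B' : R -> R[i]) :
  bigO_pow N (fun x => A' x - a.[x%:C]) -> bigO_pow N (fun x => B' x - b.[x%:C]) ->
  bigO_pow N (fun x => A' x * B' x - a.[x%:C] * b.[x%:C]).
Proof.
move=> [C [rho [C0 rho0 rho1 h]]] [C' [rho' [C'0 rho'0 rho'1 h']]].
have [Q Q0 hQ] := nsq_horner_bounded a; have [Q' Q'0 hQ'] := nsq_horner_bounded b.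
have c1 : 0 <= C * Q' by exact: mulr_ge0.
have c2 : 0 <= Q * C' by exact: mulr_ge0.
have c3 : 0 <= C * C' by exact: mulr_ge0.
exists (2 * (Q * C') + 4 * (C * Q') + 4 * (C * C')), (Num.min rho rho'); split.
- by lra.
- by rewrite lt_min rho0.
- by rewrite ge_min rho1.
move=> x x0; rewrite lt_min => /andP[xr xr'].
have x01 : 0 <= x <= 1 by rewrite ltW //=; lra.
have xp : 0 <= (x ^+ N) ^+ 2 by exact: sqr_ge0.
have x1 : (x ^+ N) ^+ 2 <= 1.
  by have /andP[? ?] := x01; rewrite -exprM exprn_ile1.
have -> : A' x * B' x - a.[x%:C] * b.[x%:C] = a.[x%:C] * (B' x - b.[x%:C]) +
  ((A' x - a.[x%:C]) * b.[x%:C] + (A' x - a.[x%:C]) * (B' x - b.[x%:C])) by ring.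
apply: (le_trans (nsqD_le2 _ _)).
have := nsqD_le2 ((A' x - a.[x%:C]) * b.[x%:C]) ((A' x - a.[x%:C]) * (B' x - b.[x%:C])).
rewrite !nsqM.
have := h x x0 xr; have := h' x x0 xr'; have := hQ x x01; have := hQ' x x01.
move: (nsq_ge0 (A' x - a.[x%:C])) (nsq_ge0 (B' x - b.[x%:C])) (nsq_ge0 a.[x%:C]) (nsq_ge0 b.[x%:C]).
move: (nsq (A' x - _)) (nsq (B' x - _)) (nsq a.[_]) (nsq b.[_]) ((x ^+ N) ^+ 2) xp x1 => d e f g y y0 y1 d0 e0 f0 g0 gQ fQ eC dC hh.
have p1 := ler_pM f0 e0 fQ eC.
have p2 := ler_pM d0 g0 dC gQ.
have p3 := ler_pM d0 e0 dC eC.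
have p4 : C * y * (C' * y) <= C * C' * y.
  have -> : C * y * (C' * y) = C * C' * y * y by ring.
  by rewrite ler_piMr // mulr_ge0.
lra.
Qed.

Lemma geometric_sq_le (M x y : R) : 0 <= M -> x <= 2^-1 -> 0 <= y ->
  2 * (M / (1 - x) * y) ^+ 2 <= 2 * (M * 2) ^+ 2 * y ^+ 2.
Proof.
move=> M0 x1 y0; have -> : 2 * (M * 2) ^+ 2 * y ^+ 2 = 2 * (M * 2 * y) ^+ 2 by ring.
have i0 : 0 <= (1 - x)^-1 by rewrite invr_ge0; lra.
have i2 : (1 - x)^-1 <= 2 by rewrite -[leRHS]invrK lef_pV2 ?posrE; lra.
rewrite ler_wpM2l // lerXn2r ?nnegrE ?mulr_ge0 //.
by rewrite ler_wpM2r // ler_wpM2l.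
Qed.

Lemma disc_ext_bigO i j N : bigO_pow N (fun x => disc_ext Phi x%:C i j -
  (\poly_(k < N) fourier Phi k%:Z i j).[x%:C]).
Proof.
have [M M0 hM] := fourier_nsq_bound hPhi.1.
exists (2 * (M * 2) ^+ 2), 2^-1; split=> //; first by rewrite pmulr_rge0 ?sqr_ge0.
  by lra.
move=> x x0 x1; rewrite mxE horner_poly -(big_mkord xpredT (fun k => fourier Phi k%:Z i j * x%:C ^+ k)).
have zr : nsq x%:C <= x ^+ 2 by rewrite nsq_real.
apply: (le_trans (limn_powser (ltW x0) (lt_trans x1 _) M0 (hM i j) zr N)); first by lra.
by apply: geometric_sq_le; rewrite ?exprn_ge0 ?(ltW x0) //; exact: ltW.
Qed.

(** Nothing is assumed on the growth of [B]. Convergence at one point x0 > 0 bounds the terms B_k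
    x0^k, and at x the series is then dominated by a geometric one in x / x0. *)
Lemma taylor_coefs_bigO i j N : bigO_pow N (fun x => invmx (disc_ext Phi x%:C) i j -
  (\poly_(k < N) B k i j).[x%:C]).
Proof.
have [r r0 hr] := hB.
pose x0 := Num.min 1 r / 2.
have x00 : 0 < x0 by rewrite divr_gt0 // lt_min ltr01.
have x0r : x0 < r by rewrite /x0; have : Num.min 1 r <= r by [rewrite ge_min lexx orbT]; lra.
have x01 : x0 <= 1 by rewrite /x0; have : Num.min 1 r <= 1 by [rewrite ge_min lexx]; lra.
have nlt (x : R) : 0 < x -> x < r -> `|x%:C| < r%:C.
  by move=> xp xr; rewrite normc_nsq nsq_real sqrtr_sqr ger0_norm ?(ltW xp) // ltcR.
pose c k := B k i j * x0%:C ^+ k.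
(* A term is the difference of two consecutive partial sums, eventually both within 1 of the limit,
   whence the 4; [S] covers the first terms. *)
have [M M0 hM] : exists2 M : R, 0 <= M & forall k, nsq (c k) <= M ^+ 2.
  have /cvgc_nsq /(_ _ ltr01) [N0 hN0] := hr x0%:C (nlt _ x00 x0r) i j.
  pose S := \sum_(0 <= k < N0) nsq (c k).
  have S0 : 0 <= S by apply: sumr_ge0 => k _; exact: nsq_ge0.
  exists (4 + S); first by lra.
  move=> k; apply: (@le_trans _ _ (4 + S)); last by nra.
  have [kN|Nk] := ltnP k N0.
    have : nsq (c k) <= S.
      rewrite /S big_mkord (bigD1 (Ordinal kN)) //= lerDl.
      by apply: sumr_ge0 => l _; exact: nsq_ge0.
    by lra.
  have h1 := hN0 k Nk; have h2 := hN0 k.+1 (leqW Nk).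
  move: h1 h2; set l := invmx _ i j; set u := series _ => h1 h2.
  have -> : c k = (l - u k) - (l - u k.+1).
    by rewrite /u /series /= big_nat_recr //= -/(c k); ring.
  apply: (le_trans (nsqD_le2 _ _)); rewrite nsqN; rewrite expr1n in h1 h2; lra.
exists (2 * (M * 2) ^+ 2 * (x0^-1 ^+ N) ^+ 2), (x0 / 2); split.
- by rewrite mulr_ge0 ?sqr_ge0 // pmulr_rge0 ?sqr_ge0.
- by rewrite divr_gt0.
- by lra.
move=> x xp xx0.
have y0 : 0 <= x / x0 by rewrite divr_ge0 // ltW.
have y12 : x / x0 <= 2^-1 by rewrite ler_pdivrMr //; lra.
have y1 : x / x0 < 1 by apply: (le_lt_trans y12); lra.
have zr : nsq (x / x0)%:C <= (x / x0) ^+ 2 by rewrite nsq_real.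
have [l [cl tl]] := power_series_tail y0 y1 M0 hM zr.
have cE k : c k * (x / x0)%:C ^+ k = B k i j * x%:C ^+ k.
  by rewrite /c -mulrA -exprMn -rmorphM [x0 * _]mulrC divfK // gt_eqF.
have lE : invmx (disc_ext Phi x%:C) i j = l.
  have xr : x < r by lra.
  have := hr x%:C (nlt _ xp xr) i j; move: cl.
  have -> : (fun k => c k * (x / x0)%:C ^+ k : R[i]^o) = (fun k => B k i j * x%:C ^+ k : R[i]^o).
    by apply/funext => k; exact: cE.
  by move=> h1 h2; rewrite -(cvg_lim _ h1) // -(cvg_lim _ h2).
rewrite lE horner_poly -(big_mkord xpredT (fun k => B k i j * x%:C ^+ k)).
under eq_bigr do rewrite -cE.
apply: (le_trans (tl N)); apply: (le_trans (geometric_sq_le M0 y12 (exprn_ge0 _ y0))).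
rewrite [(x / x0) ^+ N]exprMn le_eqVlt; apply/orP; left; apply/eqP.
by move: (x ^+ N) (x0^-1 ^+ N) => y z; ring.
Qed.

(** The product of the truncations of [Phi^-1] and [Phi] at order k differs from I by O(x^(k+1)), so
    its coefficients up to k are those of I: the Cauchy product formula. *)
Lemma taylor_inverse k :
  \sum_(0 <= j < k.+1) B j *m fourier Phi (k - j)%N%:Z = (k == 0%N)%:R%:M.
Proof.
apply/matrixP => i j.
pose a l : {poly R[i]} := \poly_(m < k.+1) B m i l.
pose b l : {poly R[i]} := \poly_(m < k.+1) fourier Phi m%:Z l j.
pose f := \sum_l a l * b l - (i == j)%:R%:P.
have [C [rho [C0 rho0 rho1 h]]] : bigO_pow k.+1 (fun x => \sum_l
    (invmx (disc_ext Phi x%:C) i l * disc_ext Phi x%:C l j - (a l).[x%:C] * (b l).[x%:C])).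
  apply: bigO_pow_sum => l; apply: bigO_pow_mul.
  - exact: taylor_coefs_bigO.
  - exact: disc_ext_bigO.
have : f`_k = 0.
  apply: (poly_small_coef0 rho0 (C := C) (N := k)) => // x x0 xr.
  apply: le_trans (h x x0 xr); rewrite -nsqN le_eqVlt; apply/orP; left; apply/eqP.
  congr nsq; rewrite /f hornerD hornerN hornerC horner_sum opprB sumrB.
  have x1 : x < 1 by lra.
  have := mulVmx (disc_ext_unit (ltW x0) x1) => /matrixP /(_ i j); rewrite !mxE => ->.
  by congr (_ - _); apply: eq_bigr => l _; rewrite hornerM.
rewrite /f coefD coefN coefC coef_sum => /subr0_eq E.
transitivity (\sum_l (a l * b l)`_k); last first.
  by rewrite E !mxE; case: (k == 0%N); rewrite ?mul0rn.
rewrite summxE; under eq_bigr do rewrite mxE.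
rewrite exchange_big; apply: eq_bigr => l _ /=; rewrite coefM big_mkord.
apply: eq_bigr => m _; rewrite !coef_poly ltn_ord.
by rewrite ltnS leq_subr.
Qed.

End TaylorInverse.

(** * The weighted space *)

Section MatrixIntegrals.
Variables (R : realType) (q : nat).
Implicit Types (F G : R -> 'M[R[i]]_q) (A : 'M[R[i]]_q).

Lemma mxintB F G : mxintegrable F -> mxintegrable G ->
  mxint (fun t => F t - G t) = mxint F - mxint G.
Proof.
move=> Fi Gi; apply/matrixP => i j; rewrite !mxE -cintB //.
by apply: cint_eq => t _; rewrite !mxE.
Qed.

Lemma mxint_mull A F : mxintegrable F -> mxint (fun t => A *m F t) = A *m mxint F.
Proof.
move=> Fi; apply/matrixP => i j; rewrite !mxE.
rewrite (@cint_eq _ _ (fun t => \sum_k A i k * F t k j)); last by move=> t _; rewrite mxE.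
rewrite cint_sum; last by move=> k; apply: cintegrableZ; exact: Fi.
by apply: eq_bigr => k _; rewrite mxE cintZ.
Qed.

Lemma mxint_mulr A F : mxintegrable F -> mxint (fun t => F t *m A) = mxint F *m A.
Proof.
move=> Fi; apply/matrixP => i j; rewrite !mxE.
rewrite (@cint_eq _ _ (fun t => \sum_k A k j * F t i k)); last first.
  by move=> t _; rewrite mxE; apply: eq_bigr => k _; rewrite mulrC.
rewrite cint_sum; last by move=> k; apply: cintegrableZ; exact: Fi.
by apply: eq_bigr => k _; rewrite mxE cintZ // mulrC.
Qed.

Lemma mxint_sum (I : Type) (s : seq I) (F : I -> R -> 'M[R[i]]_q) :
  (forall k, mxintegrable (F k)) ->
  mxint (fun t => \sum_(k <- s) F k t) = \sum_(k <- s) mxint (F k).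
Proof.
move=> Fi; apply/matrixP => i j; rewrite mxE summxE.
rewrite (@cint_eq _ _ (fun t => \sum_(k <- s) F k t i j)); last by move=> t _; rewrite summxE.
rewrite cint_sum; last by move=> k; exact: Fi.
by apply: eq_bigr => k _; rewrite mxE.
Qed.

Lemma mL2_integrable F : mL2 F -> mxintegrable F.
Proof. by move=> LF i j; exact: cL2_cintegrable. Qed.

Lemma mL2M_integrable F G : mL2 F -> mL2 G -> mxintegrable (fun t => F t *m G t).
Proof.
move=> LF LG i j; apply: (cintegrable_eq (F := fun t => \sum_k F t i k * G t k j)).
  by move=> t _; rewrite mxE.
by apply: cintegrable_sum => k; exact: cL2M_cintegrable.
Qed.

Lemma mxmeasurable_cst A : mxmeasurable (fun=> A).
Proof. by move=> i j; exact: cmeasurable_cst. Qed.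

Lemma mxmeasurableB F G : mxmeasurable F -> mxmeasurable G ->
  mxmeasurable (fun t => F t - G t).
Proof.
move=> mF mG i j; apply: cmeasurable_eq (cmeasurableB (mF i j) (mG i j)) => t.
by rewrite !mxE.
Qed.

Lemma mxmeasurableM F G : mxmeasurable F -> mxmeasurable G ->
  mxmeasurable (fun t => F t *m G t).
Proof.
move=> mF mG i j; apply: (@cmeasurable_eq _ (fun t => \sum_k F t i k * G t k j)).
  by move=> t; rewrite mxE.
by apply: cmeasurable_sum => k; exact: cmeasurableM.
Qed.

Lemma mxmeasurable_adjoint F : mxmeasurable F -> mxmeasurable (fun t => F t ^t*).
Proof.
move=> mF i j; apply: cmeasurable_eq (cmeasurableJ (mF j i)) => t.
by rewrite !mxE.
Qed.

Lemma cmeasurable_det (n : nat) (F : R -> 'M[R[i]]_n) :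
  (forall i j, cmeasurable (fun t => F t i j)) -> cmeasurable (fun t => \det (F t)).
Proof.
move=> mF; apply: cmeasurable_sum => s; apply: cmeasurableM.
  exact: cmeasurable_cst.
by apply: cmeasurable_prod.
Qed.

Lemma measurable_if (b : R -> bool) (f g : R -> R) : measurable_fun torus b ->
  measurable_fun torus f -> measurable_fun torus g ->
  measurable_fun torus (fun t => if b t then f t else g t).
Proof.
move=> mb mf mg; apply: measurable_fun_if => //; first exact: measurable_torus.
- by apply: (@measurable_funS _ _ _ _ torus) => //; exact: measurable_torus.
- by apply: (@measurable_funS _ _ _ _ torus) => //; exact: measurable_torus.
Qed.

Lemma cmeasurable_if (b : R -> bool) (F G : R -> R[i]) :
  measurable_fun torus b -> cmeasurable F -> cmeasurable G ->
  cmeasurable (fun t => if b t then F t else G t).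
Proof.
by move=> mb [F1 F2] [G1 G2]; split; under eq_fun do rewrite fun_if; exact: measurable_if.
Qed.

Lemma mxmeasurable_invmx F : mxmeasurable F -> mxmeasurable (fun t => invmx (F t)).
Proof.
move=> mF i j.
(* [invmx] returns a singular matrix unchanged, so that case needs its own branch. *)
apply: (@cmeasurable_eq _ (fun t => if nsq (\det (F t)) == 0 then F t i j
    else (\det (F t))^-1 * \adj (F t) i j)).
  move=> t; rewrite /invmx unitmxE unitfE nsq_eq0; case: eqP => //= _.
  by rewrite [RHS]mxE.
apply: cmeasurable_if.
- apply: measurable_fun_eqr; last exact: measurable_cst.
  by apply: measurable_nsq; apply: cmeasurable_det.
- exact: mF.
- apply: cmeasurableM; first by apply: cmeasurableV; exact: cmeasurable_det.
  apply: (@cmeasurable_eq _ (fun t => (-1) ^+ (j + i) * \det (row' j (col' i (F t))))).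
    by move=> t; rewrite [RHS]mxE.
  apply: cmeasurableM; first exact: cmeasurable_cst.
  apply: cmeasurable_det => k l.
  by apply: cmeasurable_eq (mF (lift j k) (lift i l)) => t; rewrite !mxE.
Qed.

Lemma taeeq_mxint F G : mxmeasurable F -> mxmeasurable G -> taeeq F G ->
  mxint F = mxint G.
Proof.
move=> mF mG FG; apply/matrixP => i j; rewrite !mxE; apply: taeeq_cint => //.
by apply: filterS FG => t FG Dt; rewrite FG.
Qed.

Lemma mxint_gram F : mL2 F -> complex.Re (\tr (mxint (fun t => F t *m F t ^t*))) = n2 F.
Proof.
move=> LF; rewrite /mxtrace Re_sum n2E //; apply: eq_bigr => i _; rewrite mxE.
rewrite (@cint_eq _ _ (fun t => \sum_j F t i j * Num.conj (F t i j))); last first.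
  by move=> t _; rewrite mxE; apply: eq_bigr => j _; rewrite !mxE.
have LJ j : cL2 (fun t => Num.conj (F t i j)) by exact: cL2J.
rewrite cint_sum; last by move=> j; exact: cL2M_cintegrable.
rewrite Re_sum; apply: eq_bigr => j _; rewrite /cint /=; apply: tint_eq => t _.
by rewrite mulcJ_nsq.
Qed.

Lemma n2_eq0 F : mL2 F -> n2 F = 0 -> taeeq F (fun=> 0).
Proof.
move=> LF F0; have h := tint_eq0 (mL2_fro LF) (fun t _ => fro_ge0 (F t)) F0.
by apply: filterS h => t h Dt; apply: fro_eq0; exact: h.
Qed.

End MatrixIntegrals.

(** * Trigonometric polynomials with prescribed frequencies *)

Section TrigonometricPolynomials.
Variables (R : realType) (q : nat).
Implicit Types (S : set int) (F G : R -> 'M[R[i]]_q) (A : 'M[R[i]]_q).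

Lemma trigpoly0 S : trigpoly S (fun=> 0 : 'M[R[i]]_q).
Proof.
by exists [::], (fun=> 0); split=> //; apply/funext => t; rewrite big_nil.
Qed.

Lemma trigpoly1 S k A : S k -> trigpoly S (fun t => expi k t *: A).
Proof.
move=> Sk; exists [:: k], (fun=> A); split=> //.
  by move=> l; rewrite inE => /eqP ->.
by apply/funext => t; rewrite big_seq1.
Qed.

Lemma trigpolyD S F G : trigpoly S F -> trigpoly S G -> trigpoly S (fun t => F t + G t).
Proof.
move=> [s1 [A1 [u1 S1 ->]]] [s2 [A2 [u2 S2 ->]]].
(* The list of frequencies must be duplicate-free, so both coefficient families are extended by 0 to
   the merged list. *)
exists (undup (s1 ++ s2)),
  (fun k => (if k \in s1 then A1 k else 0) + (if k \in s2 then A2 k else 0)); split.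
- exact: undup_uniq.
- by move=> k; rewrite mem_undup mem_cat => /orP[/S1|/S2].
apply/funext => t.
have aux (s s' : seq int) (A' : int -> 'M[R[i]]_q) : uniq s -> uniq s' -> {subset s <= s'} ->
    \sum_(k <- s) expi k t *: A' k = \sum_(k <- s') expi k t *: (if k \in s then A' k else 0).
  move=> us us' ss'; rewrite [RHS](bigID (mem s)) /= [X in _ = _ + X]big1 ?addr0; last first.
    by move=> k /negbTE ->; rewrite scaler0.
  rewrite -[RHS]big_filter [RHS](perm_big s).
    by apply: eq_big_seq => k ->.
  apply: uniq_perm => //; first exact: filter_uniq.
  move=> k; rewrite mem_filter; apply/andP/idP => [[]|ks] //.
  by split=> //; exact: ss'.
rewrite (aux s1 (undup (s1 ++ s2))) ?undup_uniq //; last first.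
  by move=> k; rewrite mem_undup mem_cat => ->.
rewrite (aux s2 (undup (s1 ++ s2))) ?undup_uniq //; last first.
  by move=> k; rewrite mem_undup mem_cat => ->; rewrite orbT.
by rewrite -big_split; apply: eq_bigr => k _ /=; rewrite scalerDr.
Qed.

Lemma trigpolyM S A F : trigpoly S F -> trigpoly S (fun t => A *m F t).
Proof.
move=> [s [A' [us Ss ->]]]; exists s, (fun k => A *m A' k); split=> //.
apply/funext => t; rewrite mulmx_sumr; apply: eq_bigr => k _.
by rewrite scalemxAr.
Qed.

Lemma trigpolyB S F G : trigpoly S F -> trigpoly S G -> trigpoly S (fun t => F t - G t).
Proof.
move=> tF tG; have := trigpolyD tF (trigpolyM (- 1%:M) tG).
by under eq_fun do rewrite mulNmx mul1mx.
Qed.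

Lemma trigpoly_sum (I : eqType) (s : seq I) S (F : I -> R -> 'M[R[i]]_q) :
  (forall i, i \in s -> trigpoly S (F i)) -> trigpoly S (fun t => \sum_(i <- s) F i t).
Proof.
elim: s => [|i s IH] hF.
  by under eq_fun do rewrite big_nil; exact: trigpoly0.
under eq_fun do rewrite big_cons; apply: trigpolyD; first by apply: hF; rewrite mem_head.
by apply: IH => j js; apply: hF; rewrite inE js orbT.
Qed.

Lemma mbounded_expiZ k F : mbounded F -> mbounded (fun t => expi k t *: F t).
Proof.
move=> [mF [C C0 FC]]; split; last by exists C => // t; rewrite froZ nsq_expi mul1r.
move=> i j; apply: cmeasurable_eq (cmeasurableM (cmeasurable_expi R k) (mF i j)) => t.
by rewrite mxE.
Qed.

Lemma mbounded_expi k A : mbounded (fun t => @expi R k t *: A).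
Proof. by apply: mbounded_expiZ; exact: mbounded_cst. Qed.

Lemma mboundedD F G : mbounded F -> mbounded G -> mbounded (fun t => F t + G t).
Proof.
move=> [mF [C C0 FC]] [mG [D D0 GD]]; split.
  move=> i j; apply: cmeasurable_eq (cmeasurableD (mF i j) (mG i j)) => t.
  by rewrite mxE.
exists (2 * C + 2 * D); first by lra.
move=> t; apply: (le_trans (froD_le2 _ _)).
by have := FC t; have := GD t; lra.
Qed.

Lemma mbounded_sum (I : Type) (s : seq I) (F : I -> R -> 'M[R[i]]_q) :
  (forall i, mbounded (F i)) -> mbounded (fun t => \sum_(i <- s) F i t).
Proof.
move=> bF; elim: s => [|i s IH].
  by under eq_fun do rewrite big_nil; exact: mbounded_cst.
by under eq_fun do rewrite big_cons; exact: mboundedD.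
Qed.

Lemma mbounded_mulmx F G : mbounded F -> mbounded G -> mbounded (fun t => F t *m G t).
Proof.
move=> [mF [C C0 FC]] [mG [D D0 GD]]; split; first exact: mxmeasurableM.
exists (q%:R * C * D); first by rewrite !mulr_ge0.
move=> t; apply: (le_trans (fro_mulmx _ _)).
by rewrite -!mulrA ler_wpM2l // ler_pM ?fro_ge0.
Qed.

Lemma mbounded_trigpoly S F : trigpoly S F -> mbounded F.
Proof. by move=> [s [A [_ _ ->]]]; apply: mbounded_sum => k; exact: mbounded_expi. Qed.

End TrigonometricPolynomials.

Section WeightedSpace.
Variables (R : realType) (q : nat) (W Phi : R -> 'M[R[i]]_q).
Implicit Types (F G X Y : R -> 'M[R[i]]_q) (S : set int).
Hypothesis q_gt0 : (0 < q)%N.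
Hypothesis hW : weight W.
Hypothesis LPhi : mL2 Phi.
Hypothesis WPhi : {ae leb R, forall t, torus t -> W t = Phi t ^t* *m Phi t}.

Lemma posdefmx_unit (A : 'M[R[i]]_q) : posdefmx A -> A \in unitmx.
Proof.
move=> [_ Apos]; rewrite -row_free_unit -kermx_eq0; apply/negPn/negP => /rowV0Pn[v].
move=> /sub_kermxP vA v0; have := Apos v v0; by rewrite vA mul0mx mxE ltxx.
Qed.

Lemma adjoint_mulmx (A C : 'M[R[i]]_q) : (A *m C) ^t* = C ^t* *m A ^t*.
Proof. by rewrite trmx_mul map_mxM. Qed.

Lemma adjointB (A C : 'M[R[i]]_q) : (A - C) ^t* = A ^t* - C ^t*.
Proof. by apply/matrixP => i j; rewrite !mxE rmorphB. Qed.

(** A factor of the positive definite [W t] is invertible. This makes the passage from [F] to its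
    representative injective up to null sets, hence the projection unique. *)
Lemma Phi_unit : {ae leb R, forall t, torus t -> Phi t ^t* \in unitmx}.
Proof.
apply: filterS WPhi => t h Dt; have := posdefmx_unit (hW.2 t Dt).
rewrite (h Dt) unitmx_mul => /andP[u _]; exact: u.
Qed.

(* [F] in L^2(W) is represented by [X = F Phi^*] in the unweighted L^2. *)
Definition rep F X := [/\ mxmeasurable F, mL2 X & taeeq (fun t => F t *m Phi t ^t*) X].

Let mPhi : mxmeasurable Phi. Proof. by move=> i j; exact: (LPhi i j).1. Qed.
Let mW : mxmeasurable W.
Proof. by move=> i j; exact: cintegrable_cmeasurable (hW.1 i j). Qed.

Lemma mxmeasurable_rep F : mxmeasurable F -> mxmeasurable (fun t => F t *m Phi t ^t*).
Proof. by move=> mF; apply: mxmeasurableM => //; exact: mxmeasurable_adjoint. Qed.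

Lemma mL2_measurable X : mL2 X -> mxmeasurable X.
Proof. by move=> LX i j; exact: (LX i j).1. Qed.

Lemma rep_gram F G X Y : rep F X -> rep G Y ->
  taeeq (fun t => F t *m W t *m G t ^t*) (fun t => X t *m Y t ^t*).
Proof.
move=> [_ _ FX] [_ _ GY]; apply: filterS3 FX GY WPhi => t h1 h2 h3 Dt.
by rewrite h3 // -h1 // -h2 // adjoint_mulmx trmxCK !mulmxA.
Qed.

Lemma rep_inner F G X Y : rep F X -> rep G Y ->
  inner W F G = mxint (fun t => X t *m Y t ^t*).
Proof.
move=> rF rG; have [mF LX _] := rF; have [mG LY _] := rG.
apply: taeeq_mxint; last exact: rep_gram.
- by apply: mxmeasurableM; [exact: mxmeasurableM|exact: mxmeasurable_adjoint].
- by apply: mxmeasurableM; [|apply: mxmeasurable_adjoint]; exact: mL2_measurable.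
Qed.

Lemma cmeasurable_ntr X : mxmeasurable X -> cmeasurable (fun t => ntr (X t)).
Proof.
move=> mX; apply: cmeasurableM; first exact: cmeasurable_cst.
by apply: cmeasurable_sum => i; exact: mX.
Qed.

Lemma Re_ntr (A : 'M[R[i]]_q) : complex.Re (ntr A) = q%:R^-1 * complex.Re (\tr A).
Proof.
rewrite /ntr -Re_realM; congr (complex.Re (_ * _)).
by rewrite -(rmorph_nat (real_complex R)) -fmorphV.
Qed.

Lemma ntr_gram (A : 'M[R[i]]_q) : ntr (A *m A ^t*) = (q%:R^-1 * fro A)%:C.
Proof.
rewrite /ntr rmorphM fmorphV rmorph_nat; congr (_ * _).
rewrite /mxtrace /fro rmorph_sum; apply: eq_bigr => i _; rewrite mxE rmorph_sum.
by apply: eq_bigr => j _; rewrite !mxE mulcJ_nsq.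
Qed.

Lemma rep_inL2 F X : rep F X -> inL2 W F.
Proof.
move=> rF; have [mF LX _] := rF; split=> //.
apply: (@taeeq_cintegrable _ (fun t => (q%:R^-1 * fro (X t))%:C)).
- apply: cmeasurable_ntr; apply: mxmeasurableM; first exact: mxmeasurableM.
  exact: mxmeasurable_adjoint.
- by apply: filterS (rep_gram rF rF) => t h Dt; rewrite h // ntr_gram.
- split; last exact: tintegrable_cst.
  exact: tintegrableZ (mL2_fro LX).
Qed.

Lemma inL2_rep F : inL2 W F -> rep F (fun t => F t *m Phi t ^t*).
Proof.
move=> [mF Fi]; split=> //; last by apply: filterE.
have mJ := mxmeasurable_rep mF.
have fi : tintegrable (fun t => fro (F t *m Phi t ^t*)).
  apply: (tintegrable_eq (f := fun t => q%:R * (q%:R^-1 * fro (F t *m Phi t ^t*)))).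
    by move=> t _; rewrite mulVKf // pnatr_eq0 -lt0n.
  apply: tintegrableZ; apply: (taeeq_integrable _ _ Fi.1).
    apply: measurable_funM; first exact: measurable_cst.
    apply: measurable_sum => i; apply: measurable_sum => j; apply: measurable_nsq; exact: mJ.
  apply: filterS WPhi => t h Dt; rewrite h //.
  have -> : F t *m (Phi t ^t* *m Phi t) *m F t ^t* =
     (F t *m Phi t ^t*) *m (F t *m Phi t ^t*) ^t*.
    by rewrite adjoint_mulmx trmxCK !mulmxA.
  by rewrite ntr_gram.
move=> i j; apply: cL2_le (mJ i j) fi _ => t _; exact: nsq_le_fro.
Qed.

Lemma rep_norm F X : rep F X -> L2norm W F ^+ 2 = q%:R^-1 * n2 X.
Proof.
move=> rF; have [mF LX _] := rF.
rewrite /L2norm sqr_sqrtr (rep_inner rF rF) Re_ntr mxint_gram //.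
by rewrite mulr_ge0 ?invr_ge0 ?n2_ge0.
Qed.

Lemma repB F G X Y : rep F X -> rep G Y -> rep (fun t => F t - G t) (fun t => X t - Y t).
Proof.
move=> [mF LX FX] [mG LY GY]; split.
- exact: mxmeasurableB.
- exact: mL2B.
- by apply: filterS2 FX GY => t h1 h2 Dt; rewrite mulmxBl h1 // h2.
Qed.

Lemma repM (A : 'M[R[i]]_q) F X : rep F X -> rep (fun t => A *m F t) (fun t => A *m X t).
Proof.
move=> [mF LX FX]; split.
- by apply: mxmeasurableM => //; exact: mxmeasurable_cst.
- by apply: mL2M_boundedl => //; exact: mbounded_cst.
- by apply: filterS FX => t h Dt; rewrite -mulmxA h.
Qed.

Lemma rep_bounded F : mbounded F -> rep F (fun t => F t *m Phi t ^t*).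
Proof.
move=> bF; split; [exact: bF.1| |exact: filterE].
by apply: mL2M_boundedl => //; exact: mL2_adjoint.
Qed.

Lemma rep_taeeq F G X : mxmeasurable G -> taeeq F G -> rep F X -> rep G X.
Proof.
move=> mG FG [mF LX FX]; split=> //.
by apply: filterS2 FG FX => t h1 h2 Dt; rewrite -h1 // h2.
Qed.

Lemma rep_eq0 F X : rep F X -> n2 X = 0 -> taeeq F (fun=> 0).
Proof.
move=> [mF LX FX] X0; apply: filterS3 FX (n2_eq0 LX X0) Phi_unit => t h1 h2 u Dt.
have := h1 Dt; rewrite h2 // => h.
by rewrite -[F t](mulmxK (u Dt)) h mul0mx.
Qed.

(** The closure read through the isometry. The norm and the strict inequality give way to [n2] and a
    weak one, which later estimates can chain. *)
Lemma MspaceP S F X : rep F X -> Mspace W S F <->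
  forall e : R, 0 < e -> exists2 G, trigpoly S G &
    n2 (fun t => X t - G t *m Phi t ^t*) <= e.
Proof.
move=> rF; have qR : (0 : R) < q%:R by rewrite ltr0n.
split.
- move=> [_ h] e e0; have d0 : 0 < Num.sqrt (q%:R^-1 * e).
    by rewrite sqrtr_gt0 mulr_gt0 // invr_gt0.
  have [G tG] := h _ d0; exists G => //.
  have rG := rep_bounded (mbounded_trigpoly tG).
  have := rep_norm (repB rF rG); set N := L2norm _ _ => NE.
  have N0 : 0 <= N by exact: sqrtr_ge0.
  have : N ^+ 2 <= Num.sqrt (q%:R^-1 * e) ^+ 2.
    by rewrite ler_sqr ?nnegrE ?sqrtr_ge0 // ltW.
  rewrite NE sqr_sqrtr; last by rewrite mulr_ge0 ?invr_ge0 // ltW.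
  by rewrite ler_pM2l // invr_gt0.
- move=> h; split; first exact: rep_inL2 rF.
  move=> e e0; have d0 : 0 < q%:R * (e ^+ 2 / 2) by rewrite mulr_gt0 // divr_gt0 // exprn_gt0.
  have [G tG hG] := h _ d0; exists G => //.
  have rG := rep_bounded (mbounded_trigpoly tG).
  have := rep_norm (repB rF rG); set N := L2norm _ _ => NE.
  have N0 : 0 <= N by exact: sqrtr_ge0.
  rewrite -ltr_sqr ?nnegrE ?(ltW e0) // NE.
  apply: (@le_lt_trans _ _ (e ^+ 2 / 2)).
    by rewrite ler_pdivrMl.
  by rewrite ltr_pdivrMr // ltr_pMr ?exprn_gt0 // ltr1n.
Qed.

Lemma MspaceB S F G : Mspace W S F -> Mspace W S G -> Mspace W S (fun t => F t - G t).
Proof.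
move=> hF hG; have rF := inL2_rep hF.1; have rG := inL2_rep hG.1.
have [_ LX _] := rF; have [_ LY _] := rG.
apply/(MspaceP S (repB rF rG)) => e e0; have e4 : 0 < e / 4 by rewrite divr_gt0.
have [F' tF hF'] := (MspaceP S rF).1 hF _ e4.
have [G' tG hG'] := (MspaceP S rG).1 hG _ e4.
exists (fun t => F' t - G' t); first exact: trigpolyB.
have [_ LF' _] := rep_bounded (mbounded_trigpoly tF).
have [_ LG' _] := rep_bounded (mbounded_trigpoly tG).
pose D t := F t *m Phi t ^t* - F' t *m Phi t ^t*.
pose E t := G' t *m Phi t ^t* - G t *m Phi t ^t*.
have -> : n2 (fun t => F t *m Phi t ^t* - G t *m Phi t ^t* - (F' t - G' t) *m Phi t ^t*) =
    n2 (fun t => D t + E t).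
  apply: tint_eq => t _; rewrite /D /E mulmxBl opprB addrACA [in RHS]addrACA.
  by congr (fro (_ + _)); rewrite addrC.
apply: (le_trans (n2D_le2 (mL2B LX LF') (mL2B LG' LY))).
have -> : n2 E = n2 (fun t => G t *m Phi t ^t* - G' t *m Phi t ^t*).
  by apply: tint_eq => t _; rewrite /E -froN opprB.
move: hF' hG'; rewrite -/D; move: (n2 D) (n2 _) => x y; lra.
Qed.

Lemma MspaceM S (A : 'M[R[i]]_q) F : Mspace W S F -> Mspace W S (fun t => A *m F t).
Proof.
move=> hF; have rF := inL2_rep hF.1; have [_ LX _] := rF.
apply/(MspaceP S (repM A rF)) => e e0.
pose d := e / (q%:R * fro A + 1).
have D0 : 0 < q%:R * fro A + 1 by rewrite ltr_wpDl // mulr_ge0 // fro_ge0.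
have d0 : 0 < d by rewrite divr_gt0.
have [G tG hG] := (MspaceP S rF).1 hF _ d0.
exists (fun t => A *m G t); first exact: trigpolyM.
have [_ LG _] := rep_bounded (mbounded_trigpoly tG).
pose D t := F t *m Phi t ^t* - G t *m Phi t ^t*; have LD : mL2 D by exact: mL2B.
apply: (@le_trans _ _ (q%:R * fro A * n2 D)).
  have := n2M_boundedl LD (mbounded_cst A) (fro_ge0 A) (fun=> lexx _).
  by apply: le_trans; rewrite le_eqVlt; apply/orP; left; apply/eqP; apply: tint_eq => t _;
    rewrite /D mulmxBr !mulmxA.
apply: (@le_trans _ _ (q%:R * fro A * d)).
  by rewrite ler_wpM2l // mulr_ge0 // fro_ge0.
have -> : e = (q%:R * fro A + 1) * d by rewrite /d mulrC divfK // gt_eqF.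
by rewrite ler_wpM2r ?lerDl // ltW.
Qed.

(** For bounded [U] the pairing with [U] is continuous in L^2, so orthogonality passes from single
    exponentials to their span and then to its closure. *)
Lemma ortho_Mspace S (U : R -> 'M[R[i]]_q) H Y : mbounded U ->
  (forall k A, S k -> mxint (fun t => U t *m ((expi k t *: A) *m Phi t ^t*) ^t*) = 0) ->
  rep H Y -> Mspace W S H -> mxint (fun t => U t *m Y t ^t*) = 0.
Proof.
move=> bU oU rH hH; have [_ LY _] := rH; have [_ [C C0 UC]] := bU.
have LU := mL2_bounded bU.
have oG G : trigpoly S G -> mxint (fun t => U t *m (G t *m Phi t ^t*) ^t*) = 0.
  move=> [s [A [us Ss ->]]].
  pose V k t := U t *m ((@expi R k t *: A k) *m Phi t ^t*) ^t*.
  rewrite (@mxint_eq _ _ _ (fun t => \sum_(k <- s) V k t)); last first.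
    move=> t _; rewrite mulmx_suml raddf_sum map_mx_sum mulmx_sumr.
    by apply: eq_bigr.
  rewrite mxint_sum; last first.
    move=> k; apply: mL2M_integrable => //; apply: mL2_adjoint.
    apply: mL2M_boundedl; first exact: mL2_adjoint.
    exact: mbounded_expi.
  by rewrite big_seq big1 // => k ks; apply: oU; exact: Ss.
have DE G : trigpoly S G -> mxint (fun t => U t *m Y t ^t*) =
    mxint (fun t => U t *m (Y t - G t *m Phi t ^t*) ^t*).
  move=> tG; have [_ LG _] := rep_bounded (mbounded_trigpoly tG).
  transitivity (mxint (fun t => U t *m Y t ^t*) -
      mxint (fun t => U t *m (G t *m Phi t ^t*) ^t*)); first by rewrite (oG G tG) subr0.
  rewrite -mxintB; last 2 first.
  - by apply: mL2M_integrable => //; exact: mL2_adjoint.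
  - by apply: mL2M_integrable => //; exact: mL2_adjoint.
  by apply: mxint_eq => t _; rewrite adjointB mulmxBr.
have bound G : trigpoly S G -> fro (mxint (fun t => U t *m Y t ^t*)) <=
    q%:R * C * n2 (fun t => Y t - G t *m Phi t ^t*).
  move=> tG; rewrite (DE G tG); have [_ LG _] := rep_bounded (mbounded_trigpoly tG).
  have LD := mL2B LY LG; rewrite -[X in _ <= _ * X]n2_adjoint.
  have LD' := mL2_adjoint LD.
  apply: (le_trans (fro_mxint_le (mL2M_boundedl LD' bU))).
  exact: n2M_boundedl.
apply: fro_eq0; move: (fro_ge0 (mxint (fun t => U t *m Y t ^t*))) bound.
move: (fro _) => p p0 bound; apply/eqP; rewrite eq_le p0 andbT leNgt; apply/negP => {}p0.
have qC : 0 <= q%:R * C by rewrite mulr_ge0.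
have D0 : 0 < 2 * (q%:R * C + 1) by rewrite mulr_gt0 // ltr_wpDl.
have [G tG hG] := (MspaceP S rH).1 hH _ (divr_gt0 p0 D0).
have := le_trans (bound G tG) (ler_wpM2l qC hG).
rewrite mulrA ler_pdivlMr //; move: (q%:R * C) qC {D0 bound hG} => z z0; nra.
Qed.

End WeightedSpace.

(** * Prediction *)

Section BackwardPartialSums.
Variables (R : realType) (q : nat) (Phi : R -> 'M[R[i]]_q) (B : nat -> 'M[R[i]]_q).
Hypothesis hPhi : outer2 Phi.
Hypothesis hB : taylor_coefs (fun z => invmx (disc_ext Phi z)) B.

Definition psum (k : nat) (t : R) : 'M[R[i]]_q :=
  \sum_(0 <= j < k.+1) expi j%:Z t *: B j.

Definition gram (n : nat) : 'M[R[i]]_q := \sum_(0 <= j < n.+1) B j *m B j ^t*.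

Let LPhi : mL2 Phi. Proof. exact: hardy2_mL2 hPhi.1. Qed.

Lemma mL2_expi m (F : R -> 'M[R[i]]_q) : mL2 F -> mL2 (fun t => expi m t *: F t).
Proof.
move=> LF; apply: (@mL2_eq _ _ (fun t => (expi m t *: 1%:M) *m F t)).
  by move=> t; rewrite -scalemxAl mul1mx.
by apply: mL2M_boundedl => //; exact: mbounded_expi.
Qed.

Lemma mbounded_psum k : mbounded (psum k).
Proof. by apply: mbounded_sum => j; exact: mbounded_expi. Qed.

Lemma B0_unit : B 0%N \in unitmx.
Proof. by have := taylor_inverse hPhi hB 0%N; rewrite big_nat1 => /mulmx1_unit[]. Qed.

(** The coefficient at m is the sum over j <= k of B_j times the coefficient of [Phi] at m - j. For
    0 <= m <= k the truncation is invisible, since j > m contributes nothing, and [taylor_inverse]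
    applies; for m < 0 every term vanishes. *)
Lemma mxint_psum_mul k (m : int) : m <= k%:Z ->
  mxint (fun t => expi (- m) t *: (psum k t *m Phi t)) = (m == 0)%:R%:M.
Proof.
move=> mk.
rewrite (@mxint_eq _ _ _ (fun t =>
    \sum_(0 <= j < k.+1) B j *m (expi (- (m - j%:Z)) t *: Phi t))); last first.
  move=> t _; rewrite /psum mulmx_suml scaler_sumr; apply: eq_bigr => j _.
  by rewrite -scalemxAl scalerA -scalemxAr opprB addrC expiD.
rewrite mxint_sum; last first.
  move=> j; apply: mL2M_integrable; first exact: mL2_cst.
  exact: mL2_expi.
transitivity (\sum_(0 <= j < k.+1) B j *m fourier Phi (m - j%:Z)).
  apply: eq_bigr => j _; rewrite mxint_mull //.
  by apply: mL2_integrable; exact: mL2_expi.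
have [_ _ neg] := hPhi.1.
case: m mk => p mk; last first.
  have -> : (Negz p == 0) = false by [].
  rewrite raddf0 big1 // => j _; by rewrite neg ?mulmx0.
have pk : (p < k.+1)%N by [].
rewrite (big_cat_nat (n := p.+1)) //= [X in _ + X]big_nat [X in _ + X]big1 ?addr0; last first.
  by move=> j /andP[pj _]; rewrite neg ?mulmx0 // subr_lt0 ltz_nat.
rewrite -[RHS](taylor_inverse hPhi hB p); apply: eq_big_nat => j /andP[_ jp].
by rewrite subzn.
Qed.

Lemma adjoint_sum (I : Type) (s : seq I) (F : I -> 'M[R[i]]_q) :
  (\sum_(k <- s) F k) ^t* = \sum_(k <- s) (F k) ^t*.
Proof. by rewrite raddf_sum map_mx_sum. Qed.

Lemma gram_adjoint n : (gram n) ^t* = gram n.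
Proof.
rewrite /gram adjoint_sum; apply: eq_bigr => j _.
by rewrite adjoint_mulmx trmxCK.
Qed.

(** The term j = 0 is already definite, because [B 0] is invertible; the others are nonnegative. *)
Lemma gram_posdef n : posdefmx (gram n).
Proof.
split.
  by apply/is_hermitianmxP; rewrite expr0 scale1r gram_adjoint.
move=> v v0; rewrite mulmx_sumr mulmx_suml summxE.
have E j : (v *m (B j *m B j ^t*) *m v ^t*) 0 0 = (\sum_i nsq ((v *m B j) 0 i))%:C.
  have -> : v *m (B j *m B j ^t*) *m v ^t* = (v *m B j) *m (v *m B j) ^t*.
    by rewrite trmx_mul map_mxM !mulmxA.
  rewrite mxE rmorph_sum; apply: eq_bigr => i _; rewrite !mxE; exact: mulcJ_nsq.
under eq_bigr do rewrite E.
rewrite -rmorph_sum ltcR big_nat_recl // ltr_wpDr //.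
  by apply: sumr_ge0 => j _; apply: sumr_ge0 => i _; exact: nsq_ge0.
have : v *m B 0%N != 0.
  apply: contra v0 => /eqP h; apply/eqP.
  by rewrite -[v](mulmxK B0_unit) h mul0mx.
apply: contraNT; rewrite -leNgt => h; apply/eqP/rowP => i; rewrite [RHS]mxE.
apply/eqP; rewrite -nsq_eq0; apply/eqP/le_anti; rewrite nsq_ge0 andbT.
apply: le_trans h; rewrite (bigD1 i) //= lerDl.
by apply: sumr_ge0 => j _; exact: nsq_ge0.
Qed.

Lemma gram_unit n : gram n \in unitmx.
Proof. exact: posdefmx_unit (gram_posdef n). Qed.

Definition coefmx (P : 'M[{poly R[i]}]_q) (k : nat) : 'M[R[i]]_q :=
  \matrix_(i, j) (P i j)`_k.

(** Every sufficiently long range is allowed, so that it can be made to contain given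
    frequencies. *)
Lemma meval_sum (P : 'M[{poly R[i]}]_q) : exists s0, forall s t, (s0 <= s)%N ->
  meval P (expi 1 t) = \sum_(0 <= a < s) expi a%:Z t *: coefmx P a.
Proof.
exists (\max_i \max_j size (P i j))%N => s t h; apply/matrixP => i j.
rewrite mevalE summxE big_mkord (@horner_coef_wide _ s).
  by apply: eq_bigr => a _; rewrite !mxE expiX mulrC.
apply: leq_trans h; apply: leq_trans (leq_bigmax (F := fun i => \max_j size (P i j))%N i).
exact: (leq_bigmax (F := fun j => size (P i j)) j).
Qed.

Section Approximation.
Variables (P : 'M[{poly R[i]}]_q).
Let X t := Phi t *m meval P (expi 1 t) - 1%:M.

Lemma mL2_residual : mL2 X.
Proof.
apply: mL2B; last exact: mL2_cst.
apply: mL2M_boundedr => //; exact: mbounded_meval.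
Qed.

(** By [mxint_psum_mul] the coefficient at k of [psum k] Phi P is that of P, and the one of [psum k]
    is B_k. So the Taylor coefficients of P approach those of [Phi^-1] as soon as Phi P approaches I
    in L^2. *)
Lemma coefmxB k : coefmx P k - B k =
  mxint (fun t => (expi (- k%:Z) t *: psum k t) *m X t).
Proof.
have [s0 hs0] := meval_sum P; pose s := (s0 + k.+1)%N.
have sk : (k < s)%N by rewrite /s leq_addl.
pose V a t := expi (- (k%:Z - a%:Z)) t *: (psum k t *m Phi t).
have LV a : mL2 (V a).
  apply: mL2_expi; apply: mL2M_boundedl => //; exact: mbounded_psum.
have bV := mbounded_expiZ (- k%:Z) (mbounded_psum k).
rewrite (@mxint_eq _ _ _ (fun t => \sum_(0 <= a < s) V a t *m coefmx P a -
    \sum_(0 <= j < k.+1) expi (j%:Z - k%:Z) t *: B j)); last first.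
  move=> t _; rewrite /X mulmxBr mulmx1; congr (_ - _).
    rewrite (hs0 s) ?leq_addr // !mulmx_sumr; apply: eq_bigr => a _.
    by rewrite /V -!scalemxAl -!scalemxAr scalerA opprB [a%:Z - _]addrC expiD mulmxA.
  rewrite /psum scaler_sumr; apply: eq_bigr => j _.
  by rewrite scalerA [j%:Z - _]addrC expiD.
rewrite mxintB; last 2 first.
- apply: mL2_integrable; apply: mL2_sum => a.
  by apply: mL2M_boundedr => //; exact: mbounded_cst.
- apply: mL2_integrable; apply: mL2_sum => j.
  by apply: mL2_bounded; exact: mbounded_expi.
rewrite !mxint_sum; last 2 first.
- by move=> j; apply: mL2_integrable; apply: mL2_bounded; exact: mbounded_expi.
- by move=> a; apply: mL2_integrable; apply: mL2M_boundedr => //; exact: mbounded_cst.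
congr (_ - _).
  rewrite (bigD1_seq k) ?mem_index_iota ?iota_uniq //=.
  rewrite [X in _ + X]big1 ?addr0 => [|a ak].
    rewrite mxint_mulr; last exact: mL2_integrable.
    by rewrite mxint_psum_mul subrr // eqxx mul1mx.
  rewrite mxint_mulr; last exact: mL2_integrable.
  rewrite mxint_psum_mul; last by rewrite gerBl.
  by rewrite subr_eq0 eqz_nat eq_sym (negbTE ak) raddf0 mul0mx.
have term j : mxint (fun t => @expi R (j%:Z - k%:Z) t *: B j) = (j == k)%:R *: B j.
  apply/matrixP => a b; rewrite !mxE.
  rewrite (@cint_eq _ _ (fun t => B j a b * expi (j%:Z - k%:Z) t)); last first.
    by move=> t _; rewrite mxE mulrC.
  rewrite cintZ; last by apply: cL2_cintegrable; exact: cL2_expi.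
  by rewrite cint_expi subr_eq0 eqz_nat mulrC.
rewrite (bigD1_seq k) ?mem_index_iota ?iota_uniq ?ltnSn //= term eqxx scale1r.
by rewrite big1 ?addr0 // => j jk; rewrite term (negbTE jk) scale0r.
Qed.

End Approximation.

End BackwardPartialSums.

(** * Spectral calculus and AM-GM for positive definite matrices *)

Section PositiveMatrices.
Variables (R : realType) (q : nat).
Implicit Types A C M : 'M[R[i]]_q.

(** Each eigenvalue is the value of the quadratic form at a row of the unitary diagonalizing matrix,
    hence real and positive. *)
Lemma posdefmx_spectral A : posdefmx A -> exists (P : 'M[R[i]]_q) (l : 'I_q -> R),
  [/\ P \is unitarymx, forall i, 0 < l i & A = P ^t* *m diag_mx (\row_i (l i)%:C) *m P].
Proof.
move=> [hA Apos]; have /orthomx_spectralP := hermitian_normalmx hA.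
set P := spectralmx A; set d := spectral_diag A => AE.
have uP : P \is unitarymx := spectral_unitarymx A.
have d0 i : 0 < d 0 i.
  have v0 : row i P != 0.
    apply/negP => /eqP h; have := spectral_unit A; rewrite -/P -row_free_unit => /row_free_inj rf.
    have := congr1 (fun x : 'rV[R[i]]_q => x *m P ^t*) h.
    rewrite -row_mul mul0mx (unitarymxP uP) => /rowP /(_ i); rewrite !mxE eqxx => /eqP.
    by rewrite oner_eq0.
  have := Apos _ v0; rewrite AE invmx_unitary //.
  have -> : row i P *m (P ^t* *m diag_mx d *m P) *m (row i P) ^t* = (d 0 i)%:M.
    rewrite !mulmxA -row_mul (unitarymxP uP) -row_mul mul1mx -row_mul.
    have -> : (row i P) ^t* = P ^t* *m (delta_mx i 0).
      by rewrite -colE; apply/matrixP => a b; rewrite !mxE.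
    rewrite mulmxA -row_mul -mulmxA (unitarymxP uP) mulmx1.
    by apply/matrixP => a b; rewrite !ord1 -colE !mxE eqxx.
  by rewrite mxE eqxx.
exists P, (fun i => complex.Re (d 0 i)); split=> //.
  by move=> i; have := d0 i; rewrite ltcE => /andP[].
rewrite {1}AE invmx_unitary //; congr (_ *m diag_mx _ *m _).
apply/rowP => i; rewrite mxE; have := d0 i; case: (d 0 i) => a b; rewrite ltcE /=.
by move=> /andP[/eqP -> _].
Qed.

Lemma det_unitary_conj (P D : 'M[R[i]]_q) : P \is unitarymx ->
  \det (P ^t* *m D *m P) = \det D.
Proof.
move=> uP; rewrite !det_mulmx mulrAC mulrC -det_mulmx.
by rewrite -(invmx_unitary uP) mulVmx ?unitarymx_unit // det1 mulr1.
Qed.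

Lemma posdefmx_AGM A : (0 < q)%N -> posdefmx A ->
  [/\ \det A = (complex.Re (\det A))%:C, 0 < complex.Re (\det A) &
      complex.Re (\det A) `^ (q%:R^-1) <= complex.Re (ntr A)].
Proof.
move=> q_gt0 /posdefmx_spectral[P [l [uP l0 AE]]].
have dE : \det A = (\prod_i l i)%:C.
  rewrite AE det_unitary_conj // det_diag rmorph_prod.
  by apply: eq_bigr => i _; rewrite mxE.
have tE : ntr A = (q%:R^-1 * \sum_i l i)%:C.
  rewrite /ntr AE mxtrace_mulC mulmxA (unitarymxP uP) mul1mx mxtrace_diag.
  rewrite rmorphM fmorphV rmorph_nat rmorph_sum; congr (_ * _).
  by apply: eq_bigr => i _; rewrite mxE.
have p0 : 0 < \prod_i l i by apply: prodr_gt0 => i _; exact: l0.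
rewrite dE tE /=; split=> //.
have s0 : 0 <= \sum_i l i by apply: sumr_ge0 => i _; exact: ltW.
have qR : (0 : R) < q%:R by rewrite ltr0n.
have h2 : \prod_i l i <= (q%:R^-1 * \sum_i l i) ^+ q.
  have [] := leif_AGM (A := {: 'I_q}) (E := l) (fun i _ => ltW (l0 i)).
  by rewrite card_ord [_ / _]mulrC.
have -> : q%:R^-1 * \sum_i l i = ((q%:R^-1 * \sum_i l i) ^+ q) `^ (q%:R^-1).
  by rewrite -powR_mulrn ?mulr_ge0 ?invr_ge0 ?(ltW qR) // -powRrM mulfV ?gt_eqF // powRr1 // mulr_ge0 // invr_ge0 ltW.
by apply: ge0_ler_powR => //; rewrite ?invr_ge0 ?nnegrE ?exprn_ge0 ?mulr_ge0 ?invr_ge0 // ltW.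
Qed.

Lemma posdefmx_conj A C : C \in unitmx -> posdefmx A -> posdefmx (C *m A *m C ^t*).
Proof.
move=> uC [hA Apos]; split.
  apply/is_hermitianmxP; rewrite expr0 scale1r !adjoint_mulmx trmxCK mulmxA.
  by have /is_hermitianmxP := hA; rewrite expr0 scale1r => <-.
move=> v v0; have vC : v *m C != 0.
  by apply: contra v0 => /eqP h; rewrite -[v](mulmxK uC) h mul0mx.
by have := Apos _ vC; rewrite trmx_mul map_mxM !mulmxA.
Qed.

(* The minimum is attained at a multiple of [K^(1/2)], the equality case of AM-GM. *)
Lemma posdefmx_min K : (0 < q)%N -> posdefmx K -> exists2 A : 'M[R[i]]_q, \det A = 1 &
  ntr (A *m invmx K *m A ^t*) = (complex.Re (\det K) `^ (- q%:R^-1))%:C.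
Proof.
move=> q_gt0 hK; have [P [l [uP l0 KE]]] := posdefmx_spectral hK.
have qR : (0 : R) < q%:R by rewrite ltr0n.
have dE : \det K = (\prod_i l i)%:C.
  rewrite KE det_unitary_conj // det_diag rmorph_prod.
  by apply: eq_bigr => i _; rewrite mxE.
rewrite dE /=; set p := \prod_i l i; have p0 : 0 < p by apply: prodr_gt0 => i _; exact: l0.
(* This normalization gives determinant 1: c^(2q) is the inverse of the product of the
   eigenvalues. *)
pose c : R := Num.sqrt (p `^ (- q%:R^-1)).
have c2 : c ^+ 2 = p `^ (- q%:R^-1) by rewrite sqr_sqrtr // powR_ge0.
have c0 : 0 <= c by exact: sqrtr_ge0.
pose a i := c * Num.sqrt (l i).
have PP : P *m P ^t* = 1%:M by exact/unitarymxP.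
have PP' : P ^t* *m P = 1%:M by rewrite -(invmx_unitary uP) mulVmx // unitarymx_unit.
(* Functions of K in its own eigenbasis: they multiply entrywise and are Hermitian, and K and its
   inverse are among them. *)
pose D (x : 'I_q -> R) : 'M[R[i]]_q := P ^t* *m diag_mx (\row_i (x i)%:C) *m P.
have DM x y : D x *m D y = D (fun i => x i * y i).
  rewrite /D !mulmxA; congr (_ *m _).
  rewrite -[P ^t* *m _ *m P *m _]mulmxA PP mulmx1 -mulmxA mulmx_diag.
  by congr (_ *m diag_mx _); apply/rowP => i; rewrite !mxE rmorphM.
have Dc (x : R) : D (fun=> x) = x%:C%:M.
  have -> : D (fun=> x) = P ^t* *m (x%:C%:M) *m P.
    by congr (_ *m _ *m _); rewrite -diag_const_mx; congr diag_mx; apply/rowP => i; rewrite !mxE.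
  by rewrite -mulmxA mul_scalar_mx -scalemxAr PP' scalemx1.
have DJ x : (D x) ^t* = D x.
  rewrite /D !adjoint_mulmx trmxCK mulmxA; congr (_ *m _ *m _).
  rewrite tr_diag_mx map_diag_mx; congr diag_mx; apply/rowP => i.
  by rewrite !mxE; apply: (etrans (conjE _)); rewrite /= oppr0.
have KV : invmx K = D (fun i => (l i)^-1).
  have h : K *m D (fun i => (l i)^-1) = 1%:M.
    rewrite KE -/(D l) DM -[RHS](Dc 1); congr D; apply/funext => i.
    by rewrite mulfV // gt_eqF.
  by rewrite -[RHS]mul1mx -(mulVmx (posdefmx_unit hK)) -mulmxA h mulmx1.
exists (D a).
  rewrite /D det_unitary_conj // det_diag.
  under eq_bigr do rewrite mxE; rewrite -rmorph_prod -[RHS]/(1%:C); congr (_%:C).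
  rewrite big_split /= prodr_const card_ord.
  have s0 : 0 <= \prod_i Num.sqrt (l i) by apply: prodr_ge0 => i _; exact: sqrtr_ge0.
  apply/eqP; rewrite -sqrp_eq1 ?mulr_ge0 ?exprn_ge0 // exprMn -exprM mulnC exprM c2.
  rewrite -prodrXl; under eq_bigr do rewrite sqr_sqrtr ?ltW //.
  rewrite -/p -powR_mulrn ?powR_ge0 // -powRrM mulNr mulVf ?(gt_eqF qR) //.
  by rewrite powRN powRr1 ?ltW // mulVf // (gt_eqF p0).
rewrite KV DJ !DM (_ : (fun i => _) = fun=> c ^+ 2); last first.
  apply/funext => i; rewrite /a.
  have li : Num.sqrt (l i) ^+ 2 = l i by rewrite sqr_sqrtr // ltW.
  have l1 : l i != 0 by rewrite gt_eqF.
  transitivity (c ^+ 2 * ((l i)^-1 * Num.sqrt (l i) ^+ 2)); first by ring.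
  by rewrite li mulVf // mulr1.
rewrite Dc c2 /ntr mxtrace_scalar -[X in _ * X]mulr_natl mulKf //.
by rewrite pnatr_eq0 -lt0n.
Qed.

End PositiveMatrices.

Section Prediction.
Variables (R : realType) (q n : nat) (W Phi : R -> 'M[R[i]]_q) (B : nat -> 'M[R[i]]_q).
Hypothesis q_gt0 : (0 < q)%N.
Hypothesis hW : weight W.
Hypothesis hPhi : outer2 Phi.
Hypothesis WPhi : {ae leb R, forall t, torus t -> W t = Phi t ^t* *m Phi t}.
Hypothesis hB : taylor_coefs (fun z => invmx (disc_ext Phi z)) B.

Let LPhi : mL2 Phi. Proof. exact: hardy2_mL2 hPhi.1. Qed.
Let K := gram B n.
Let Ku : K \in unitmx. Proof. exact: gram_unit hPhi hB n. Qed.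
Let U t := invmx K *m psum B n t.

Lemma n2_sum_le (m : nat) (F : nat -> R -> 'M[R[i]]_q) : (forall j, mL2 (F j)) ->
  n2 (fun t => \sum_(0 <= j < m) F j t) <= 2 ^+ m * \sum_(0 <= j < m) n2 (F j).
Proof.
move=> LF; elim: m => [|m IH].
  rewrite big_nil mulr0 /n2 -[X in _ <= X](tint_cst (0 : R)) le_eqVlt; apply/orP; left.
  by apply/eqP; apply: tint_eq => t _; rewrite big_nil fro0.
rewrite (_ : n2 _ = n2 (fun t => \sum_(0 <= j < m) F j t + F m t)); last first.
  by apply: tint_eq => t _; rewrite big_nat_recr.
apply: (le_trans (n2D_le2 _ _)) => //; first exact: mL2_sum.
rewrite big_nat_recr //= exprS mulrDr -!mulrA; apply: lerD.
  by rewrite ler_pM2l.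
rewrite ler_pM2l // ler_peMl ?n2_ge0 //; apply: exprn_ege1; lra.
Qed.

Lemma invgram_adjoint : (invmx K) ^t* = invmx K.
Proof. by rewrite trmx_inv map_invmx gram_adjoint. Qed.

Lemma trigpoly_if S (b : bool) k (A : 'M[R[i]]_q) : (~~ b -> S k) ->
  trigpoly S (fun t => if b then 0 else expi k t *: A).
Proof.
by case: b => Sk; [exact: trigpoly0|apply: trigpoly1; exact: Sk].
Qed.

Lemma adjointZ (a : R[i]) (A : 'M[R[i]]_q) : (a *: A) ^t* = Num.conj a *: A ^t*.
Proof. by apply/matrixP => i j; rewrite !mxE rmorphM. Qed.

Let X (P : 'M[{poly R[i]}]_q) t := Phi t *m meval P (expi 1 t) - 1%:M.

(* [G^* = sum_j A_j D_j - sum_j e_(-j) P D_j], where the [A_j] are the coefficients of [P]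
   and [sum_j e_(-j) D_j] is the adjoint of [U]; the first sum removes the frequency 0. *)
Lemma predictor_approx P :
  let D j := B j ^t* *m invmx K in
  exists2 G, trigpoly (S2 n) G &
    forall t, (Phi t ^t* - U t - G t *m Phi t ^t*) ^t* = \sum_(0 <= j < n.+1)
      (Phi t *m ((B j - coefmx P j) *m D j) + X P t *m (expi (- j%:Z) t *: D j)).
Proof.
move=> D; have [s0 hs0] := meval_sum P; pose s := (s0 + n.+1)%N.
have [G [tG GE]] : exists G : R -> 'M[R[i]]_q, trigpoly (S2 n) G /\ forall t, (G t) ^t* =
    \sum_(0 <= j < n.+1) (coefmx P j *m D j - expi (- j%:Z) t *: (meval P (expi 1 t) *m D j)).
  exists (fun t => - 1%:M *m \sum_(0 <= j < n.+1) \sum_(0 <= a < s)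
    (if a == j then 0 else @expi R (j%:Z - a%:Z) t *: (coefmx P a *m D j) ^t*)); split.
    apply: trigpolyM; apply: trigpoly_sum => j; rewrite mem_index_iota => /andP[_ jn].
    apply: trigpoly_sum => a _; apply: trigpoly_if => aj; rewrite /S2 /=.
    (* The frequency j - a is negative if a > j; otherwise 1 <= j - a <= j <= n, as a = j was
       removed. Either way it lies in [S2 n]. *)
    have [ja|aj'] := ltnP j a; [left|right]; first by rewrite subr_lt0 ltz_nat.
    rewrite subzn //; move: jn aj aj'; rewrite ltnS !lez_nat => jn aj aj'.
    by rewrite subn_gt0 ltn_neqAle aj aj' /= (leq_trans (leq_subr _ _)).
  move=> t; rewrite mulNmx mul1mx -sub0r adjointB adjoint_sum trmx0 map_mx0 sub0r -sumrN.
  apply: eq_big_nat => j /andP[_ jn]; rewrite adjoint_sum -[RHS]opprB; congr (- _).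
  have js : (j < s)%N by rewrite /s (leq_trans jn) ?leq_addl.
  rewrite (hs0 s) ?leq_addr // mulmx_suml scaler_sumr.
  rewrite (bigD1_seq j) ?mem_index_iota ?iota_uniq //= eqxx trmx0 map_mx0 add0r.
  rewrite [in RHS](bigD1_seq j) ?mem_index_iota ?iota_uniq //=.
  rewrite -scalemxAl scalerA expiNK scale1r [coefmx P j *m _ + _]addrC addrK.
  apply: eq_bigr => a /negbTE ->.
  by rewrite adjointZ trmxCK expiJ opprB -scalemxAl scalerA addrC expiD.
exists G => // t; rewrite !adjointB (adjoint_mulmx (G t)) !trmxCK GE.
have -> : (U t) ^t* = \sum_(0 <= j < n.+1) expi (- j%:Z) t *: D j.
  rewrite /U adjoint_mulmx invgram_adjoint /psum adjoint_sum mulmx_suml.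
  by apply: eq_bigr => j _; rewrite adjointZ expiJ -scalemxAl.
(* The sum of the B_j D_j is K K^-1 = I, which lets Phi be distributed over the same index j as the
   other two terms. *)
have {1}-> : Phi t = \sum_(0 <= j < n.+1) Phi t *m (B j *m D j).
  rewrite -mulmx_sumr.
  have -> : \sum_(0 <= j < n.+1) B j *m D j = K *m invmx K.
    by rewrite /K /gram mulmx_suml; apply: eq_bigr => j _; rewrite mulmxA.
  by rewrite mulmxV // mulmx1.
rewrite mulmx_sumr -!sumrB; apply: eq_bigr => j _.
rewrite /X (mulmxBr (Phi t)) (mulmxBl (B j)) (mulmxBr (Phi t)) mulmxBl mul1mx.
rewrite -!scalemxAr (mulmxA (Phi t) (meval _ _)) opprB addrACA [in RHS]addrACA.
by congr (_ + _); rewrite addrC.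
Qed.

(** The constant [M] does not depend on [P], so [P] can be chosen afterwards from the accuracy
    required. *)
Lemma residual_small : exists2 M : R, 0 <= M & forall P, exists2 G, trigpoly (S2 n) G &
  n2 (fun t => Phi t ^t* - U t - G t *m Phi t ^t*) <= M * n2 (X P).
Proof.
have hC j : exists C : R, 0 <= C /\ forall t, fro (psum B j t) <= C.
  by have [_ [C C0 hC]] := mbounded_psum B j; exists C.
have [C {}hC] := choice hC.
pose D j := B j ^t* *m invmx K.
(* The first summand bounds Phi (B_j - P_j) D_j by way of [coefmxB], the second bounds X e_(-j)
   D_j. *)
pose M j := 2 * (q%:R * (q%:R * (q%:R * C j) * fro (D j)) * n2 Phi) + 2 * (q%:R * fro (D j)).
have M0 j : 0 <= M j.
  have := (hC j).1; have := n2_ge0 Phi; have := fro_ge0 (D j); rewrite /M.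
  by move: (C j) (n2 Phi) (fro _) => x y z *; rewrite addr_ge0 // !mulr_ge0.
exists (2 ^+ n.+1 * \sum_(0 <= j < n.+1) M j).
  by rewrite mulr_ge0 ?exprn_ge0 // sumr_ge0.
move=> P; have LX : mL2 (X P) by exact: mL2_residual.
have [G tG GE] := predictor_approx P; exists G => //.
pose Y1 j t := Phi t *m ((B j - coefmx P j) *m D j).
pose Y2 j t := X P t *m (expi (- j%:Z) t *: D j).
have L1 j : mL2 (Y1 j) by apply: mL2M_boundedr => //; exact: mbounded_cst.
have L2 j : mL2 (Y2 j) by apply: mL2M_boundedr => //; exact: mbounded_expi.
rewrite -n2_adjoint.
have -> : n2 (fun t => (Phi t ^t* - U t - G t *m Phi t ^t*) ^t*) =
    n2 (fun t => \sum_(0 <= j < n.+1) (Y1 j t + Y2 j t)).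
  by apply: tint_eq => t _; rewrite GE.
apply: (le_trans (n2_sum_le _ (fun j => mL2D (L1 j) (L2 j)))).
rewrite -mulrA ler_wpM2l ?exprn_ge0 // mulr_suml; apply: ler_sum => j _.
apply: (le_trans (n2D_le2 (L1 j) (L2 j))).
rewrite /M (mulrDl (2 * _)) -!(mulrA 2); apply: lerD; rewrite ler_wpM2l //.
  apply: (le_trans (n2M_boundedr LPhi (mbounded_cst _) (fro_ge0 _) (fun=> lexx _))).
  have h1 := fro_mulmx (B j - coefmx P j) (D j).
  suff h2 : fro (B j - coefmx P j) <= q%:R * C j * n2 (X P).
    have := fro_ge0 (D j); have := n2_ge0 Phi; move: h1 h2.
    move: (fro (_ *m D j)) (fro (B j - _)) (n2 Phi) (n2 (X P)) (C j) (fro (D j)).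
    move=> a b p y c d h1 h2 p0 d0.
    have -> : q%:R * (q%:R * (q%:R * c) * d) * p * y = q%:R * (q%:R * (q%:R * c * y) * d) * p.
      by ring.
    rewrite ler_wpM2r // ler_wpM2l //; apply: (le_trans h1).
    by rewrite ler_wpM2r // ler_wpM2l.
  rewrite -froN opprB (coefmxB hPhi hB).
  have bV := mbounded_expiZ (- j%:Z) (mbounded_psum B j).
  have LV := mL2M_boundedl LX bV.
  apply: (le_trans (fro_mxint_le LV)); apply: n2M_boundedl => //; first exact: (hC j).1.
  by move=> t; rewrite froZ nsq_expi mul1r; exact: (hC j).2.
apply: (n2M_boundedr LX (mbounded_expi _ _) (fro_ge0 _)) => t.
by rewrite froZ nsq_expi mul1r.
Qed.

(** The claimed I - P_S I: the element of L^2(W) that [U] represents. *)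
Let E0 t := U t *m invmx (Phi t ^t*).
Let bU : mbounded U.
Proof. by apply: mbounded_mulmx; [exact: mbounded_cst|exact: mbounded_psum]. Qed.
Let mPhi : mxmeasurable Phi. Proof. exact: mL2_measurable. Qed.

Lemma rep_error : rep Phi E0 U.
Proof.
split.
- apply: mxmeasurableM; first exact: bU.1.
  by apply: mxmeasurable_invmx; exact: mxmeasurable_adjoint.
- exact: mL2_bounded.
- apply: filterS (Phi_unit hW WPhi) => t u Dt.
  by rewrite /E0 mulmxKV //; exact: u.
Qed.

Lemma rep_one : rep Phi (fun=> 1%:M) (fun t => Phi t ^t*).
Proof.
have := rep_bounded LPhi (mbounded_cst 1%:M).
by under [X in rep _ _ X]eq_fun do rewrite mul1mx.
Qed.

(** [S2 n] consists of the nonzero integers up to n, precisely where [psum n] Phi has no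
    frequency. *)
Lemma error_ortho H Y : rep Phi H Y -> Mspace W (S2 n) H ->
  mxint (fun t => U t *m Y t ^t*) = 0.
Proof.
apply: (ortho_Mspace q_gt0 hW LPhi WPhi) => // k A kS.
have kn : k <= n%:Z /\ k != 0.
  case: kS => [k0|/andP[k1 k2]]; first by rewrite (le_trans (ltW k0)) // lt_eqF.
  by rewrite k2 gt_eqF // (lt_le_trans _ k1).
have Le : mL2 (fun t => expi (- k) t *: (psum B n t *m Phi t)).
  by apply: mL2_expi; apply: mL2M_boundedl => //; exact: mbounded_psum.
rewrite (@mxint_eq _ _ _ (fun t =>
    invmx K *m ((expi (- k) t *: (psum B n t *m Phi t)) *m A ^t*))); last first.
  move=> t _; rewrite adjoint_mulmx trmxCK adjointZ expiJ /U -[LHS]mulmxA.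
  congr (_ *m _); rewrite -[RHS]scalemxAl -2![in LHS]scalemxAr; congr (_ *: _).
  by rewrite mulmxA.
have LA : mL2 (fun t => (expi (- k) t *: (psum B n t *m Phi t)) *m A ^t*).
  by apply: mL2M_boundedr => //; exact: mbounded_cst.
rewrite mxint_mull; last exact: mL2_integrable.
rewrite mxint_mulr; last exact: mL2_integrable.
rewrite (mxint_psum_mul hPhi hB kn.1) (negbTE kn.2).
by rewrite raddf0 mul0mx mulmx0.
Qed.

Let G0 t : 'M[R[i]]_q := 1%:M - E0 t.

Lemma rep_predictor : rep Phi G0 (fun t => Phi t ^t* - U t).
Proof. exact: repB rep_one rep_error. Qed.

Lemma predictor_Mspace : Mspace W (S2 n) G0.
Proof.
apply/(MspaceP q_gt0 hW LPhi WPhi (S2 n) rep_predictor) => e e0.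
have [M M0 hM] := residual_small.
have d0 : 0 < e / (M + 1) by rewrite divr_gt0 // ltr_wpDl.
have [P [_ hP]] := outer_cyclic q_gt0 hPhi d0.
have [G tG hG] := hM P; exists G => //; apply: (le_trans hG).
apply: (le_trans (ler_wpM2l M0 hP)); rewrite mulrCA ger_pMr //.
by rewrite ler_pdivrMr ?mul1r ?lerDl // ltr_wpDl.
Qed.

Lemma predictor_orthproj : is_orthproj W (S2 n) (fun=> 1%:M) G0.
Proof.
split=> [|H hH]; first exact: predictor_Mspace.
have -> : (fun t => 1%:M - G0 t) = E0 by apply/funext => t; rewrite /G0 subKr.
have rH := inL2_rep q_gt0 LPhi WPhi hH.1.
rewrite (rep_inner hW WPhi rep_error rH); exact: error_ortho rH hH.
Qed.

(** The choice made by [xget] is meaningful because the explicit [G0] is a projection; any other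
    choice is compared with it below. *)
Lemma orthprojP : is_orthproj W (S2 n) (fun=> 1%:M) (orthproj W (S2 n) (fun=> 1%:M)).
Proof. by apply: (@xgetPex _ _ (is_orthproj W (S2 n) (fun=> 1%:M))); exists G0; exact: predictor_orthproj. Qed.

(** The difference of two projections lies in the closed module and is orthogonal to it, so it has
    norm 0. *)
Lemma orthproj_predictor :
  {ae leb R, forall t, torus t -> orthproj W (S2 n) (fun=> 1%:M) t = G0 t}.
Proof.
have [hP oP] := orthprojP; have [hG oG] := predictor_orthproj.
move: hP oP; set P := orthproj _ _ _ => hP oP.
have hH := MspaceB q_gt0 hW LPhi WPhi hP hG.
have rP := inL2_rep q_gt0 LPhi WPhi hP.1.
have rH := repB rP rep_predictor; have [_ LP _] := rP; have [_ LH _] := rH.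
pose Y t := P t *m Phi t ^t* - (Phi t ^t* - U t).
have h1 := oP _ hH; have h2 := error_ortho rH hH.
have r1 := repB rep_one rP; have [_ L1 _] := r1.
rewrite (rep_inner hW WPhi r1 rH) in h1.
(* The representative [Y] of the difference is also the difference of the two errors, each of which
   is orthogonal to it. *)
have Z : mxint (fun t => Y t *m Y t ^t*) = 0.
  transitivity (mxint (fun t => U t *m Y t ^t*) -
      mxint (fun t => (Phi t ^t* - P t *m Phi t ^t*) *m Y t ^t*)); last by rewrite h1 h2 subr0.
  rewrite -mxintB.
  - apply: mxint_eq => t _; rewrite -mulmxBl; congr (_ *m _).
    by rewrite /Y !opprB addrCA addrC.
  - by apply: mL2M_integrable; [exact: mL2_bounded|exact: mL2_adjoint].
  - by apply: mL2M_integrable => //; exact: mL2_adjoint.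
have := rep_eq0 hW WPhi rH.
have -> : n2 (fun t => P t *m Phi t ^t* - (Phi t ^t* - U t)) = 0.
  by rewrite -(mxint_gram LH) Z raddf0.
move=> /(_ erefl); apply: filterS => t h Dt.
by apply/eqP; rewrite -subr_eq0; apply/eqP; exact: h.
Qed.

(** The predictor, represented by Phi^* - U, is itself orthogonal to [U]. So one factor [U] may be
    traded for Phi^*, and the mean of [psum n] Phi is I. *)
Lemma error_gram : mxint (fun t => U t *m U t ^t*) = invmx K.
Proof.
have h := error_ortho rep_predictor predictor_Mspace.
have LU := mL2_bounded bU.
transitivity (mxint (fun t => U t *m Phi t) -
    mxint (fun t => U t *m (Phi t ^t* - U t) ^t*)).
  rewrite -mxintB.
  - by apply: mxint_eq => t _; rewrite adjointB trmxCK mulmxBr subKr.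
  - exact: mL2M_integrable.
  - apply: mL2M_integrable => //; apply: mL2_adjoint.
    by apply: mL2B => //; exact: mL2_adjoint.
rewrite h subr0.
have Lp : mL2 (fun t => psum B n t *m Phi t).
  by apply: mL2M_boundedl => //; exact: mbounded_psum.
rewrite (@mxint_eq _ _ _ (fun t => invmx K *m (psum B n t *m Phi t))).
  rewrite mxint_mull; last exact: mL2_integrable.
  rewrite (@mxint_eq _ _ _ (fun t => expi (- 0) t *: (psum B n t *m Phi t))).
    by rewrite (mxint_psum_mul hPhi hB) // eqxx mulmx1.
  by move=> t _; rewrite oppr0 expi0 scale1r.
by move=> t _; rewrite mulmxA.
Qed.

Lemma Delta_gram : Delta W (S2 n) = invmx K.
Proof.
have [hP _] := orthprojP.
have rE : rep Phi (fun t => 1%:M - orthproj W (S2 n) (fun=> 1%:M) t) U.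
  apply: rep_taeeq rep_error.
    by apply: mxmeasurableB; [exact: mxmeasurable_cst|exact: hP.1.1].
  by apply: filterS orthproj_predictor => t h Dt; rewrite h // /G0 subKr.
by rewrite /Delta (rep_inner hW WPhi rE rE) error_gram.
Qed.

Lemma mxint_adjoint (F : R -> 'M[R[i]]_q) : mxintegrable F ->
  mxint (fun t => F t ^t*) = (mxint F) ^t*.
Proof.
move=> Fi; apply/matrixP => i j; rewrite !mxE; apply: complex_ext.
  by rewrite [RHS]ReJ /=; apply: tint_eq => t _; rewrite !mxE; exact: ReJ.
rewrite [RHS]ImJ /= -tintN; last exact: (Fi j i).2.
by apply: tint_eq => t _; rewrite !mxE; exact: ImJ.
Qed.

Lemma adjoint0 : (0 : 'M[R[i]]_q) ^t* = 0.
Proof. by rewrite trmx0 map_mx0. Qed.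

Lemma mL2_gram_integrable (V Y : R -> 'M[R[i]]_q) : mL2 V -> mL2 Y ->
  mxintegrable (fun t => V t *m Y t ^t*).
Proof. by move=> LV LY; apply: mL2M_integrable => //; exact: mL2_adjoint. Qed.

Lemma pythagoras (V Y : R -> 'M[R[i]]_q) : mL2 V -> mL2 Y ->
  mxint (fun t => V t *m Y t ^t*) = 0 -> n2 (fun t => V t - Y t) = n2 V + n2 Y.
Proof.
move=> LV LY VY; rewrite -!mxint_gram //; last exact: mL2B.
have YV : mxint (fun t => Y t *m V t ^t*) = 0.
  rewrite -adjoint0 -VY -mxint_adjoint; last exact: mL2_gram_integrable.
  by apply: mxint_eq => t _; rewrite adjoint_mulmx trmxCK.
have LD := mL2B LV LY.
have -> : mxint (fun t => (V t - Y t) *m (V t - Y t) ^t*) =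
    mxint (fun t => V t *m V t ^t*) + mxint (fun t => Y t *m Y t ^t*).
  transitivity (mxint (fun t => V t *m V t ^t* - V t *m Y t ^t*) -
      mxint (fun t => Y t *m V t ^t* - Y t *m Y t ^t*)).
    rewrite -mxintB.
    - by apply: mxint_eq => t _; rewrite adjointB mulmxBl !mulmxBr.
    - move=> i j; have := mL2_gram_integrable LV LD => /(_ i j).
      by apply: cintegrable_eq => t _; rewrite adjointB mulmxBr.
    - move=> i j; have := mL2_gram_integrable LY LD => /(_ i j).
      by apply: cintegrable_eq => t _; rewrite adjointB mulmxBr.
  rewrite !mxintB; try exact: mL2_gram_integrable.
  by rewrite VY YV subr0 sub0r opprK.
by rewrite mxtraceD ReD.
Qed.

Lemma n2_error (A : 'M[R[i]]_q) :
  q%:R^-1 * n2 (fun t => A *m U t) = complex.Re (ntr (A *m invmx K *m A ^t*)).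
Proof.
have LU := mL2_bounded bU.
have LAU : mL2 (fun t => A *m U t) by apply: mL2M_boundedl => //; exact: mbounded_cst.
rewrite -mxint_gram // Re_ntr; congr (_ * complex.Re (\tr _)).
have Ui : mxintegrable (fun t => U t *m U t ^t*) by exact: mL2_gram_integrable.
have LA : mxintegrable (fun t => U t *m (A *m U t) ^t*) by exact: mL2_gram_integrable.
rewrite (@mxint_eq _ _ _ (fun t => A *m (U t *m (A *m U t) ^t*))); last first.
  by move=> t _; rewrite !mulmxA.
rewrite mxint_mull // -mulmxA; congr (_ *m _).
rewrite (@mxint_eq _ _ _ (fun t => (U t *m U t ^t*) *m A ^t*)); last first.
  by move=> t _; rewrite adjoint_mulmx !mulmxA.
by rewrite mxint_mulr // error_gram.
Qed.

Lemma delta_gram : delta W (S2 n) = complex.Re (\det K) `^ (- q%:R^-1).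
Proof.
have hK : posdefmx K by exact: gram_posdef hPhi hB n.
have [kE k0 _] := posdefmx_AGM q_gt0 hK; set k := complex.Re (\det K) in kE k0 *.
have lower r : (exists (A : 'M[R[i]]_q) (F : R -> 'M[R[i]]_q),
    [/\ \det A = 1, Mspace W (S2 n) F & r = L2norm W (fun t => A - F t) ^+ 2]) ->
    k `^ (- q%:R^-1) <= r.
  move=> [A [F [dA hF ->]]].
  have hH := MspaceB q_gt0 hW LPhi WPhi hF (MspaceM q_gt0 hW LPhi WPhi A predictor_Mspace).
  have rH := inL2_rep q_gt0 LPhi WPhi hH.1; have [_ LY _] := rH.
  have LAU : mL2 (fun t => A *m U t).
    by apply: mL2M_boundedl; [exact: mL2_bounded|exact: mbounded_cst].
  (* The error A [E0] is orthogonal to the second term, which lies in the closed module, so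
     Pythagoras discards the latter. *)
  have -> : (fun t => A - F t) = (fun t => A *m E0 t - (F t - A *m G0 t)).
    by apply/funext => t; rewrite /G0 mulmxBr mulmx1 opprB addrCA addrA subrK.
  rewrite (rep_norm hW WPhi (repB (repM A rep_error) rH)).
  rewrite pythagoras //; last first.
    rewrite (@mxint_eq _ _ _ (fun t => A *m (U t *m ((F t - A *m G0 t) *m Phi t ^t*) ^t*))).
      rewrite mxint_mull; last by apply: mL2_gram_integrable => //; exact: mL2_bounded.
      by rewrite (error_ortho rH hH) mulmx0.
    by move=> t _; rewrite -[LHS]mulmxA.
  have := n2_error A; have := n2_ge0 (fun t => (F t - A *m G0 t) *m Phi t ^t*).
  move: (n2 (fun t => A *m U t)) (n2 _) => x y y0 xE; rewrite mulrDr xE; apply: ler_wpDr.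
    by rewrite mulr_ge0 ?invr_ge0.
  have uA : A \in unitmx by rewrite unitmxE dA unitr1.
  (* Written as a congruence of K by A K^-1, so that positivity of K itself suffices; its
     determinant is then 1 / k. *)
  have -> : A *m invmx K *m A ^t* = (A *m invmx K) *m K *m (A *m invmx K) ^t*.
    by rewrite adjoint_mulmx invgram_adjoint mulmxKV // mulmxA.
  have uC : A *m invmx K \in unitmx by rewrite unitmx_mul uA unitmx_inv.
  have [_ _] := posdefmx_AGM q_gt0 (posdefmx_conj uC hK).
  apply: le_trans; rewrite le_eqVlt; apply/orP; left; apply/eqP.
  have -> : complex.Re (\det (A *m invmx K *m K *m (A *m invmx K) ^t*)) = k^-1.
    rewrite mulmxKV // adjoint_mulmx invgram_adjoint !det_mulmx det_map_mx det_tr dA.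
    by rewrite rmorph1 mulr1 mul1r det_inv kE -fmorphV.
  by rewrite -(powR_inv1 (ltW k0)) -powRrM mulN1r.
have [A dA AE] := posdefmx_min q_gt0 hK.
have mem : exists (A : 'M[R[i]]_q) (F : R -> 'M[R[i]]_q), [/\ \det A = 1, Mspace W (S2 n) F &
    k `^ (- q%:R^-1) = L2norm W (fun t => A - F t) ^+ 2].
  exists A, (fun t => A *m G0 t); split=> //.
    exact: (MspaceM q_gt0 hW LPhi WPhi A predictor_Mspace).
  have -> : (fun t => A - A *m G0 t) = (fun t => A *m E0 t).
    by apply/funext => t; rewrite /G0 mulmxBr mulmx1 subKr.
  by rewrite (rep_norm hW WPhi (repM A rep_error)) n2_error AE.
apply/eqP; rewrite eq_le; apply/andP; split.
  by apply: ge_inf => //; exists (k `^ (- q%:R^-1)) => r; exact: lower.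
by apply: lb_le_inf => [|r]; [exists (k `^ (- q%:R^-1))|exact: lower].
Qed.

Lemma orthproj_L2eq : L2eq W (orthproj W (S2 n) (fun=> 1%:M)) G0.
Proof.
have [hP _] := orthprojP; split; [exact: hP.1|exact: predictor_Mspace.1|].
exact: orthproj_predictor.
Qed.

End Prediction.

Theorem theorem5p4 (R : realType) (q n : nat) (q_gt0 : (0 < q)%N)
    (n_gt0 : (0 < n)%N) (W Phi : R -> 'M[R[i]]_q) (B : nat -> 'M[R[i]]_q)
    (hW : logdet_weight W) (hPhi : outer_factor W Phi)
    (hB : taylor_coefs (fun z => invmx (disc_ext Phi z)) B) :
  [/\ L2eq W (orthproj W (S2 n) (fun=> 1%:M))
        (fun t => 1%:M -
           invmx (\sum_(0 <= j < n.+1) B j *m B j ^t*) *m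
           (\sum_(0 <= j < n.+1) expi j%:Z t *: B j) *m invmx (Phi t ^t*)),
      Delta W (S2 n) = invmx (\sum_(0 <= j < n.+1) B j *m B j ^t*) &
      delta W (S2 n) =
        complex.Re (\det (\sum_(0 <= j < n.+1) B j *m B j ^t*))
          `^ (- q%:R^-1)].
Proof.
have [outPhi WPhi _] := hPhi; have wW := hW.1; split.
- exact: orthproj_L2eq q_gt0 wW outPhi WPhi hB.
- exact: Delta_gram q_gt0 wW outPhi WPhi hB.
- exact: delta_gram q_gt0 wW outPhi WPhi hB.
Qed.
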